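(* Let $p>1$, let $\Omega\subset\mathbb{R}^n$ be open and bounded, and let $f\in L^1(\Omega)$. Suppose $u\in W^{1,\max\{1,p-1\}}(\Omega)$ solves $$\operatorname{div}(|Du|^{p-2}Du)=f$$ in the weak sense on $\Omega$, and that for every $1\le i\le n$ there exist constants $\sigma_i\in\{1,-1\}$ and $L_i\in\mathbb{R}$ such that $$\sigma_i\,\partial_i u\ge L_i\quad\text{a.e. in }\Omega.$$ Then $u\in W^{1,p}_{\mathrm{loc}}(\Omega)$, and for every open $\Omega'$ compactly contained in $\Omega$ there exists a constant $C>0$, depending only on $n$, $R$ and $\operatorname{dist}(\Omega',\partial\Omega)$, where $R>0$ is such that $\Omega\subset B_R(0)$, for which $$\int_{\Omega'}|Du|^p\,dx\le C\left(\|f\|_{L^1(\Omega)}+\|Du\|_{L^{p-1}(\Omega)}^{p-1}\right)\left(\|u\|_{L^1(\Omega)}+|(L_1,\dots,L_n)|\right).$$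
   Context: The equation is understood in the weak (distributional) sense: $-\int_\Omega |Du|^{p-2}Du\cdot D\varphi\,dx=\int_\Omega f\varphi\,dx$ for all $\varphi\in C_c^\infty(\Omega)$, where $|Du|^{p-2}Du$ is set equal to $0$ where $Du=0$. The notation $\|Du\|_{L^{p-1}(\Omega)}^{p-1}$ means $\int_\Omega|Du|^{p-1}dx$ (also when $p-1<1$). $|\cdot|$ is the Euclidean norm. *)

(* Defs.v *)
From HB Require Import structures.
From mathcomp Require Import all_boot all_order all_algebra.
From mathcomp Require Import all_classical all_reals all_analysis.
From mathcomp Require Import measurable_realfun.

Set Implicit Arguments.
Unset Strict Implicit.
Unset Printing Implicit Defensive.

Import Order.TTheory GRing.Theory Num.Theory.
Import numFieldNormedType.Exports.

Local Open Scope classical_set_scope.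
Local Open Scope ring_scope.

(* R^n is 'rV[R]_n, with its Borel sigma-algebra.  The library norm on 'rV[R]_n
   is the sup norm; only the topology, the bounded sets and the directional
   derivatives it induces are used, and these agree with the Euclidean ones.
   All lengths, balls and distances are Euclidean (enorm). *)

Definition rV_display : measure_display.
Proof. exact: default_measure_display. Qed.

Section rV_borel.
Context {R : realType} (n : nat).

HB.instance Definition _ := @isMeasurable.Build rV_display 'rV[R]_n
  <<s @open 'rV[R]_n >> (@sigma_algebra0 _ setT _) (@sigma_algebraC _ _)
  (@sigma_algebra_bigcup _ setT _).

Lemma open_measurable_rV (A : set 'rV[R]_n) : open A -> measurable A.
Proof. exact: sub_sigma_algebra. Qed.

End rV_borel.

Section lebesgue_rV.
Context {R : realType}.

Definition rV_cons n (z : measurableTypeR R * 'rV[R]_n) : 'rV[R]_n.+1 :=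
  row_mx (z.1 : R)%:M z.2.

Lemma rV_cons0 n (z : measurableTypeR R * 'rV[R]_n) :
  rV_cons z ord0 ord0 = z.1.
Proof.
have /(congr1 (rV_cons z ord0)) -> : ord0 = lshift n (ord0 : 'I_1).
  exact/val_inj.
by apply: etrans (row_mxEl _ _ _ _) _; rewrite mxE eqxx mulr1n.
Qed.

Lemma rV_consS n (z : measurableTypeR R * 'rV[R]_n) (j : 'I_n) :
  rV_cons z ord0 (lift ord0 j) = z.2 ord0 j.
Proof.
have /(congr1 (rV_cons z ord0)) -> : lift ord0 j = rshift 1 j.
  exact/val_inj.
exact: row_mxEr.
Qed.

Lemma rV_cons_ball n (c : 'rV[R]_n.+1) (e : R) : 0 < e ->
  @rV_cons n @^-1` ball c e =
  ball (c ord0 ord0) e `*` ball (\row_j c ord0 (lift ord0 j)) e.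
Proof.
move=> e0; apply/seteqP; split=> [z [_ H]|z [/= Hx [_ Hy]]] /=; split => //=.
- by have := H ord0 ord0; rewrite rV_cons0.
- apply: (conj e0) => i j; rewrite (ord1 i) mxE; have := H ord0 (lift ord0 j).
  by rewrite rV_consS.
- move=> i j; rewrite (ord1 i); case: (unliftP ord0 j) => [k ->|->].
    by rewrite rV_consS; have := Hy ord0 k; rewrite mxE.
  by rewrite rV_cons0.
Qed.

Lemma open_bigcup_rV_ball n (A : set 'rV[R]_n) : open A ->
  A = \bigcup_(p in [set p : 'rV[rat]_n * nat |
                      ball (map_mx ratr p.1 : 'rV[R]_n) p.2.+1%:R^-1 `<=` A])
        ball (map_mx ratr p.1 : 'rV[R]_n) p.2.+1%:R^-1.
Proof.
move=> oA; apply/seteqP; split=> [x Ax|x [[q k]/= qkA]]; last exact: qkA.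
have /nbhs_ballP[/= e e0 xeA] : nbhs x A by exact: open_nbhs_nbhs.
pose k := Num.truncn (2 / e).
have k0 : (0 : R) < k.+1%:R^-1 by rewrite invr_gt0.
have k2e : (k.+1%:R^-1 : R) < e / 2.
  rewrite -[ltRHS]invrK ltf_pV2 ?posrE ?invr_gt0 ?divr_gt0// invf_div.
  by rewrite truncnS_gt.
have /choice[q qP] : forall j : 'I_n, exists q : rat,
    ratr q \in `](x ord0 j - k.+1%:R^-1), (x ord0 j + k.+1%:R^-1)[.
  move=> j; have /rat_in_itvoo[q] :
    x ord0 j - k.+1%:R^-1 < x ord0 j + k.+1%:R^-1.
    by rewrite ltrBlDr -addrA ltrDl addr_gt0.
  by exists q.
have qx : ball (map_mx ratr (\row_j q j) : 'rV[R]_n) k.+1%:R^-1 x.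
  split => // i j; rewrite (ord1 i) !mxE /ball/=.
  have := qP j; rewrite in_itv/= => /andP[? ?].
  by rewrite ltr_distl; apply/andP; split; rewrite 1?ltrBlDr // -ltrBlDr.
exists (\row_j q j, k) => //= y qy; apply: xeA.
by apply: (@le_ball _ _ _ (k.+1%:R^-1 + k.+1%:R^-1));
  [rewrite (splitr e) lerD// ltW|apply: ball_triangle qy; exact: ball_sym].
Qed.

Lemma measurable_rV_cons n : measurable_fun [set: measurableTypeR R * 'rV[R]_n]
  (@rV_cons n).
Proof.
apply: (@measurability _ _ _ _ _ _ (@open 'rV[R]_n.+1)) => //.
move=> _ [A oA <-]; rewrite setTI (open_bigcup_rV_ball oA) preimage_bigcup.
rewrite bigcup_mkcond; apply: countable_bigcupT_measurable => //.
move=> [q k]; case: ifPn => _; last exact: measurable0.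
rewrite rV_cons_ball//; apply: measurableX.
  exact: measurable_ball.
by apply: open_measurable_rV; exact: ball_open.
Qed.

(* n-dimensional Lebesgue measure as an iterated product: the image of
   lebesgue_measure (x) lebesgue_rV n under R * R^n ~ R^(n+1). *)
Fixpoint lebesgue_rV n : set 'rV[R]_n -> \bar R :=
  match n with
  | 0 => \d_(0 : 'rV[R]_0)
  | n.+1 => pushforward (product_measure1 lebesgue_measure (@lebesgue_rV n))
              (@rV_cons n)
  end.

Let ball_sigma_finite n (m : set 'rV[R]_n -> \bar R) :
  (forall e, (m (ball (0%R : 'rV[R]_n) e) < +oo)%E) ->
  sigma_finite [set: 'rV[R]_n] m.
Proof.
move=> mb; exists (fun k => ball (0 : 'rV[R]_n) k.+1%:R).
  apply/seteqP; split => // x _.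
  exists (Num.truncn `|x|) => //=; rewrite -ball_normE /= sub0r normrN.
  exact: truncnS_gt.
by move=> k; split => //; apply: open_measurable_rV; exact: ball_open.
Qed.

Let lebesgue_rV_spec n :
  exists2 m : {sigma_finite_measure set 'rV[R]_n -> \bar R},
  m = @lebesgue_rV n :> (set _ -> _) &
  forall e, (m (ball (0%R : 'rV[R]_n) e) < +oo)%E.
Proof.
elim: n => [|n [m mE mb]].
  have fb e : (\d_(0%R : 'rV[R]_0) (ball (0%R : 'rV[R]_0) e) < +oo :> \bar R)%E.
    by rewrite /= diracE ltry.
  pose F := Measure_isSigmaFinite.Build _ _ _ (\d_(0 : 'rV[R]_0))
    (ball_sigma_finite fb).
  pose M : {sigma_finite_measure set 'rV[R]_0 -> \bar R} :=
    HB.pack (\d_(0 : 'rV[R]_0)) F.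
  by exists M.
have mc := @measurable_rV_cons n.
pose m' : {measure set 'rV[R]_n.+1 -> \bar R} :=
  measure_function_pushforward__canonical__measure_function_Measure
    (product_measure1 lebesgue_measure m) mc.
have m'b e : (m' (ball (0%R : 'rV[R]_n.+1) e) < +oo)%E.
  have [e0|e0] := leP e 0.
    rewrite (_ : ball _ _ = set0).
      by rewrite measure0 ltry.
    by rewrite -subset0 => x [+ _]; rewrite ltNge e0.
  have m1b x : measurable (ball x e : set (measurableTypeR R)).
    exact: measurable_ball.
  have mnb (x : 'rV[R]_n) : measurable (ball x e).
    by apply: open_measurable_rV; exact: ball_open.
  rewrite /m' /= /pushforward rV_cons_ball// product_measure1E//.
  have -> : \row_j (0 : 'rV[R]_n.+1) ord0 (lift ord0 j) = 0.
    by apply/rowP => j; rewrite !mxE.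
  have mE1 := lebesgue_measure_ball ((0 : 'rV[R]_n.+1) ord0 ord0) (ltW e0).
  apply: lte_mul_pinfty; [exact: measure_ge0| |exact: mb].
  by apply: (eq_ind_r (fun y => y \is a fin_num) _ mE1).
pose F := Measure_isSigmaFinite.Build _ _ _ m' (ball_sigma_finite m'b).
pose M : {sigma_finite_measure set 'rV[R]_n.+1 -> \bar R} :=
  HB.pack (m' : set _ -> \bar R) m' F.
exists M => //; rewrite [RHS]/= -mE//.
Qed.

Let lebesgue_rV0 n : @lebesgue_rV n set0 = 0%E.
Proof. by have [m <- _] := lebesgue_rV_spec n; exact: measure0. Qed.

Let lebesgue_rV_ge0 n A : (0 <= @lebesgue_rV n A)%E.
Proof. by have [m <- _] := lebesgue_rV_spec n; exact: measure_ge0. Qed.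

Let lebesgue_rV_sigma_additive n : semi_sigma_additive (@lebesgue_rV n).
Proof.
by have [m <- _] := lebesgue_rV_spec n; exact: measure_semi_sigma_additive.
Qed.

HB.instance Definition _ n := isMeasure.Build _ _ _ (@lebesgue_rV n)
  (@lebesgue_rV0 n) (@lebesgue_rV_ge0 n) (@lebesgue_rV_sigma_additive n).

Let lebesgue_rV_sigma_finite n : sigma_finite setT (@lebesgue_rV n).
Proof. by have [m <- _] := lebesgue_rV_spec n; exact: sigma_finiteT. Qed.

HB.instance Definition _ n := Measure_isSigmaFinite.Build _ _ _ (@lebesgue_rV n)
  (@lebesgue_rV_sigma_finite n).


End lebesgue_rV.

Section pde.
Context {R : realType} {n : nat}.
Implicit Types (Omega A B : set 'rV[R]_n) (u f phi : 'rV[R]_n -> R)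
  (Du : 'rV[R]_n -> 'rV[R]_n) (x xi : 'rV[R]_n).

Local Notation mu := (@lebesgue_rV R n).

Definition enorm x : R := Num.sqrt (\sum_(i < n) x ord0 i ^+ 2).

Definition eball x (r : R) : set 'rV[R]_n := [set y | enorm (y - x) < r].

Definition boundary A : set 'rV[R]_n := closure A `\` interior A.

(* Since inf set0 = 0, this is only meaningful for nonempty A and B. *)
Definition set_dist A B : R :=
  inf [set d | exists x y, [/\ A x, B y & d = enorm (x - y)]].

Definition compactly_contained A Omega :=
  compact (closure A) /\ closure A `<=` Omega.

(* Membership in L^q(Omega), through extension by 0 outside Omega. *)
Definition Lp_on Omega (q : R) f : Prop := f \_ Omega \in Lfun mu q%:E.

Definition partial (i : 'I_n) f : 'rV[R]_n -> R := 'D_(delta_mx ord0 i) f.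

(* C^oo: all iterated partial derivatives exist and are continuous. *)
Definition smooth f := forall s : seq 'I_n,
  continuous (foldr partial f s) /\
  forall i x, derivable (foldr partial f s) x (delta_mx ord0 i).

Definition test_function Omega phi :=
  smooth phi /\ compactly_contained [set x | phi x != 0] Omega.

Definition weak_gradient Omega u Du := forall phi, test_function Omega phi ->
  forall i, \int[mu]_(x in Omega) (u x * partial i phi x) =
            - \int[mu]_(x in Omega) (Du x ord0 i * phi x).

(* u is in W^{1,q}(Omega) and its weak gradient is Du. *)
Definition sobolev Omega (q : R) u Du :=
  [/\ Lp_on Omega q u, forall i, Lp_on Omega q (fun x => Du x ord0 i) &
      weak_gradient Omega u Du].

Definition sobolev_loc Omega (q : R) u Du :=
  forall A, open A -> compactly_contained A Omega -> sobolev A q u Du.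

(* |xi|^{p-2} xi; it vanishes at xi = 0, also when p < 2. *)
Definition p_flux (p : R) xi : 'rV[R]_n := (enorm xi `^ (p - 2)) *: xi.

(* div(|Du|^{p-2} Du) = f in the sense of distributions on Omega. *)
Definition weak_p_laplace Omega (p : R) Du f :=
  forall phi, test_function Omega phi ->
  - (\int[mu]_(x in Omega)
       (\sum_(i < n) p_flux p (Du x) ord0 i * partial i phi x)) =
  \int[mu]_(x in Omega) (f x * phi x).

End pde.

(* Main.v *)
(* The idea is to test the equation with [eta * u_e], where [eta] is a cutoff on
   a small box of side comparable to [h] and [u_e] is a mollification of [u].

   The sup of [u_e] on the box is controlled by the L^1 norm of [u] and the
   constants [L_i], with no information on the size of [Du].  The
   difference of the values of [u_e] and of an average of [u] at scale [h] is
   [u] integrated against a difference of two product bumps; changing one factor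
   at a time, this difference telescopes into partial derivatives of nonnegative
   test functions, so the bounds [sigma_i d_i u >= L_i] give a one-sided
   estimate, and moving the average to either side of the point gives the other
   one: [|u_e| <= (C / h) ^ n * ||u||_1 + 5 h * sum_i |L_i|].

   Hence [sum_i int eta F_i (d_i u)_e], with [F = |Du|^(p-2) Du], is bounded
   independently of [e].  To let [e] tend to [0] write
   [sigma_i d_i u = L_i + g_i] with [g_i >= 0].  Since [sigma_i F_i] is negative
   only where [sigma_i d_i u] lies between [L_i] and [0], one has
   [sigma_i F_i >= - |L_i| |Du|^(p-2)]; truncating [F] at [|Du| <= k] therefore
   costs only tails of integrable functions.  First [e -> 0], then [k -> oo].
   Finally [Omega'] is covered by finitely many boxes of side proportional to its
   distance to the boundary.

   All test functions are products of functions of one variable, so that their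
   smoothness reduces to one-dimensional calculus. *)
Require Import Defs.
From mathcomp Require Import all_boot all_order all_algebra.
From mathcomp Require Import all_classical all_reals all_analysis.
From mathcomp Require Import measurable_realfun ring lra.

Set Implicit Arguments.
Unset Strict Implicit.
Unset Printing Implicit Defensive.

Import Order.TTheory GRing.Theory Num.Theory.
Import numFieldNormedType.Exports.

Local Open Scope classical_set_scope.
Local Open Scope ring_scope.

(** * One-dimensional bumps *)

(** A priori the flux is merely integrable, so [eta * u] is not admissible and [F_i * d_i u] need
    not be integrable. Even [eta * u_e] is never shown to be smooth: for each fixed [y] the equation
    is tested with [eta] times the mollifying kernel based at [y], the result is integrated against
    [u y], and Fubini produces all mollified terms. Mollification enters only through the weak limit
    of [int a * g_e] with [a] bounded and integrable. The flux itself is unbounded, which is what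
    forces the truncation at [|Du| <= k]. Where [|Du| > k] one must control [|Du|^(p-2)] at [x]
    times an average of [g_i] around [x]. For [w > k >= 1] and [t >= 0], the inequality [w^(p-2) * t
    <= w^(p-1) + t^max(1,p-1) * 1_(t > k)] separates the two points, and the assumed integrability
    exponent [max(1, p-1)] is exactly what makes both resulting tails vanish. *)

Section smooth1.
Context {R : realType}.
Implicit Types (g h : R -> R) (q : {poly R}).

(** Derivatives are carried as witnesses of [is_derive] rather than as iterates of [derive1], so
    that closure under products and affine substitutions is an induction on the order alone. *)
Fixpoint ndiff (k : nat) g : Prop :=
  if k is k'.+1 then
    exists2 g', (forall x : R, is_derive x 1 g (g' x)) & ndiff k' g'
  else True.

Definition smooth1 g := forall k, ndiff k g.

Lemma ndiffW k g : ndiff k.+1 g -> ndiff k g.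
Proof. by elim: k g => [//|k IH] g [g' gg' /IH]; exists g'. Qed.

Lemma derive1_is_derive g g' : (forall x : R, is_derive x 1 g (g' x)) ->
  g^`()%classic = g'.
Proof. by move=> gg'; apply/funext => x; rewrite derive1E; case: (gg' x). Qed.

Lemma smooth1_is_derive g (x : R) : smooth1 g -> is_derive x 1 g (g^`()%classic x : R).
Proof. by case/(_ 1) => g' gg' _; rewrite (derive1_is_derive gg'). Qed.

Lemma smooth1_derive1 g : smooth1 g -> smooth1 (g^`()%classic).
Proof. by move=> sg k; case: (sg k.+1) => g' gg'; rewrite (derive1_is_derive gg'). Qed.

Lemma smooth1_continuous g : smooth1 g -> continuous g.
Proof.
move=> sg x; apply/differentiable_continuous/derivable1_diffP.
by have [] := smooth1_is_derive x sg.
Qed.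

(** A coinduction principle: membership in some class stable under differentiation suffices. It
    spares closed formulas for the iterated derivatives of [flat]. *)
Lemma smooth1_class (S : set (R -> R)) :
  (forall g, S g -> exists2 g', (forall x : R, is_derive x 1 g (g' x)) & S g') ->
  forall g, S g -> smooth1 g.
Proof.
move=> HS g Sg k; elim: k g Sg => [//|k IH] g /HS[g' gg' Sg'].
by exists g' => //; exact: IH.
Qed.

Lemma smooth1_cst c : smooth1 (fun=> c).
Proof.
apply: (@smooth1_class [set g | exists c, g = fun=> c]); last by exists c.
by move=> _ [d ->]; exists (fun=> 0); [move=> x; exact: is_derive_cst|exists 0].
Qed.

Lemma ndiffD k g h : ndiff k g -> ndiff k h -> ndiff k (fun s => g s + h s).
Proof.
elim: k g h => [//|k IH] g h [g' gg' sg'] [h' hh' sh'].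
exists (fun s => g' s + h' s); last exact: IH.
by move=> x; exact: is_deriveD (gg' x) (hh' x).
Qed.

Lemma ndiffM k g h : ndiff k g -> ndiff k h -> ndiff k (fun s => g s * h s).
Proof.
elim: k g h => [//|k IH] g h sg sh.
have [g' gg' sg'] := sg; have [h' hh' sh'] := sh.
exists (fun s => g s * h' s + h s * g' s) => [x|].
  exact: is_deriveM (gg' x) (hh' x).
by apply: ndiffD; apply: IH => //; exact: ndiffW.
Qed.

Lemma smooth1D g h : smooth1 g -> smooth1 h -> smooth1 (fun s => g s + h s).
Proof. by move=> sg sh k; exact: ndiffD. Qed.

Lemma smooth1M g h : smooth1 g -> smooth1 h -> smooth1 (fun s => g s * h s).
Proof. by move=> sg sh k; exact: ndiffM. Qed.

Lemma smooth1Z c g : smooth1 g -> smooth1 (fun s => c * g s).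
Proof. by move=> sg; apply: smooth1M => //; exact: smooth1_cst. Qed.

Lemma smooth1B g h : smooth1 g -> smooth1 h -> smooth1 (fun s => g s - h s).
Proof.
move=> sg sh; apply: smooth1D => //.
rewrite (_ : (fun s => - h s) = (fun s => -1 * h s)); first exact: smooth1Z.
by apply/funext => s; rewrite mulN1r.
Qed.

Lemma is_derive_affine g (d a b x : R) : is_derive (a * x + b) 1 g d ->
  is_derive x 1 (fun s => g (a * s + b)) (a * d).
Proof.
move=> gd; rewrite mulrC.
have : is_derive x 1 (fun s : R => a * s + b) a.
  have dax := is_deriveD (is_deriveZ a (is_derive_id x 1)) (is_derive_cst b x 1).
  by apply: is_derive_eq dax _; rewrite addr0 /GRing.scale/= mulr1.
exact: is_derive1_comp.
Qed.

Lemma smooth1_affine a b g : smooth1 g -> smooth1 (fun s => g (a * s + b)).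
Proof.
move=> sg k; have {sg} := sg k.
elim: k g => [//|k IH] g [g' gg' sg'].
exists (fun s => a * g' (a * s + b)).
  by move=> x; exact: is_derive_affine.
apply: (@ndiffM k (fun=> a) (fun s => g' (a * s + b))); last exact: IH.
exact: smooth1_cst.
Qed.

Lemma smooth1V g : smooth1 g -> (forall x, g x != 0) -> smooth1 (fun s => (g s)^-1).
Proof.
move=> sg g0; elim=> [//|k IH].
exists (fun x => - (g^`()%classic x) * ((g x)^-1 * (g x)^-1)) => [x|].
  apply: is_derive_eq; first by apply: is_deriveV => //; exact: smooth1_is_derive.
  by rewrite /GRing.scale/= expr2 invfM; ring.
apply: ndiffM; last exact: ndiffM.
have := @smooth1Z (-1) _ (smooth1_derive1 sg) k.
by under eq_fun do rewrite mulN1r.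
Qed.

End smooth1.

Lemma cvg_is_derive {R : numFieldType} {V W : normedModType R} (f : V -> W) x v l :
  h^-1 *: (f (h *: v + x) - f x) @[h --> 0^'] --> l -> is_derive x v f l.
Proof.
move=> fl; apply: DeriveDef; first by apply/cvg_ex; exists l.
exact: cvg_lim.
Qed.

(** * The flat function exp(-1/x) and its derivatives *)

Section flat.
Context {R : realType}.
Implicit Types (q : {poly R}).

(* The functions [q(1/x) exp(-1/x)] on [x > 0], extended by [0], form a class
   stable under differentiation. *)
Definition flat q (x : R) : R :=
  if x <= 0 then 0 else q.[x^-1] * expR (- x^-1).

(** Induction on [q] with [m] general: a factor ['X] is absorbed into [s ^+ m], and the constant
    term is controlled by [s ^+ m <= m! * expR s], a single term of the exponential series. *)
Lemma horner_expRN_bounded q m : exists C : R, forall s, 0 <= s ->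
  s ^+ m * `|q.[s]| * expR (- s) <= C.
Proof.
elim/poly_ind: q m => [|q c IH] m.
  by exists 0 => s _; rewrite horner0 normr0 mulr0 mul0r.
have [C HC] := IH m.+1.
exists (C + `|c| * m`!%:R) => s s0.
rewrite hornerMXaddC.
have le1 : s ^+ m * expR (- s) <= m`!%:R.
  rewrite expRN ler_pdivrMr ?expR_gt0//.
  case: m {HC} => [|m]; first by rewrite expr0 fact0 mul1r -[leLHS]addr0 (le_trans _ (expR_ge1Dx _))// lerD2l.
  rewrite mulrC -ler_pdivrMr ?ltr0n ?fact_gt0//.
  by apply: le_trans (expR_ge1Dxn m s0); rewrite lerDr.
apply: (@le_trans _ _ ((s ^+ m * expR (- s)) * (`|q.[s]| * s + `|c|))).
  rewrite -mulrA [X in _ * X]mulrC mulrA.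
  apply: ler_wpM2l; first by rewrite mulr_ge0 ?exprn_ge0 ?expR_ge0.
  by rewrite (le_trans (ler_normD _ _))// normrM (ger0_norm s0).
rewrite mulrDr lerD//; last by rewrite mulrC ler_wpM2l.
by apply: le_trans (HC _ s0); rewrite exprS le_eqVlt; apply/orP; left; apply/eqP; ring.
Qed.

Lemma flat_le_norm q : exists C : R, forall x, `|flat q x| <= C * `|x|.
Proof.
have [C HC] := horner_expRN_bounded q 1.
exists C => x; rewrite /flat; case: ifPn => [x0|]; last rewrite -ltNge => x0.
  by rewrite normr0 mulr_ge0// (le_trans _ (HC 0 _))// expr1 !mul0r.
have := HC x^-1; rewrite invr_ge0 (ltW x0) => /(_ isT).
rewrite normrM (gtr0_norm (expR_gt0 _)) (gtr0_norm x0) => H.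
by rewrite -ler_pdivrMr// mulrC mulrA -[x^-1]expr1.
Qed.

(** Turns the difference quotient of [flat q] at [0] into [flat ('X * q)], which [flat_le_norm]
    shows to be of order [|x|]. *)
Lemma flatMX q x : flat q x = x * flat ('X * q) x.
Proof.
rewrite /flat; case: ifPn => [x0|]; first by rewrite mulr0.
rewrite -ltNge => x0; rewrite hornerM hornerX !mulrA divff ?mul1r//.
by rewrite gt_eqF.
Qed.

Lemma flat_is_derive q (x : R) :
  is_derive x 1 (flat q) (flat ('X * 'X * (q - q^`())) x).
Proof.
have [x0|x0|->] := ltgtP x 0.
- rewrite [X in is_derive _ _ _ X]/flat (ltW x0)/=.
  apply: (@near_eq_is_derive _ _ _ (cst 0)).
  near=> y; rewrite /flat ifT//; apply: ltW; near: y.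
  exact: lt_nbhsl.
- rewrite [X in is_derive _ _ _ X]/flat leNgt x0/=.
  apply: (@near_eq_is_derive _ _ _ (fun y : R => q.[y^-1] * expR (- y^-1))).
    near=> y; rewrite /flat leNgt ifF//; apply/negbF; near: y.
    exact: lt_nbhsr.
  have dV : is_derive x 1 (fun y : R => y^-1) (- x ^- 2).
    apply: is_derive_eq; first by apply: is_deriveV; rewrite gt_eqF.
    by rewrite /GRing.scale/= mulr1.
  have dq := is_derive1_comp (is_derive_poly q x^-1) dV.
  have de := @is_derive1_comp _ expR (fun y => - y^-1) x _ _ (is_derive_expR _) (is_deriveN dV).
  apply: is_derive_eq (is_deriveM dq de) _.
  by rewrite /GRing.scale/= !hornerE/=; field; rewrite gt_eqF.
- rewrite {2}/flat lexx; apply: cvg_is_derive.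
  have [C HC] := flat_le_norm ('X * q).
  have C0 : 0 <= C by have := HC 1; rewrite normr1 mulr1; exact: le_trans.
  apply/cvgr0Pnorm_lt => e e0; near=> h.
  have h0 : h != 0 by near: h; exact: nbhs_dnbhs_neq.
  rewrite [flat q 0]/flat lexx subr0 addr0 flatMX /GRing.scale/= mulr1 mulKf//.
  apply: le_lt_trans (HC h) _.
  apply: (@le_lt_trans _ _ ((C + 1) * `|h|)); first by rewrite ler_wpM2r// lerDl.
  rewrite -ltr_pdivlMl ?ltr_wpDl//; near: h.
  by apply: dnbhs0_lt; rewrite mulr_gt0// invr_gt0 ltr_wpDl.
Unshelve. all: by end_near. Qed.

Lemma smooth1_flat q : smooth1 (flat q).
Proof.
apply: (@smooth1_class _ (range flat)); last by exists q.
move=> _ [q' _ <-]; exists (flat ('X * 'X * (q' - q'^`()))).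
  exact: flat_is_derive.
by exists ('X * 'X * (q' - q'^`())).
Qed.

Lemma flat1_ge0 x : 0 <= flat 1 x.
Proof. by rewrite /flat; case: ifP => // _; rewrite mulr_ge0 ?expR_ge0 ?hornerC. Qed.

Lemma flat_le0 q x : x <= 0 -> flat q x = 0.
Proof. by rewrite /flat => ->. Qed.

Lemma flat1_gt0 x : 0 < x -> 0 < flat 1 x.
Proof. by move=> x0; rewrite /flat leNgt x0 hornerC mul1r expR_gt0. Qed.

Lemma flat1_le1 x : flat 1 x <= 1.
Proof.
rewrite /flat; case: ifPn => //; rewrite -ltNge => x0; rewrite hornerC mul1r.
by rewrite -expR0 ler_expR oppr_le0 invr_ge0 ltW.
Qed.

Lemma flat1_le x y : x <= y -> flat 1 x <= flat 1 y.
Proof.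
rewrite /flat; case: ifPn => [_ _|]; first exact: flat1_ge0.
rewrite -ltNge => x0 xy; have y0 := lt_le_trans x0 xy.
by rewrite (lt_geF y0) !hornerC !mul1r ler_expR lerN2 lef_pV2.
Qed.

Lemma flat1_is_derive (x : R) : is_derive x 1 (flat 1) (flat ('X * 'X) x).
Proof. by have := flat_is_derive 1 x; rewrite derivC subr0 mulr1. Qed.

Lemma flatXX_ge0 x : 0 <= flat ('X * 'X) x.
Proof.
by rewrite /flat; case: ifP => // _; rewrite mulr_ge0 ?expR_ge0// !hornerE -expr2 sqr_ge0.
Qed.

End flat.

(** * Smooth step, bump and their rescalings *)

Section bump.
Context {R : realType}.
Local Notation leb := (@lebesgue_measure R).

Lemma smooth1_shift_scale (g : R -> R) c h :
  smooth1 g -> smooth1 (fun s => g ((s - c) / h)).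
Proof.
move=> sg; rewrite (_ : (fun s => _) = fun s => g (h^-1 * s + - (c / h))).
  exact: smooth1_affine.
by apply/funext => s; congr g; ring.
Qed.

Lemma smooth1_refl_scale (g : R -> R) c h :
  smooth1 g -> smooth1 (fun s => g ((c - s) / h)).
Proof.
move=> sg; rewrite (_ : (fun s => _) = fun s => g (- h^-1 * s + c / h)).
  exact: smooth1_affine.
by apply/funext => s; congr g; ring.
Qed.

Lemma derive1_shift_scale (g : R -> R) c h : smooth1 g ->
  (fun s => g ((s - c) / h))^`()%classic =
  (fun s => h^-1 * g^`()%classic ((s - c) / h)).
Proof.
move=> sg; apply: derive1_is_derive => x.
rewrite (_ : (fun s => _) = fun s => g (h^-1 * s + - (c / h))); last first.
  by apply/funext => s; congr g; ring.
rewrite (_ : (x - c) / h = h^-1 * x + - (c / h)); last by ring.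
by apply: is_derive_affine; exact: smooth1_is_derive.
Qed.

Lemma derive1_refl_scale (g : R -> R) c h : smooth1 g ->
  (fun s => g ((c - s) / h))^`()%classic =
  (fun s => - (h^-1 * g^`()%classic ((c - s) / h))).
Proof.
move=> sg; apply: derive1_is_derive => x.
rewrite (_ : (fun s => _) = fun s => g (- h^-1 * s + c / h)); last first.
  by apply/funext => s; congr g; ring.
rewrite (_ : (c - x) / h = - h^-1 * x + c / h); last by ring.
rewrite -mulNr; apply: is_derive_affine; exact: smooth1_is_derive.
Qed.

(** At every point [x] or [1 - x] is positive, so the denominator never vanishes; [1 - x] is spelled
    in the shape expected by [smooth1_affine]. *)
Definition step (x : R) : R := flat 1 x * (flat 1 x + flat 1 (-1 * x + 1))^-1.

Lemma step_den_gt0 (x : R) : 0 < flat 1 x + flat 1 (-1 * x + 1) :> R.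
Proof.
have [x0|x0] := ltP 0 x; first by rewrite ltr_wpDr ?flat1_ge0 ?flat1_gt0.
by rewrite ltr_wpDl ?flat1_ge0 ?flat1_gt0//; lra.
Qed.

Lemma smooth1_step : smooth1 step.
Proof.
apply: smooth1M; first exact: smooth1_flat.
apply: smooth1V => [|x]; last by rewrite gt_eqF ?step_den_gt0.
by apply: smooth1D; [exact: smooth1_flat|apply: smooth1_affine; exact: smooth1_flat].
Qed.

Lemma step_le0 x : x <= 0 -> step x = 0.
Proof. by move=> x0; rewrite /step flat_le0 ?mul0r. Qed.

Lemma step_ge1 x : 1 <= x -> step x = 1.
Proof.
move=> x1; rewrite /step [X in _ + X]flat_le0 ?addr0; last by lra.
by rewrite divff// gt_eqF// flat1_gt0//; lra.
Qed.

Lemma step_ge0 x : 0 <= step x.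
Proof. by rewrite mulr_ge0 ?flat1_ge0// invr_ge0 ltW// step_den_gt0. Qed.

Lemma step_le1 x : step x <= 1.
Proof. by rewrite ler_pdivrMr ?step_den_gt0// mul1r lerDl flat1_ge0. Qed.

(** Taken as a derivative so that its primitive is known: unit mass is the fundamental theorem of
    calculus, and differences of steps serve later as smooth primitives of differences of
    kernels. *)
Definition bump (x : R) : R := step^`()%classic x.

(** In the quotient rule the products of [flat 1 x] with its own derivative cancel, and what remains
    shows both the sign and the support in [[0, 1]]. *)
Lemma bumpE x : bump x =
  (flat ('X * 'X) x * flat 1 (-1 * x + 1) + flat 1 x * flat ('X * 'X) (-1 * x + 1))
  * ((flat 1 x + flat 1 (-1 * x + 1)) ^- 2).
Proof.
have de := flat1_is_derive x.
have dE : is_derive x 1 (fun s => flat 1 (-1 * s + 1)) (-1 * flat ('X * 'X) (-1 * x + 1) : R).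
  by apply: is_derive_affine; exact: flat1_is_derive.
have dD := is_deriveD de dE.
have dV := @is_deriveV _ (fun x => flat 1 x + flat 1 (-1 * x + 1)) x _ _
  (lt0r_neq0 (step_den_gt0 x)) dD.
have [_ H] := is_deriveM de dV.
rewrite /bump derive1E; apply: etrans H _.
rewrite /GRing.scale/=; have := step_den_gt0 x => den0; field.
by rewrite gt_eqF.
Qed.

Lemma bump_ge0 x : 0 <= bump x.
Proof.
rewrite bumpE mulr_ge0 ?invr_ge0 ?sqr_ge0//.
by rewrite addr_ge0// mulr_ge0 ?flat1_ge0 ?flatXX_ge0.
Qed.

Lemma bump_le0 x : x <= 0 -> bump x = 0.
Proof. by move=> x0; rewrite bumpE !(flat_le0 _ x0) !mul0r addr0 mul0r. Qed.

Lemma bump_ge1 x : 1 <= x -> bump x = 0.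
Proof.
by move=> x1; rewrite bumpE !(@flat_le0 _ _ (_ + _)) ?mulr0 ?addr0 ?mul0r//; lra.
Qed.

Lemma smooth1_bump : smooth1 bump.
Proof. exact: smooth1_derive1 smooth1_step. Qed.

Lemma smooth1_bounded (g : R -> R) a b : smooth1 g ->
  (forall x, x < a \/ b < x -> g x = 0) -> exists2 C : R, 0 < C & forall x, `|g x| <= C.
Proof.
move=> sg g0.
have := @segment_compact R a b => cab.
have cg : {within `[a, b], continuous g}.
  by apply: continuous_subspaceT; exact: smooth1_continuous.
have := continuous_compact cg cab.
move=> /compact_bounded[M [Mr HM]].
exists (`|M| + 1) => [|x]; first by rewrite ltr_wpDl.
have [xab|nxab] := pselect (`[a, b]%classic x).
  apply: (HM (`|M| + 1)); last by exists x.
  by rewrite (le_lt_trans (ler_norm _))// ltrDl.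
rewrite g0 ?normr0 ?addr_ge0//.
by apply: contra_notP nxab => /not_orP[/negP + /negP]; rewrite -!leNgt /= in_itv/= => -> ->.
Qed.

Lemma integral_derive1_ge0 (F : R -> R) (a b : R) : a < b -> smooth1 F ->
  (forall x, 0 <= F^`()%classic x) ->
  (forall x, x < a \/ b < x -> F^`()%classic x = 0) ->
  (\int[leb]_x (F^`()%classic x)%:E = (F b - F a)%:E)%E.
Proof.
move=> ab sF F'0 F'out.
have cF' : continuous F^`()%classic.
  by apply: smooth1_continuous; exact: smooth1_derive1.
rewrite (_ : (\int[leb]_x _)%E = (\int[leb]_(x in `[a, b]) (F^`()%classic x)%:E)%E).
  rewrite (continuous_FTC2 (F := F))//.
  - exact: continuous_subspaceT.
  - split=> [x _| |]; first by have [] := smooth1_is_derive x sF.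
    + by apply: cvg_at_right_filter; exact: smooth1_continuous.
    + by apply: cvg_at_left_filter; exact: smooth1_continuous.
rewrite [RHS]integral_mkcond; apply: eq_integral => x _.
rewrite patchE; case: ifPn => // /negP; rewrite inE /= in_itv/= => /negP.
by rewrite negb_and -!ltNge => /orP xab; rewrite F'out.
Qed.

End bump.

(** * Product test functions and their integrals *)
Section tensor.
Context {R : realType} {n : nat}.
Implicit Types (h : 'I_n -> R -> R) (x : 'rV[R]_n).

Definition tensor h x : R := \prod_(j < n) h j (x ord0 j).

Definition upd h i (g : R -> R) : 'I_n -> R -> R := fun j => if j == i then g else h j.

Lemma tensor_upd h i g x :
  tensor (upd h i g) x = g (x ord0 i) * \prod_(j < n | j != i) h j (x ord0 j).
Proof.
rewrite /tensor (bigD1 i)//= /upd eqxx; congr (_ * _).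
by apply: eq_bigr => j /negPf ->.
Qed.

Lemma tensorD1 h i x :
  tensor h x = h i (x ord0 i) * \prod_(j < n | j != i) h j (x ord0 j).
Proof. by rewrite /tensor (bigD1 i). Qed.

Lemma tensor_is_derive h i x : smooth1 (h i) ->
  is_derive x (delta_mx ord0 i) (tensor h) (tensor (upd h i ((h i)^`()%classic)) x).
Proof.
move=> si; apply: cvg_is_derive; rewrite tensor_upd.
set c := \prod_(_ < _ | _) _.
rewrite (_ : (fun t : R => _) = fun t => (t^-1 *: (h i (t *: 1 + x ord0 i) - h i (x ord0 i))) * c).
  have [dg dv] := smooth1_is_derive (x ord0 i) si.
  by rewrite -dv; apply: cvgMr_tmp; exact: dg.
apply/funext => t; rewrite 2!(tensorD1 _ i) !mxE !eqxx/= /GRing.scale/= mulr1.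
rewrite -mulrA; congr (_ * _); rewrite mulrBl; congr (_ - _).
congr (_ * _); apply: eq_bigr => j ji; rewrite !mxE eqxx/= (negPf ji).
by rewrite mulr0 add0r.
Qed.

Lemma partial_tensor h i : smooth1 (h i) ->
  partial i (tensor h) = tensor (upd h i ((h i)^`()%classic)).
Proof. by move=> si; apply/funext => x; have [] := tensor_is_derive x si. Qed.

Lemma continuous_tensor h : (forall j, continuous (h j)) -> continuous (tensor h).
Proof.
move=> ch; rewrite /tensor; elim: (index_enum _) => [|i s IH].
  by under eq_fun do rewrite big_nil; exact: cst_continuous.
under eq_fun do rewrite big_cons; move=> x; apply: continuousM; last exact: IH.
apply: (@continuous_comp _ _ _ (fun x : 'rV[R]_n => x ord0 i) (h i)).
  exact: coord_continuous.
exact: ch.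
Qed.

Lemma smooth1_upd h i g :
  (forall j, smooth1 (h j)) -> smooth1 g -> forall j, smooth1 (upd h i g j).
Proof. by move=> sh sg j; rewrite /upd; case: ifP. Qed.

(** A partial derivative of a product is again a product with one factor differentiated, so the
    invariant of the induction is the existence of smooth factors. *)
Lemma smooth_tensor h : (forall j, smooth1 (h j)) -> smooth (tensor h).
Proof.
move=> sh s.
have [h' sh' ->] : exists2 h', (forall j, smooth1 (h' j)) &
    foldr partial (tensor h) s = tensor h'.
  elim: s => [|i s [h' sh' IH]]; first by exists h.
  exists (upd h' i ((h' i)^`()%classic)).
    by apply: smooth1_upd => //; exact: smooth1_derive1.
  by rewrite /= IH partial_tensor.
split; first by apply: continuous_tensor => j; exact: smooth1_continuous.
by move=> i x; have [] := tensor_is_derive x (sh' i).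
Qed.

Definition cbox (a b : 'I_n -> R) : set 'rV[R]_n :=
  [set x | forall j, a j <= x ord0 j <= b j].

Lemma cbox_compact a b : compact (cbox a b).
Proof.
rewrite (_ : cbox a b = [set x | forall j, `[a j, b j]%classic (x ord0 j)]).
  by apply: (@rV_compact _ _ (fun j => `[a j, b j]%classic)) => j; exact: segment_compact.
by apply/seteqP; split=> x xab j; have := xab j; rewrite /= in_itv.
Qed.

Lemma measurable_cbox (b d : 'I_n -> R) : measurable (cbox b d).
Proof.
rewrite -[cbox b d]setCK; apply: measurableC; apply: open_measurable_rV.
by apply: closed_openC; apply: compact_closed; [exact: norm_hausdorff|exact: cbox_compact].
Qed.

Definition supp_in h (a b : 'I_n -> R) :=
  forall j t, t < a j \/ b j < t -> h j t = 0.

Lemma tensor_eq0 h a b x : supp_in h a b -> ~ cbox a b x -> tensor h x = 0.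
Proof.
move=> hab /existsNP[j]/negP; rewrite negb_and -!ltNge => /orP xab.
by rewrite (tensorD1 _ j) hab ?mul0r.
Qed.

Lemma test_function_tensor h a b (Omega : set 'rV[R]_n) :
  (forall j, smooth1 (h j)) -> supp_in h a b -> cbox a b `<=` Omega ->
  test_function Omega (tensor h).
Proof.
move=> sh hab abO; split; first exact: smooth_tensor.
have sub : closure [set x | tensor h x != 0] `<=` cbox a b.
  have /closure_id -> : closed (cbox a b).
    by apply: compact_closed; [exact: norm_hausdorff|exact: cbox_compact].
  apply: closure_subset => x /= /eqP x0; apply: contra_notP x0 => nx.
  exact: tensor_eq0 hab nx.
split; last exact: subset_trans sub abO.
by apply: subclosed_compact sub; [exact: closed_closure|exact: cbox_compact].
Qed.

End tensor.

Section integral_tensor.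
Context {R : realType}.

Lemma measurable_coord n (j : 'I_n) :
  measurable_fun setT (fun x : 'rV[R]_n => x ord0 j).
Proof.
apply: (measurability _ (RGenOpens.measurableE R)).
move=> _ [_ [a [b ->]] <-]; rewrite setTI; apply: open_measurable_rV.
by apply: open_comp => [x _|]; [exact: coord_continuous|exact: interval_open].
Qed.

Lemma measurable_tensor n (h : 'I_n -> R -> R) :
  (forall j, measurable_fun setT (h j)) -> measurable_fun setT (tensor h).
Proof.
move=> mh; rewrite /tensor; apply: measurable_prod => j _.
by apply: (measurableT_comp (mh j)); exact: measurable_coord.
Qed.

Lemma ge0_integral_rV_cons n (f : 'rV[R]_n.+1 -> \bar R) :
  measurable_fun setT f -> (forall x, (0 <= f x)%E) ->
  (\int[@lebesgue_rV R n.+1]_x f x =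
   \int[lebesgue_measure]_s \int[@lebesgue_rV R n]_y f (rV_cons (s, y)))%E.
Proof.
move=> mf f0.
have := @ge0_integral_pushforward _ _ _ _ _ _ (@measurable_rV_cons R n)
  (lebesgue_measure \x (@lebesgue_rV R n))%E setT f measurableT mf (fun x _ => f0 x).
rewrite preimage_setT => H; apply: etrans H _.
rewrite (fubini_tonelli1 (f \o rV_cons (n := n)))//.
  by apply: measurableT_comp => //; exact: measurable_rV_cons.
by move=> z /=.
Qed.

(** Induction on the dimension through [rV_cons]. Nonnegative factors allow Tonelli before any
    integrability is known, and the formula then yields that integrability. *)
Lemma integral_tensor n (h : 'I_n -> R -> R) (c : 'I_n -> R) :
  (forall j, measurable_fun setT (h j)) -> (forall j t, 0 <= h j t) ->
  (forall j, (\int[lebesgue_measure]_t (h j t)%:E = (c j)%:E)%E) ->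
  (\int[@lebesgue_rV R n]_x (tensor h x)%:E = (\prod_(j < n) c j)%:E)%E.
Proof.
elim: n h c => [|n IH] h c mh h0 hc.
  under eq_integral do rewrite /tensor big_ord0.
  rewrite big_ord0 integral_cst//; first by rewrite mul1e /lebesgue_rV /= diracT.
rewrite ge0_integral_rV_cons; last 2 first.
- by apply/measurable_EFinP; exact: measurable_tensor.
- by move=> x; rewrite lee_fin prodr_ge0.
have tens s (y : 'rV[R]_n) :
    tensor h (rV_cons (s, y)) = h ord0 s * tensor (fun j => h (lift ord0 j)) y.
  rewrite /tensor big_ord_recl rV_cons0; congr (_ * _).
  by apply: eq_bigr => j _; rewrite rV_consS.
under eq_integral => s _.
  under eq_integral do rewrite tens EFinM.
  rewrite ge0_integralZl//; last 3 first.
  - by apply/measurable_EFinP; exact: measurable_tensor.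
  - by move=> y _; rewrite lee_fin prodr_ge0.
  - by rewrite lee_fin.
  rewrite (IH _ (fun j => c (lift ord0 j)))//.
  over.
rewrite ge0_integralZr//; last 3 first.
- by apply/measurable_EFinP; exact: mh.
- by move=> y _; rewrite lee_fin.
- rewrite lee_fin prodr_ge0// => j _.
  by rewrite -lee_fin -hc integral_ge0// => t _; rewrite lee_fin.
by rewrite hc -EFinM big_ord_recl.
Qed.

End integral_tensor.

(** * Fubini with a bounded kernel *)

Section Rfubini.
Context d1 d2 (T1 : measurableType d1) (T2 : measurableType d2) (R : realType).
Variables (m1 : {sigma_finite_measure set T1 -> \bar R})
          (m2 : {sigma_finite_measure set T2 -> \bar R}).

Lemma integrableM_bounded d (T : measurableType d) (m : {measure set T -> \bar R})
    (f k : T -> R) (C : R) :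
  m.-integrable setT (EFin \o f) -> measurable_fun setT k ->
  (forall x, `|k x| <= C) -> m.-integrable setT (EFin \o (fun x => f x * k x)).
Proof.
move=> fi mk kC; have mf := measurable_int _ fi.
have iC := integrableZl measurableT C fi.
apply: le_integrable iC => //.
  by apply/measurable_EFinP; apply: measurable_funM => //; exact/measurable_EFinP.
move=> x _; rewrite -EFinM !abse_EFin lee_fin !normrM mulrC.
by rewrite ler_wpM2r// (le_trans (kC x))// ler_norm.
Qed.

(** The integrand is dominated by [C * |a x| * |b y|]. The first conclusion is what later makes
    [a * moll e g] integrable without a separate study of [moll]. *)
Lemma Rfubini (a : T1 -> R) (b : T2 -> R) (k : T1 * T2 -> R) (C : R) :
  m1.-integrable setT (EFin \o a) -> m2.-integrable setT (EFin \o b) ->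
  measurable_fun setT k -> (forall z, `|k z| <= C) ->
  m1.-integrable setT (EFin \o (fun x => a x * \int[m2]_y (b y * k (x, y)))) /\
      \int[m1]_x (a x * \int[m2]_y (b y * k (x, y))) =
      \int[m2]_y (b y * \int[m1]_x (a x * k (x, y))).
Proof.
move=> ia ib mk kC.
have ma := measurable_int _ ia; have mb := measurable_int _ ib.
have mk1 x : measurable_fun setT (fun y => k (x, y)).
  by apply: (measurableT_comp mk); exact: measurable_pair1.
have mk2 y : measurable_fun setT (fun x => k (x, y)).
  by apply: (measurableT_comp mk); exact: measurable_pair2.
pose f := EFin \o (fun z : T1 * T2 => a z.1 * b z.2 * k z).
have mf : measurable_fun setT f.
  apply/measurable_EFinP; apply: measurable_funM => //; apply: measurable_funM.
    by apply: measurableT_comp => //; exact/measurable_EFinP.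
  by apply: measurableT_comp => //; exact/measurable_EFinP.
have i1 x : m2.-integrable setT (EFin \o (fun y => b y * k (x, y))).
  exact: (integrableM_bounded ib).
have i2 y : m1.-integrable setT (EFin \o (fun x => a x * k (x, y))).
  exact: (integrableM_bounded ia).
have F1 x : (\int[m2]_y f (x, y) = (a x * \int[m2]_y (b y * k (x, y)))%:E)%E.
  rewrite EFinM /Rintegral fineK; last exact: (integrable_fin_num measurableT (i1 x)).
  rewrite -integralZl//; last exact: i1.
  apply: eq_integral => y _.
  by rewrite /f /= -EFinM mulrA.
have F2 y : (\int[m1]_x f (x, y) = (b y * \int[m1]_x (a x * k (x, y)))%:E)%E.
  rewrite EFinM /Rintegral fineK; last exact: (integrable_fin_num measurableT (i2 y)).
  rewrite -integralZl//; last exact: i2.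
  apply: eq_integral => x _.
  by rewrite /f /= -EFinM mulrA [b y * _]mulrC.
have fi : (m1 \x m2)%E.-integrable setT f.
  apply/integrable12ltyP => //.
  apply: (@le_lt_trans _ _ (\int[m1]_x (`|(a x)%:E| * (C%:E * \int[m2]_y `|(b y)%:E|)))%E).
    apply: ge0_le_integral => //.
    - by move=> x _; exact: integral_ge0.
    - apply: (@measurable_fun_fubini_tonelli_F _ _ _ _ _ m2 (fun z => `|f z|%E)) => //.
      by apply: measurableT_comp.
    - by apply: emeasurable_funM => //; apply: measurableT_comp.
    move=> x _.
    have C0 : 0 <= C by have := kC (x, point); exact: le_trans.
    rewrite -ge0_integralZl//; last by apply: measurableT_comp.
    rewrite -ge0_integralZl//; last 2 first.
      by apply: emeasurable_funM => //; apply: measurableT_comp.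
      by move=> y _; rewrite mule_ge0// lee_fin.
    apply: ge0_le_integral => //.
    - apply: measurableT_comp => //; apply/measurable_EFinP.
      rewrite /f/=; apply: measurable_funM => //; apply: measurable_funM => //.
      exact/measurable_EFinP.
    - apply: emeasurable_funM => //; apply: emeasurable_funM => //.
      by apply: measurableT_comp.
    move=> y _; rewrite /f/= -!EFinM lee_fin !normrM -mulrA ler_wpM2l// mulrC.
    by rewrite ler_wpM2r.
  have [/integrableP[_ fa] /integrableP[_ fb]] := (ia, ib).
  have fbf : (\int[m2]_y `|(b y)%:E| \is a fin_num)%E.
    by rewrite ge0_fin_numE//; exact: integral_ge0.
  rewrite -(fineK fbf) -EFinM ge0_integralZr//; last 2 first.
    by apply: measurableT_comp.
    have C0 : 0 <= C by have := kC (point, point); exact: le_trans.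
    by rewrite lee_fin mulr_ge0// fine_ge0// integral_ge0.
  rewrite lte_mul_pinfty//; [exact: integral_ge0| |by rewrite ltry].
  by rewrite ge0_fin_numE//; exact: integral_ge0.
have F1E : (fun x => \int[m2]_y f (x, y))%E =
    EFin \o (fun x => a x * \int[m2]_y (b y * k (x, y))) by apply/funext.
have F2E : (fun x => \int[m1]_y f (y, x))%E =
    EFin \o (fun y => b y * \int[m1]_x (a x * k (x, y))) by apply/funext.
split.
- by rewrite -F1E; exact: integrable_fubini_F.
- rewrite /Rintegral; congr fine.
  by have := Fubini fi; rewrite F1E F2E.
Qed.

End Rfubini.

Notation rintegrable mu f := (integrable mu setT (EFin \o f%R)).

Lemma cvg_sum_seq (R : realType) (I : Type) (s : seq I) (v : I -> nat -> R) (l : I -> R) :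
  (forall i, v i m @[m --> \oo] --> l i) ->
  \sum_(i <- s) v i m @[m --> \oo] --> \sum_(i <- s) l i.
Proof.
move=> vl; elim: s => [|i s IH].
  by rewrite big_nil; under eq_fun do rewrite big_nil; exact: cvg_cst.
rewrite big_cons; under eq_fun do rewrite big_cons.
by apply: cvgD; [exact: vl|exact: IH].
Qed.

(** * Calculus of real-valued integrable functions *)

Section rintegrable.
Context d (T : measurableType d) (R : realType).
Variable mu : {measure set T -> \bar R}.
Implicit Types (f g : T -> R).

Lemma rintegrable_measurable f : rintegrable mu f -> measurable_fun setT f.
Proof. by move=> /measurable_int/measurable_EFinP. Qed.

Lemma rintegrableD f g : rintegrable mu f -> rintegrable mu g ->
  rintegrable mu (fun x => f x + g x).
Proof. exact: integrableD. Qed.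

Lemma rintegrableZ c f : rintegrable mu f -> rintegrable mu (fun x => c * f x).
Proof. exact: integrableZl. Qed.

Lemma rintegrableN f : rintegrable mu f -> rintegrable mu (fun x => - f x).
Proof.
by move=> /(rintegrableZ (-1)); under eq_fun do rewrite /= mulN1r.
Qed.

Lemma rintegrableB f g : rintegrable mu f -> rintegrable mu g ->
  rintegrable mu (fun x => f x - g x).
Proof. by move=> fi /rintegrableN gi; exact: (rintegrableD fi gi). Qed.

Lemma rintegrable0 : rintegrable mu (fun=> 0).
Proof. exact: integrable0. Qed.

Lemma rintegrable_sum (I : Type) (s : seq I) (F : I -> T -> R) :
  (forall i, rintegrable mu (F i)) -> rintegrable mu (fun x => \sum_(i <- s) F i x).
Proof.
move=> Fi; elim: s => [|i s IH].
  by under eq_fun do rewrite big_nil; exact: rintegrable0.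
by under eq_fun do rewrite big_cons; exact: (rintegrableD (Fi i) IH).
Qed.

Lemma rintegrable_le f g : rintegrable mu g -> measurable_fun setT f ->
  (forall x, `|f x| <= g x) -> rintegrable mu f.
Proof.
move=> gi mf fg; apply: le_integrable gi => //; first exact/measurable_EFinP.
by move=> x _ /=; rewrite lee_fin (le_trans (fg x))// ler_norm.
Qed.

Lemma rintegrable_norm f : rintegrable mu f -> rintegrable mu (fun x => `|f x|).
Proof.
move=> fi; exact: integrable_abse fi.
Qed.

Lemma Rint_sum (I : Type) (s : seq I) (F : I -> T -> R) :
  (forall i, rintegrable mu (F i)) ->
  \int[mu]_x (\sum_(i <- s) F i x) = \sum_(i <- s) \int[mu]_x F i x.
Proof.
move=> Fi; elim: s => [|i s IH].
  by under eq_Rintegral do rewrite big_nil; rewrite big_nil Rintegral_cst// mul0r.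
under eq_Rintegral do rewrite big_cons.
by rewrite big_cons RintegralD// ?IH//; exact: rintegrable_sum.
Qed.

Lemma Rint_norm_le f g : rintegrable mu f -> rintegrable mu g ->
  (forall x, `|f x| <= g x) -> `|\int[mu]_x f x| <= \int[mu]_x g x.
Proof.
move=> fi gi fg; apply: (le_trans (le_normr_Rintegral measurableT fi)).
by apply: le_Rintegral => //; exact: rintegrable_norm.
Qed.

Lemma RintE f : rintegrable mu f -> (\int[mu]_x (f x)%:E = (\int[mu]_x f x)%:E)%E.
Proof. by move=> fi; rewrite fineK// (integrable_fin_num measurableT fi). Qed.

Lemma rintegrable_indic (A : set T) : measurable A -> (mu A < +oo)%E ->
  rintegrable mu \1_A.
Proof.
move=> mA Aoo; apply/integrableP; split.
  by apply/measurable_EFinP; exact: measurable_indic.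
under eq_integral => x _ do rewrite /= ger0_norm//.
by rewrite integral_indic// setIT.
Qed.

Lemma Rdominated_cvg (f_ : nat -> T -> R) f g :
  (forall k, measurable_fun setT (f_ k)) ->
  (forall x, f_ k x @[k --> \oo] --> f x) -> rintegrable mu g ->
  (forall k x, `|f_ k x| <= g x) ->
  rintegrable mu f /\ \int[mu]_x f_ k x @[k --> \oo] --> \int[mu]_x f x.
Proof.
move=> mf_ f_f gi fg.
have mf : measurable_fun setT f.
  apply/measurable_EFinP; apply: (emeasurable_fun_cvg (fun k => EFin \o f_ k)) => [k|x _].
    exact/measurable_EFinP.
  by apply: cvg_EFin (f_f x); exact: nearW.
have fi : rintegrable mu f.
  apply: rintegrable_le gi mf _ => x.
  have fx : `|f_ k x| @[k --> \oo] --> `|f x| by apply: cvg_norm; exact: f_f.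
  rewrite -(cvg_lim (@Rhausdorff R) fx); apply: limr_le; first exact: cvgP fx.
  exact: nearW.
split => //; apply: (@fine_cvg _ _ _ _ (fun k => (\int[mu]_x (f_ k x)%:E)%E)).
rewrite -RintE//.
apply: (dominated_cvg measurableT (g := EFin \o g)) => //.
- by move=> k; exact/measurable_EFinP.
- by move=> x _; apply: cvg_EFin (f_f x); exact: nearW.
- by move=> k x _; rewrite lee_fin.
Qed.

End rintegrable.

(** * Mollification *)
Section mollifier.
Context {R : realType}.
Local Notation leb := (@lebesgue_measure R).

(* One-sided in every coordinate, so that its averages of indicators of
   half-open boxes converge everywhere. *)
Definition rho (e s : R) : R := e^-1 * bump (s / e).

Lemma rho_ge0 e s : 0 < e -> 0 <= rho e s.
Proof. by move=> e0; rewrite mulr_ge0 ?bump_ge0// invr_ge0 ltW. Qed.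

Lemma rho_eq0 e s : 0 < e -> s <= 0 \/ e <= s -> rho e s = 0.
Proof.
move=> e0 [s0|es]; rewrite /rho.
  by rewrite bump_le0 ?mulr0// pmulr_lle0// invr_gt0.
by rewrite bump_ge1 ?mulr0// ler_pdivlMr// mul1r.
Qed.

Lemma smooth1_rho_refl e x : smooth1 (fun t => rho e (x - t)).
Proof. by apply: smooth1Z; apply: smooth1_refl_scale; exact: smooth1_bump. Qed.

Lemma smooth1_rho_shift e y : smooth1 (fun s => rho e (s - y)).
Proof. by apply: smooth1Z; apply: smooth1_shift_scale; exact: smooth1_bump. Qed.

Lemma rho_bounded e : 0 < e -> exists2 C : R, 0 < C & forall s, rho e s <= C.
Proof.
move=> e0; have [C C0 HC] := @smooth1_bounded R bump 0 1 smooth1_bump (fun x =>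
  fun H => match H with or_introl h => bump_le0 (ltW h) | or_intror h => bump_ge1 (ltW h) end).
exists (e^-1 * C) => [|s]; first by rewrite mulr_gt0 ?invr_gt0.
by apply: ler_wpM2l; [rewrite invr_ge0 ltW|exact: le_trans (ler_norm _) (HC _)].
Qed.

Lemma integral_rho_refl e x : 0 < e ->
  (\int[leb]_t (rho e (x - t))%:E = 1%:E)%E.
Proof.
move=> e0; pose F (t : R) := -1 * step ((x - t) / e).
have sF : smooth1 F.
  by apply: smooth1Z; apply: smooth1_refl_scale; exact: smooth1_step.
have F'E : F^`()%classic = (fun t => rho e (x - t)).
  apply: derive1_is_derive => t.
  have := smooth1_is_derive t (smooth1_refl_scale x e (@smooth1_step R)).
  rewrite (derive1_refl_scale _ _ (@smooth1_step R)) => dF.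
  have := is_deriveZ (-1) dF; rewrite /GRing.scale/= mulN1r opprK; exact.
have -> : (1 : R) = F x - F (x - e).
  rewrite /F subrr mul0r (step_le0 (lexx 0)) opprB [x + _]addrC subrK divff ?gt_eqF//.
  by rewrite step_ge1// mulr0 mulr1 opprK add0r.
have := @integral_derive1_ge0 _ F (x - e) x; rewrite F'E; apply=> //.
- by rewrite ltrBlDr ltrDl.
- by move=> t; exact: rho_ge0.
- by move=> t xt; apply: rho_eq0 => //; case: xt => xt; [right|left]; lra.
Qed.

Lemma integral_rho_shift e y : 0 < e ->
  (\int[leb]_s (rho e (s - y))%:E = 1%:E)%E.
Proof.
move=> e0; pose F (t : R) := step ((t - y) / e).
have sF : smooth1 F by apply: smooth1_shift_scale; exact: smooth1_step.
have F'E : F^`()%classic = (fun t => rho e (t - y)).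
  by rewrite (derive1_shift_scale _ _ (@smooth1_step R)).
have -> : (1 : R) = F (y + e) - F y.
  rewrite /F subrr mul0r (step_le0 (lexx 0)) subr0 [y + _]addrC addrK divff ?gt_eqF//.
  by rewrite step_ge1.
have := @integral_derive1_ge0 _ F y (y + e); rewrite F'E; apply=> //.
- by rewrite ltrDl.
- by move=> t; exact: rho_ge0.
- by move=> t xt; apply: rho_eq0 => //; case: xt => xt; [left|right]; lra.
Qed.

Context {n : nat}.
Local Notation mu := (@lebesgue_rV R n).
Implicit Types (e : R) (x y : 'rV[R]_n) (a g : 'rV[R]_n -> R).

(** In [y] the kernel lives on the cube of side [e] with upper corner [x]; in [x], on the cube of
    side [e] with lower corner [y]. *)
Definition mol (e : R) x y : R := \prod_(j < n) rho e (x ord0 j - y ord0 j).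

Lemma mol_ge0 e x y : 0 < e -> 0 <= mol e x y.
Proof. by move=> e0; apply: prodr_ge0 => j _; exact: rho_ge0. Qed.

Lemma mol_eq0 e x y : 0 < e ->
  ~ (forall j, y ord0 j < x ord0 j /\ x ord0 j < y ord0 j + e) -> mol e x y = 0.
Proof.
move=> e0 /existsNP[j /not_andP H]; rewrite /mol (bigD1 j)//= rho_eq0 ?mul0r//.
by case: H => /negP; rewrite -leNgt => H; [left|right]; lra.
Qed.

Lemma mol_bounded e : 0 < e -> exists C : R, forall x y, `|mol e x y| <= C.
Proof.
move=> e0; have [C C0 HC] := rho_bounded e0; exists (C ^+ n) => x y.
rewrite ger0_norm ?mol_ge0// -[n in leRHS]card_ord -prodr_const.
by apply: ler_prod => j _; rewrite rho_ge0 ?HC.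
Qed.

Lemma measurable_rho e : measurable_fun setT (rho e).
Proof.
apply: continuous_measurable_fun; apply: smooth1_continuous; apply: smooth1Z.
by have := smooth1_shift_scale 0 e (@smooth1_bump R); under eq_fun do rewrite subr0.
Qed.

Lemma measurable_mol e : measurable_fun setT (fun z : 'rV[R]_n * 'rV[R]_n => mol e z.1 z.2).
Proof.
apply: measurable_prod => j _; apply: (measurableT_comp (measurable_rho e)).
apply: measurable_funB.
  by apply: (measurableT_comp (measurable_coord j)).
by apply: (measurableT_comp (measurable_coord j)).
Qed.

Lemma measurable_mol_swap e :
  measurable_fun setT (fun z : 'rV[R]_n * 'rV[R]_n => mol e z.2 z.1).
Proof.
apply: measurable_prod => j _; apply: (measurableT_comp (measurable_rho e)).
apply: measurable_funB.
  by apply: (measurableT_comp (measurable_coord j)).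
by apply: (measurableT_comp (measurable_coord j)).
Qed.

Lemma integral_mol2 e x : 0 < e -> (\int[mu]_y (mol e x y)%:E = 1%:E)%E.
Proof.
move=> e0; have := @integral_tensor _ n (fun j t => rho e (x ord0 j - t)) (fun=> 1).
rewrite big1// => -> //.
- by move=> j; apply: continuous_measurable_fun; apply: smooth1_continuous; exact: smooth1_rho_refl.
- by move=> j t; exact: rho_ge0.
- by move=> j; exact: integral_rho_refl.
Qed.

Lemma integral_mol1 e y : 0 < e -> (\int[mu]_x (mol e x y)%:E = 1%:E)%E.
Proof.
move=> e0; have := @integral_tensor _ n (fun j t => rho e (t - y ord0 j)) (fun=> 1).
rewrite big1// => -> //.
- by move=> j; apply: continuous_measurable_fun; apply: smooth1_continuous; exact: smooth1_rho_shift.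
- by move=> j t; exact: rho_ge0.
- by move=> j; exact: integral_rho_shift.
Qed.

Lemma measurable_mol2 e x : measurable_fun setT (mol e x).
Proof.
apply: (@measurable_tensor _ _ (fun j t => rho e (x ord0 j - t))) => j.
by apply: continuous_measurable_fun; apply: smooth1_continuous; exact: smooth1_rho_refl.
Qed.

Lemma measurable_mol1 e y : measurable_fun setT (mol e ^~ y).
Proof.
apply: (@measurable_tensor _ _ (fun j t => rho e (t - y ord0 j))) => j.
by apply: continuous_measurable_fun; apply: smooth1_continuous; exact: smooth1_rho_shift.
Qed.

Lemma rintegrable_mol2 e x : 0 < e -> rintegrable mu (mol e x).
Proof.
move=> e0; apply/integrableP; split; first by apply/measurable_EFinP; exact: measurable_mol2.
under eq_integral => y _ do rewrite /= ger0_norm ?mol_ge0//.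
by rewrite integral_mol2// ltry.
Qed.

Lemma rintegrable_mol1 e y : 0 < e -> rintegrable mu (mol e ^~ y).
Proof.
move=> e0; apply/integrableP; split; first by apply/measurable_EFinP; exact: measurable_mol1.
under eq_integral => x _ do rewrite /= ger0_norm ?mol_ge0//.
by rewrite integral_mol1// ltry.
Qed.

Definition moll (e : R) g x : R := \int[mu]_y (g y * mol e x y).

Lemma moll_ge0 (e : R) (v : 'rV[R]_n -> R) x : 0 < e -> (forall y, 0 <= v y) -> 0 <= moll e v x.
Proof.
by move=> e0 v0; apply: Rintegral_ge0 => y _; rewrite mulr_ge0 ?mol_ge0.
Qed.

Lemma rintegrable_mul_mol e g x : 0 < e -> rintegrable mu g ->
  rintegrable mu (fun y => g y * mol e x y).
Proof.
move=> e0 gi; have [C HC] := mol_bounded e0.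
by apply: (integrableM_bounded gi (measurable_mol2 e x) (C := C)).
Qed.

Lemma moll_fubini e a g : 0 < e -> rintegrable mu a -> rintegrable mu g ->
  rintegrable mu (fun x => a x * moll e g x) /\
  \int[mu]_x (a x * moll e g x) =
  \int[mu]_y (g y * \int[mu]_x (a x * mol e x y)).
Proof.
move=> e0 ai gi; have [C HC] := mol_bounded e0.
exact: (Rfubini ai gi (measurable_mol e) (fun z => HC z.1 z.2)).
Qed.

Lemma moll_norm_le e g x M : 0 < e -> measurable_fun setT g ->
  (forall y, `|g y| <= M) -> `|moll e g x| <= M.
Proof.
move=> e0 mg gM.
have M0 : 0 <= M by apply: le_trans (gM 0).
have iM : rintegrable mu (fun y => M * mol e x y).
  by apply: rintegrableZ; exact: rintegrable_mol2.
have gm y : `|g y * mol e x y| <= M * mol e x y.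
  by rewrite normrM (ger0_norm (mol_ge0 _ _ e0)) ler_wpM2r ?mol_ge0.
rewrite -[leRHS]mulr1.
have -> : (1 : R) = \int[mu]_y mol e x y by rewrite /Rintegral integral_mol2.
rewrite -RintegralZl//; last exact: rintegrable_mol2.
apply: Rint_norm_le => //; apply: rintegrable_le iM _ gm.
by apply: measurable_funM => //; exact: measurable_mol2.
Qed.

(** Dual form of the contraction property in L^1: Fubini moves the averaging onto the bounded
    function [a], where it does not increase the bound [A]. *)
Lemma moll_L1_bound e a g (A : R) : 0 < e -> rintegrable mu a -> rintegrable mu g ->
  (forall x, `|a x| <= A) ->
  `|\int[mu]_x (a x * moll e g x)| <= A * \int[mu]_y `|g y|.
Proof.
move=> e0 ai gi aA; have [C HC] := mol_bounded e0.
have [_ ->] := moll_fubini e0 ai gi.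
have [gai _] := Rfubini (k := fun z => mol e z.2 z.1) (C := C) gi ai
  (measurable_mol_swap e) (fun z => HC z.2 z.1).
rewrite -RintegralZl//; last exact: rintegrable_norm.
apply: Rint_norm_le => //; first by apply: rintegrableZ; exact: rintegrable_norm.
move=> y; rewrite normrM mulrC ler_wpM2r//.
have iA : rintegrable mu (fun x => A * mol e x y).
  by apply: rintegrableZ; exact: rintegrable_mol1.
rewrite -[leRHS]mulr1.
have -> : (1 : R) = \int[mu]_x mol e x y by rewrite /Rintegral integral_mol1.
rewrite -RintegralZl//; last exact: rintegrable_mol1.
apply: Rint_norm_le => //.
  by apply: (integrableM_bounded ai (measurable_mol1 e y) (C := C)).
by move=> x; rewrite normrM (ger0_norm (mol_ge0 _ _ e0)) ler_wpM2r ?mol_ge0.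
Qed.

End mollifier.

(** * Half-open boxes as generators of the Borel sets *)

Section ocbox.
Context {R : realType} {n : nat}.
Local Notation mu := (@lebesgue_rV R n).

Definition ocbox (a b : 'I_n -> R) : set 'rV[R]_n :=
  [set x | forall j, a j < x ord0 j <= b j].

Lemma ocboxI a b a' b' : ocbox a b `&` ocbox a' b' =
  ocbox (fun j => Num.max (a j) (a' j)) (fun j => Num.min (b j) (b' j)).
Proof.
apply/seteqP; split=> [x [xab xab'] j|x H].
  have /andP[h1 h2] := xab j; have /andP[h3 h4] := xab' j.
  by rewrite gt_max le_min h1 h2 h3 h4.
by split=> j; have := H j; rewrite gt_max le_min;
  move=> /andP[/andP[h1 h2] /andP[h3 h4]]; apply/andP.
Qed.

Lemma indic_ocbox a b x : \1_(ocbox a b) x =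
  tensor (fun j => \1_(`]a j, b j]%classic)) x :> R.
Proof.
rewrite indicE; case: (boolP (x \in ocbox a b)) => [|/negP]; rewrite inE => xab.
  rewrite /tensor big1// => j _; rewrite indicE.
  by have := xab j; case: (boolP (_ \in _)) => // /negP; rewrite inE/= in_itv.
have [j /negP] : exists j, ~ (a j < x ord0 j <= b j) by apply/existsNP.
rewrite (tensorD1 _ j) indicE => xj.
by rewrite (_ : (_ \in _) = false) ?mul0r//; apply/negbTE/negP; rewrite inE/= in_itv/=; exact/negP.
Qed.

Lemma measurable_ocbox a b : measurable (ocbox a b).
Proof.
apply/(@measurable_indicP _ _ R).
rewrite (_ : \1_(ocbox a b) = tensor (fun j => \1_(`]a j, b j]%classic))); last first.
  by apply/funext => x; exact: indic_ocbox.
by apply: measurable_tensor => j; apply: measurable_indic; exact: measurable_itv.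
Qed.

Lemma lebesgue_ocbox_lty a b : (mu (ocbox a b) < +oo)%E.
Proof.
rewrite -[ocbox a b]setIT -integral_indic//; last exact: measurable_ocbox.
under eq_integral do rewrite indic_ocbox.
rewrite (integral_tensor (c := fun j => fine (lebesgue_measure `]a j, b j]%classic))).
- exact: ltry.
- by move=> j; exact: measurable_indic.
- by move=> j t; rewrite indicE.
- move=> j; rewrite integral_indic// setIT fineK// lebesgue_measure_itv/=.
  by case: ifP.
Qed.

Lemma rintegrable_ocbox a b : rintegrable mu \1_(ocbox a b).
Proof. by apply: rintegrable_indic; [exact: measurable_ocbox|exact: lebesgue_ocbox_lty]. Qed.

(** Balls of the sup norm are open cubes; the lower faces are already excluded by half-open boxes,
    so only the upper faces have to recede. *)
Lemma rV_ball_ocbox (c : 'rV[R]_n) (r : R) : 0 < r -> ball c r =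
  \bigcup_k ocbox (fun j => c ord0 j - r) (fun j => c ord0 j + r - k.+1%:R^-1).
Proof.
move=> r0; apply/seteqP; split=> [y [_ cy]|y [k _ yk]].
  have : \forall k \near \oo, forall j : 'I_n, y ord0 j <= c ord0 j + r - k.+1%:R^-1.
    apply: filter_forall => j.
    have := cy ord0 j; rewrite /ball/= ltr_distlC => /andP[_ yj].
    have d0 : 0 < c ord0 j + r - y ord0 j by rewrite subr_gt0.
    near=> k; rewrite lerBrDr -lerBrDl ltW//; near: k.
    exact: near_infty_natSinv_lt (PosNum d0).
  move=> [k _ Hk]; exists k => // j.
  have := cy ord0 j; rewrite /ball/= ltr_distlC => /andP[-> _].
  exact: (Hk k (leqnn k)).
split=> // i j; rewrite (ord1 i) /ball/= ltr_distlC; have /andP[-> yj] := yk j.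
by apply: le_lt_trans yj _; rewrite ltrBlDr ltrDl invr_gt0 ltr0Sn.
Unshelve. all: by end_near. Qed.

(** Together with stability under intersection ([ocboxI]), this makes the half-open boxes a
    generating pi-system for the Dynkin argument below. *)
Lemma measurable_rV_ocbox : @measurable _ 'rV[R]_n =
  <<s [set A | exists a b, A = ocbox a b] >>.
Proof.
apply/seteqP; split; apply: smallest_sub; try exact: smallest_sigma_algebra.
- move=> A oA; rewrite (open_bigcup_rV_ball oA) bigcup_mkcond.
  apply: (countable_bigcupT_measurable (T := g_sigma_algebraType [set A | exists a b, A = ocbox a b])) => // -[q k].
  case: ifP => _; last exact: sigma_algebra0.
  rewrite rV_ball_ocbox ?invr_gt0//.
  apply: (bigcupT_measurable (s := g_sigma_algebraType [set A | exists a b, A = ocbox a b])) => m.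
  by apply: sub_sigma_algebra; eexists; eexists.
- by move=> _ [a [b ->]]; exact: measurable_ocbox.
Qed.

End ocbox.

(** * Weak convergence of mollifications *)

Section moll_cvg.
Context {R : realType} {n : nat}.
Local Notation mu := (@lebesgue_rV R n).
Implicit Types (e : R) (x y : 'rV[R]_n) (a g : 'rV[R]_n -> R).

Lemma mollD e f g x : 0 < e -> rintegrable mu f -> rintegrable mu g ->
  moll e (fun y => f y + g y) x = moll e f x + moll e g x.
Proof.
move=> e0 fi gi; rewrite /moll; under eq_Rintegral do rewrite mulrDl.
by apply: RintegralD => //; exact: rintegrable_mul_mol.
Qed.

Lemma mollZ e c g x : 0 < e -> rintegrable mu g ->
  moll e (fun y => c * g y) x = c * moll e g x.
Proof.
move=> e0 gi; rewrite /moll; under eq_Rintegral do rewrite -mulrA.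
by apply: RintegralZl => //; exact: rintegrable_mul_mol.
Qed.

Lemma mollB e f g x : 0 < e -> rintegrable mu f -> rintegrable mu g ->
  moll e (fun y => f y - g y) x = moll e f x - moll e g x.
Proof.
move=> e0 fi gi; rewrite /moll; under eq_Rintegral do rewrite mulrBl.
by apply: RintegralB => //; exact: rintegrable_mul_mol.
Qed.

(** Only bounded integrable multipliers are allowed. This makes the property closed under L^1 limits
    of [g] by [moll_L1_bound], and truncated fluxes are multipliers of this kind. *)
Definition moll_cvg g := forall a (A : R), rintegrable mu a -> (forall x, `|a x| <= A) ->
  \int[mu]_x (a x * moll k.+1%:R^-1 g x) @[k --> \oo] --> \int[mu]_x (a x * g x).

Let kV0 (k : nat) : 0 < k.+1%:R^-1 :> R. Proof. by rewrite invr_gt0. Qed.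

Lemma rintegrable_mul_moll e a g : 0 < e -> rintegrable mu a -> rintegrable mu g ->
  rintegrable mu (fun x => a x * moll e g x).
Proof. by move=> e0 ai gi; have [] := moll_fubini e0 ai gi. Qed.

Lemma rintegrable_bmul a g A : rintegrable mu a -> (forall x, `|a x| <= A) ->
  rintegrable mu g -> rintegrable mu (fun x => a x * g x).
Proof.
move=> ai aA gi; have ma := rintegrable_measurable ai.
have := integrableM_bounded gi ma aA.
by under eq_fun do rewrite /= mulrC.
Qed.

Lemma moll_cvgD f g : rintegrable mu f -> rintegrable mu g ->
  moll_cvg f -> moll_cvg g -> moll_cvg (fun x => f x + g x).
Proof.
move=> fi gi cf cg a A ai aA.
rewrite (_ : (fun k => _) = fun k : nat => \int[mu]_x (a x * moll k.+1%:R^-1 f x) +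
    \int[mu]_x (a x * moll k.+1%:R^-1 g x)); last first.
  apply/funext => k; rewrite -RintegralD//; try exact: rintegrable_mul_moll.
  by apply: eq_Rintegral => x _; rewrite mollD// mulrDr.
under eq_Rintegral do rewrite mulrDr.
rewrite RintegralD//; try exact: (rintegrable_bmul ai aA).
by apply: cvgD; [exact: cf|exact: cg].
Qed.

Lemma moll_cvgZ c g : rintegrable mu g -> moll_cvg g -> moll_cvg (fun x => c * g x).
Proof.
move=> gi cg a A ai aA.
rewrite (_ : (fun k => _) = fun k : nat => c * \int[mu]_x (a x * moll k.+1%:R^-1 g x)); last first.
  apply/funext => k; rewrite -RintegralZl//; try exact: rintegrable_mul_moll.
  by apply: eq_Rintegral => x _; rewrite mollZ// mulrCA.
under eq_Rintegral do rewrite mulrCA.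
rewrite RintegralZl//; try exact: (rintegrable_bmul ai aA).
by apply: cvgMl_tmp; exact: cg.
Qed.

Lemma moll_cvgB f g : rintegrable mu f -> rintegrable mu g ->
  moll_cvg f -> moll_cvg g -> moll_cvg (fun x => f x - g x).
Proof.
move=> fi gi cf cg.
have := moll_cvgD fi (rintegrableZ (-1) gi) cf (@moll_cvgZ (-1) g gi cg).
by under eq_fun do rewrite mulN1r.
Qed.

Lemma moll_cvg0 : moll_cvg (fun=> 0).
Proof.
move=> a A ai aA; under eq_Rintegral do rewrite mulr0.
apply: cvg_near_cst; apply: nearW => k; apply: eq_Rintegral => x _.
by rewrite /moll; under eq_Rintegral do rewrite mul0r; rewrite Rintegral_cst// mul0r mulr0.
Qed.

Lemma moll_cvg_sum (I : Type) (s : seq I) (F : I -> 'rV[R]_n -> R) :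
  (forall i, rintegrable mu (F i)) -> (forall i, moll_cvg (F i)) ->
  moll_cvg (fun x => \sum_(i <- s) F i x).
Proof.
move=> Fi cF; elim: s => [|i s IH].
  by under eq_fun do rewrite big_nil; exact: moll_cvg0.
under eq_fun do rewrite big_cons; apply: moll_cvgD => //.
exact: rintegrable_sum.
Qed.

(** Replacing [g] by [h] on either side of the limit costs at most [A] times their L^1 distance,
    uniformly in the mollification parameter. *)
Lemma moll_cvg_L1 g : rintegrable mu g ->
  (forall e, 0 < e -> exists h, [/\ rintegrable mu h, moll_cvg h &
    \int[mu]_x `|g x - h x| <= e]) -> moll_cvg g.
Proof.
move=> gi H a A ai aA.
have A0 : 0 <= A by apply: le_trans (aA 0).
apply/cvgrPdist_le => e e0.
(* [A + 1] keeps the denominator positive when [A = 0]. *)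
pose d := e / (3 * (A + 1)).
have d0 : 0 < d by rewrite divr_gt0// mulr_gt0// ltr_wpDl.
have Ad : A * d <= e / 3.
  rewrite (_ : A * d = e / 3 * (A / (A + 1))); last first.
    by rewrite /d; field; rewrite gt_eqF// ltr_wpDl.
  by rewrite ler_piMr ?divr_ge0 ?(ltW e0)// ler_pdivrMr ?ltr_wpDl// mul1r lerDl.
have [h [hi ch gh]] := H d d0.
have ghi : rintegrable mu (fun x => g x - h x) by exact: rintegrableB.
near=> k.
have ka : `|\int[mu]_x (a x * h x) - \int[mu]_x (a x * moll k.+1%:R^-1 h x)| <= e / 3.
  by near: k; apply: cvgr_dist_le; [exact: (ch a A ai aA)|rewrite divr_gt0].
have E1 : \int[mu]_x (a x * g x) - \int[mu]_x (a x * h x) =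
    \int[mu]_x (a x * (g x - h x)).
  rewrite -RintegralB//; try exact: (rintegrable_bmul ai aA).
  by apply: eq_Rintegral => x _; rewrite mulrBr.
have E2 : \int[mu]_x (a x * moll k.+1%:R^-1 g x) - \int[mu]_x (a x * moll k.+1%:R^-1 h x) =
    \int[mu]_x (a x * moll k.+1%:R^-1 (fun y => g y - h y) x).
  rewrite -RintegralB//; try exact: rintegrable_mul_moll.
  by apply: eq_Rintegral => x _; rewrite mollB// mulrBr.
have B1 : `|\int[mu]_x (a x * (g x - h x))| <= e / 3.
  apply: le_trans Ad; apply: (@le_trans _ _ (A * \int[mu]_x `|g x - h x|)); last by rewrite ler_wpM2l.
  rewrite -RintegralZl//; last exact: rintegrable_norm.
  apply: Rint_norm_le; first exact: (rintegrable_bmul ai aA).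
    by apply: rintegrableZ; exact: rintegrable_norm.
  by move=> x; rewrite normrM ler_wpM2r.
have B2 : `|\int[mu]_x (a x * moll k.+1%:R^-1 (fun y => g y - h y) x)| <= e / 3.
  apply: le_trans Ad; apply: (le_trans (moll_L1_bound _ ai ghi aA)) => //.
  by rewrite ler_wpM2l.
rewrite (_ : _ - _ = \int[mu]_x (a x * (g x - h x)) +
  (\int[mu]_x (a x * h x) - \int[mu]_x (a x * moll k.+1%:R^-1 h x)) -
  \int[mu]_x (a x * moll k.+1%:R^-1 (fun y => g y - h y) x)); last first.
  by rewrite -E1 -E2; ring.
apply: (le_trans (ler_normB _ _)).
by have := ler_normD (\int[mu]_x (a x * (g x - h x)))
  (\int[mu]_x (a x * h x) - \int[mu]_x (a x * moll k.+1%:R^-1 h x)); lra.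
Unshelve. all: by end_near. Qed.

(** The kernel at [x] samples only points strictly below [x] in every coordinate and at distance
    less than [1/(k+1)]. For large [k] these lie all inside the box or all outside it, according to
    [x], so the averages are eventually constant at every point, including the faces, and dominated
    convergence applies. *)
Lemma moll_cvg_ocbox b c : moll_cvg \1_(ocbox b c).
Proof.
move=> a A ai aA.
have iB := @rintegrable_ocbox R n b c.
apply: (proj2 (@Rdominated_cvg _ _ _ mu
  (fun k x => a x * moll k.+1%:R^-1 \1_(ocbox b c) x) (fun x => a x * \1_(ocbox b c) x)
  (fun x => `|a x|) _ _ _ _)).
- by move=> k; apply: rintegrable_measurable; exact: rintegrable_mul_moll.
- move=> x; apply: cvgMl_tmp.
  have [xB|nxB] := pselect (ocbox b c x).
    rewrite indicE mem_set//; apply: cvg_near_cst.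
    have : \forall k \near \oo, forall j : 'I_n, b j < x ord0 j - k.+1%:R^-1.
      apply: filter_forall => j; have /andP[bx _] := xB j.
      have d0 : 0 < x ord0 j - b j by rewrite subr_gt0.
      near=> k; rewrite ltrBrDr -ltrBrDl; near: k.
      exact: near_infty_natSinv_lt (PosNum d0).
    apply: filterS => k Hk; rewrite /moll.
    rewrite (_ : 1%:R = \int[mu]_y mol k.+1%:R^-1 x y); last by rewrite /Rintegral integral_mol2.
    apply: eq_Rintegral => y _.
    have [H|H] := pselect (forall j, y ord0 j < x ord0 j /\ x ord0 j < y ord0 j + k.+1%:R^-1).
      rewrite indicE mem_set ?mul1r// => j; have [yx xy] := H j.
      have /andP[_ xc] := xB j; have bx := Hk j.
      by apply/andP; split; [rewrite (lt_trans bx)// ltrBlDr|exact: ltW (lt_le_trans yx xc)].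
    by rewrite mol_eq0 ?mulr0.
  rewrite indicE memNset//; apply: cvg_near_cst.
  have [j /negP] : exists j, ~ (b j < x ord0 j <= c j) by apply/existsNP.
  rewrite negb_and -leNgt -ltNge => Hj.
  have : \forall k \near \oo, x ord0 j <= b j \/ c j < x ord0 j - k.+1%:R^-1.
    case/orP: Hj => Hj; first by apply: nearW; left.
    have d0 : 0 < x ord0 j - c j by rewrite subr_gt0.
    near=> k; right; rewrite ltrBrDr -ltrBrDl; near: k.
    exact: near_infty_natSinv_lt (PosNum d0).
  apply: filterS => k Hk; rewrite /moll.
  transitivity (\int[mu]_y 0); last by rewrite Rintegral_cst// mul0r.
  apply: eq_Rintegral => y _.
  have [H|H] := pselect (forall j, y ord0 j < x ord0 j /\ x ord0 j < y ord0 j + k.+1%:R^-1).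
    rewrite indicE memNset ?mul0r// => yB; have [yx xy] := H j.
    have /andP[by1 yc] := yB j; case: Hk => Hk.
      by have := lt_le_trans (lt_trans by1 yx) Hk; rewrite ltxx.
    by move: xy; rewrite -ltrBlDr => /(lt_trans Hk)/lt_le_trans/(_ yc); rewrite ltxx.
  by rewrite mol_eq0 ?mulr0.
- exact: rintegrable_norm.
- move=> k x; rewrite normrM ler_piMr//; apply: moll_norm_le => //.
    exact: rintegrable_measurable iB.
  by move=> y; rewrite indicE; case: (_ \in _); rewrite ?normr1 ?normr0.
Unshelve. all: by end_near. Qed.

End moll_cvg.

Import HBSimple.
Section moll_cvg_all.
Context {R : realType} {n : nat}.
Local Notation mu := (@lebesgue_rV R n).
Implicit Types (e : R) (x y : 'rV[R]_n) (a g : 'rV[R]_n -> R).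

Lemma rintegrable_indicI_ocbox b c (S : set 'rV[R]_n) : measurable S ->
  rintegrable mu (\1_(S `&` ocbox b c)).
Proof.
move=> mS; have mB := measurable_ocbox b c; apply: rintegrable_indic.
  exact: measurableI.
by apply: le_lt_trans (lebesgue_ocbox_lty b c); apply: le_measure; rewrite ?inE//;
  exact: measurableI.
Qed.

Lemma moll_cvg_L1_seq g (h : nat -> 'rV[R]_n -> R) G : rintegrable mu g ->
  (forall k, rintegrable mu (h k)) -> (forall k, moll_cvg (h k)) ->
  rintegrable mu G -> (forall k x, `|g x - h k x| <= G x) ->
  (forall x, h k x @[k --> \oo] --> g x) -> moll_cvg g.
Proof.
move=> gi hi ch Gi gh hg; apply: moll_cvg_L1 => // e e0.
have [_] := @Rdominated_cvg _ _ _ mu (fun k x => `|g x - h k x|) (fun=> 0) G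
  (fun k => rintegrable_measurable (rintegrable_norm (rintegrableB gi (hi k))))
  (fun x => ltac:(rewrite -(normr0 R) -(subrr (g x));
     apply: cvg_norm; apply: cvgB; [exact: cvg_cst|exact: hg])) Gi
  (fun k x => ltac:(rewrite normr_id; exact: gh)).
rewrite Rintegral_cst// mul0r => /cvgr0Pnorm_le/(_ e e0)[k _ /(_ k (leqnn k)) Hk].
exists (h k); split=> //; apply: le_trans Hk; exact: ler_norm.
Qed.

(** Dynkin induction on [S]. The fixed box keeps all measures finite, so that complementation
    becomes a difference of integrable functions. *)
Lemma moll_cvg_indicI b c (S : set 'rV[R]_n) : measurable S ->
  moll_cvg (\1_(S `&` ocbox b c) : _ -> R).
Proof.
set D := ocbox b c; rewrite {1}measurable_rV_ocbox => mS.
pose P S := moll_cvg (\1_(S `&` D) : 'rV[R]_n -> R).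
apply: (@dynkin_induction _ _ _ P measurable_rV_ocbox _ _ _ _ _ S mS).
- move=> _ _ [a1 [b1 ->]] [a2 [b2 ->]]; rewrite ocboxI.
  by eexists; eexists.
- by rewrite /P setTI; exact: moll_cvg_ocbox.
- by move=> _ [a1 [b1 ->]]; rewrite /P ocboxI; exact: moll_cvg_ocbox.
- move=> A mA PA; rewrite /P (_ : \1_(~` A `&` D) = fun x => \1_D x - \1_(A `&` D) x).
    by apply: moll_cvgB => //; [exact: rintegrable_ocbox|
      exact: rintegrable_indicI_ocbox|exact: moll_cvg_ocbox].
  apply/funext => x; rewrite !indicE !in_setI in_setC.
  by case: (x \in A); case: (x \in D); rewrite /= ?subrr ?subr0.
- move=> F mF tF PF.
  have mU : measurable (\bigcup_k F k) by exact: bigcupT_measurable.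
  (* By disjointness at most one summand is nonzero, so the partial sums are indicators and [\1_D]
     dominates the error. *)
  have sumE m x : \sum_(k <- iota 0 m) (\1_(F k `&` D) x : R) =
      ((x \in D) && has (fun k => x \in F k) (iota 0 m))%:R.
    case: (boolP (x \in D)) => xD /=; last first.
      by rewrite big1// => k _; rewrite indicE in_setI (negPf xD) andbF.
    have [/hasP[k km xk]|/hasPn H] := boolP (has _ _); last first.
      rewrite big_seq big1// => k km; rewrite indicE in_setI.
      by rewrite (negPf (H k km)).
    rewrite (bigD1_seq k)//=; last exact: iota_uniq.
    rewrite big1 ?addr0; first by rewrite indicE in_setI xk xD.
    move=> l lk; rewrite indicE in_setI.
    case: (boolP (x \in F l)) => // xl; exfalso; move/eqP: lk; apply.
    by apply: tF => //; exists x; split; exact/set_mem.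
  apply: (@moll_cvg_L1_seq _ (fun m x => \sum_(k <- iota 0 m) \1_(F k `&` D) x) \1_D).
  + exact: rintegrable_indicI_ocbox.
  + by move=> m; apply: rintegrable_sum => k; exact: rintegrable_indicI_ocbox.
  + move=> m; apply: moll_cvg_sum => k; first exact: rintegrable_indicI_ocbox.
    exact: PF.
  + exact: rintegrable_ocbox.
  + move=> m x; rewrite sumE indicE in_setI [X in _ <= X]indicE.
    case: (x \in D); rewrite /= ?andbF ?subrr ?normr0// andbT.
    have [_|_] := boolP (has _ _); case: (boolP (_ \in _)) => _;
      by rewrite ?subrr ?subr0 ?sub0r ?normrN ?normr0 ?normr1.
  + move=> x; apply: cvg_near_cst.
    under eq_near do rewrite sumE.
    have [[k _ xk]|nx] := pselect ((\bigcup_k F k) x); last first.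
      apply: nearW => m; rewrite indicE in_setI (memNset nx) andFb.
      case: hasP => [[k _ /set_mem xk]|_]; last by rewrite andbF.
      by exfalso; apply: nx; exists k.
    exists k.+1 => // m /= km; rewrite indicE in_setI andbC; congr (_ && _)%:R.
    rewrite mem_set; last by exists k.
    by apply/hasP; exists k; [rewrite mem_iota|exact: mem_set].
Qed.

(** The level set of the value [0] may have infinite measure, so [s] is first cut off by growing
    boxes, with [|s|] dominating the error. *)
Lemma moll_cvg_sfun (s : {sfun 'rV[R]_n >-> R}) : rintegrable mu s -> moll_cvg s.
Proof.
move=> si; pose D k := @ocbox R n (fun=> - k%:R) (fun=> k%:R).
have mD k : measurable (D k) by exact: measurable_ocbox.
have sE k x : s x * \1_(D k) x =
    \sum_(r <- finmap.enum_fset (fset_set (range s))) r * \1_(s @^-1` [set r] `&` D k) x.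
  rewrite {1}fimfunE fsbig_finite//= mulr_suml; apply: eq_bigr => r _.
  by rewrite indicI -mulrA.
have iD r k : rintegrable mu \1_(s @^-1` [set r] `&` D k).
  exact: rintegrable_indicI_ocbox.
apply: (@moll_cvg_L1_seq _ (fun k x => s x * \1_(D k) x) (fun x => `|s x|)) => //.
- move=> k; under eq_fun do rewrite /= sE.
  by apply: rintegrable_sum => r; exact: rintegrableZ.
- move=> k; under eq_fun do rewrite /= sE.
  apply: moll_cvg_sum => r; first exact: rintegrableZ.
  by apply: moll_cvgZ => //; exact: moll_cvg_indicI.
- exact: rintegrable_norm.
- move=> k x; rewrite indicE; case: (_ \in _); first by rewrite mulr1 subrr normr0.
  by rewrite mulr0 subr0.
- move=> x; apply: cvg_near_cst.
  have : \forall k \near \oo, forall j : 'I_n, `|x ord0 j| < k%:R.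
    by apply: filter_forall => j; exact: nbhs_infty_gtr.
  apply: filterS => k Hk; rewrite indicE mem_set ?mulr1// => j.
  by have := Hk j; rewrite ltr_norml => /andP[-> /ltW].
Qed.

Lemma moll_cvg_integrable g : rintegrable mu g -> moll_cvg g.
Proof.
move=> gi; apply: moll_cvg_L1 => // e e0.
have [s [si _]] := approximation_sfun_integrable measurableT gi.
move=> /fine_cvgP[_ /cvgr0Pnorm_le/(_ e e0)[k _ /(_ k (leqnn k)) Hk]].
exists (s k); split; [exact: si|exact: moll_cvg_sfun (si k)|].
apply: le_trans Hk; rewrite /= /Rintegral.
exact: ler_norm.
Qed.

End moll_cvg_all.

(** * The sup bound and the pairing identity *)
Section sup_bound.
Context {R : realType} {n : nat}.
Local Notation mu := (@lebesgue_rV R n).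
Local Notation leb := (@lebesgue_measure R).
Implicit Types (u : 'rV[R]_n -> R) (G F : 'I_n -> 'rV[R]_n -> R) (H : 'I_n -> R -> R)
  (lo hi : 'I_n -> R).

(** The integrals run over the whole space because [u] and [G] will be extensions by zero; the
    support of [H] confines the identity to the box. *)
Definition weak_grad_on lo hi u G := forall H, (forall j, smooth1 (H j)) ->
  supp_in H lo hi -> forall i,
  \int[mu]_y (u y * partial i (tensor H) y) = - \int[mu]_y (G i y * tensor H y).

Lemma derive1_supp (g : R -> R) a b : (forall t, t < a \/ b < t -> g t = 0) ->
  forall t, t < a \/ b < t -> g^`()%classic t = 0.
Proof.
move=> g0 t tab; rewrite derive1E.
have : is_derive t 1 g 0.
  apply: (@near_eq_is_derive _ _ _ (cst 0)).
  case: tab => tab; near=> s; rewrite g0//; [left|right]; near: s;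
    [exact: lt_nbhsl|exact: lt_nbhsr].
by case.
Unshelve. all: by end_near. Qed.

Lemma tensor_bounded H lo hi : (forall j, smooth1 (H j)) -> supp_in H lo hi ->
  exists C : R, forall x, `|tensor H x| <= C.
Proof.
move=> sH Hs.
have /choice[C HC] : forall j, exists C : R, forall t, `|H j t| <= C.
  by move=> j; have [C _ HC] := smooth1_bounded (sH j) (Hs j); exists C.
exists (\prod_j C j) => x; rewrite normr_prod; apply: ler_prod => j _.
by rewrite normr_ge0 HC.
Qed.

Lemma measurable_smooth_tensor H : (forall j, smooth1 (H j)) ->
  measurable_fun setT (tensor H).
Proof.
move=> sH; apply: measurable_tensor => j; apply: continuous_measurable_fun.
exact: smooth1_continuous.
Qed.

Lemma rintegrable_mul_tensor u H lo hi : rintegrable mu u ->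
  (forall j, smooth1 (H j)) -> supp_in H lo hi ->
  rintegrable mu (fun y => u y * tensor H y).
Proof.
move=> ui sH Hs; have [C HC] := tensor_bounded sH Hs.
exact: (integrableM_bounded ui (measurable_smooth_tensor sH) HC).
Qed.

Lemma supp_in_upd H lo hi i g : supp_in H lo hi ->
  (forall t, t < lo i \/ hi i < t -> g t = 0) -> supp_in (upd H i g) lo hi.
Proof. by move=> Hs gs j t tj; rewrite /upd; case: eqP => [ji|_]; [rewrite ji in tj; exact: gs|exact: Hs]. Qed.

Lemma integral_unit_supp (P : R -> R) (a b : R) : a <= b -> measurable_fun setT P ->
  (forall t, 0 <= P t <= 1) -> (forall t, t < a \/ b < t -> P t = 0) ->
  exists2 r, 0 <= r <= b - a & (\int[leb]_t (P t)%:E = r%:E)%E.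
Proof.
move=> ab mP P01 Ps.
have le : (\int[leb]_t (P t)%:E <= (b - a)%:E)%E.
  have -> : ((b - a)%:E = \int[leb]_t (\1_(`[a, b]%classic) t)%:E)%E.
    rewrite integral_indic// setIT; apply/esym; apply: etrans (lebesgue_measure_itv `[a, b]) _ => /=.
    case: ifPn; first by rewrite EFinB.
    by rewrite lte_fin -leNgt => ba; rewrite (@le_anti _ _ a b) ?subrr ?ab.
  apply: ge0_le_integral => //.
  - by move=> t _; rewrite lee_fin; have /andP[] := P01 t.
  - exact/measurable_EFinP.
  - by apply/measurable_EFinP; exact: measurable_indic.
  move=> t _; rewrite lee_fin indicE; case: (boolP (t \in _)) => [_|].
    by have /andP[] := P01 t.
  rewrite notin_setE/= in_itv/= => /negP; rewrite negb_and -!ltNge => /orP tab.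
  by rewrite Ps.
have ge : (0 <= \int[leb]_t (P t)%:E)%E.
  by apply: integral_ge0 => t _; rewrite lee_fin; have /andP[] := P01 t.
have fin : (\int[leb]_t (P t)%:E)%E \is a fin_num.
  by rewrite ge0_fin_numE//; apply: le_lt_trans le _; rewrite ltry.
exists (fine (\int[leb]_t (P t)%:E)%E); last by rewrite fineK.
by rewrite -!lee_fin fineK// ge.
Qed.

(* Interpolates between [tensor b] and [tensor a] by changing one factor at a
   time; each change is a partial derivative of a nonnegative test function. *)
Definition hyb (a b : 'I_n -> R -> R) (m : nat) : 'I_n -> R -> R :=
  fun j => if (j < m)%N then a j else b j.

Lemma tensor_hyb_telescope (a b : 'I_n -> R -> R) x :
  tensor b x - tensor a x =
  \sum_(i < n) tensor (upd (hyb a b i) i (fun t => b i t - a i t)) x.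
Proof.
have -> : tensor b x - tensor a x = - (tensor (hyb a b n) x - tensor (hyb a b 0) x).
  rewrite opprB; congr (_ - _).
  by apply: eq_bigr => j _; rewrite /hyb ltn_ord.
rewrite -(@telescope_sumr _ 0 n (fun m => tensor (hyb a b m) x))// big_mkord -sumrN; apply: eq_bigr => i _.
rewrite opprB tensor_upd !(tensorD1 _ i) {1 3}/hyb ltnn ltnSn mulrBl; congr (_ - _ * _).
apply: eq_bigr => j ji; rewrite /hyb ltnS leq_eqVlt.
by rewrite (_ : (j == i :> nat) = false)//; exact/negbTE.
Qed.

Lemma upd_eq H i g : upd H i g i = g.
Proof. by rewrite /upd eqxx. Qed.

Lemma upd_upd H i g g' : upd (upd H i g) i g' = upd H i g'.
Proof. by apply/funext => j; rewrite /upd; case: eqP. Qed.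

Lemma tensorZ_upd H i k g x : tensor (upd H i (fun t => k * g t)) x = k * tensor (upd H i g) x.
Proof. by rewrite !tensor_upd mulrA. Qed.

Lemma moll_sup_bound u G (sigma L c : 'I_n -> R) (h e s Cb : R) (x : 'rV[R]_n) :
  0 < e -> e <= h -> rintegrable mu u -> (forall i, rintegrable mu (G i)) ->
  weak_grad_on (fun j => c j - 4 * h) (fun j => c j + 4 * h) u G ->
  (forall i, sigma i = 1 \/ sigma i = -1) -> s = 1 \/ s = -1 ->
  (forall i y, cbox (fun j => c j - 4 * h) (fun j => c j + 4 * h) y ->
     L i <= sigma i * G i y) ->
  (forall t : R, bump t <= Cb) -> (forall j, `|x ord0 j - c j| <= h) ->
  s * moll e u x <=
  (h^-1 * Cb) ^+ n * \int[mu]_y `|u y| + 5 * h * \sum_(i < n) `|L i|.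
Proof.
move=> e0 eh ui Gi uG sig s1 LG HCb xc.
have h0 : 0 < h by exact: lt_le_trans eh.
set lo := (fun j => c j - 4 * h) in uG LG *.
set hi := (fun j => c j + 4 * h) in uG LG *.
pose tau j := s * sigma j.
have tau1 j : tau j = 1 \/ tau j = -1.
  by rewrite /tau; case: s1 => ->; case: (sig j) => ->; rewrite ?mul1r ?mulN1r ?opprK; [left|right|right|left].
have tautau j : tau j * tau j = 1 by case: (tau1 j) => ->; rewrite ?mulr1// mulrNN mulr1.
have stau j : s * tau j = sigma j.
  by rewrite /tau mulrA; case: s1 => ->; rewrite ?mulrNN !mul1r.
have xcj j : c j - h <= x ord0 j <= c j + h by have := xc j; rewrite ler_distl.
(* The support of [b j] lies in [[c j - 2 * h, c j + h]], because [e <= h]. The shift by [2 * h]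
   puts the support of [a j], of length [h], entirely on one side of it, the side being given by
   [tau j]; hence the primitive [P j] of [tau j * (b j - a j)] is nonnegative. *)
pose d j := c j + tau j * (2 * h).
pose b (j : 'I_n) t := rho e (x ord0 j - t).
pose a (j : 'I_n) t := rho h (d j - t).
pose P (j : 'I_n) t := tau j * (step ((d j - t) / h) - step ((x ord0 j - t) / e)).
have sP j : smooth1 (P j).
  by apply: smooth1Z; apply: smooth1B; apply: smooth1_refl_scale; exact: smooth1_step.
have sa j : smooth1 (a j) by exact: smooth1_rho_refl.
have sb j : smooth1 (b j) by exact: smooth1_rho_refl.
have P'E j : (P j)^`()%classic = (fun t => tau j * (b j t - a j t)).
  apply: derive1_is_derive => t.
  have := smooth1_is_derive t (smooth1_refl_scale (x ord0 j) e (@smooth1_step R)).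
  rewrite (derive1_refl_scale _ _ (@smooth1_step R)) => d1.
  have := smooth1_is_derive t (smooth1_refl_scale (d j) h (@smooth1_step R)).
  rewrite (derive1_refl_scale _ _ (@smooth1_step R)) => d2.
  apply: is_derive_eq (is_deriveZ (tau j) (is_deriveB d2 d1)) _.
  by rewrite /GRing.scale/= /b /a /rho /bump; ring.
have P01 j t : 0 <= P j t <= 1.
  have xj := xcj j.
  have s0 := @step_ge0 R ((d j - t) / h); have s1' := @step_le1 R ((d j - t) / h).
  have t0 := @step_ge0 R ((x ord0 j - t) / e); have t1 := @step_le1 R ((x ord0 j - t) / e).
  rewrite /P; case: (tau1 j) => tj; rewrite tj.
    have [xt|xt] := leP (x ord0 j) t.
      by rewrite (@step_le0 _ ((x ord0 j - t) / e)) ?pmulr_lle0 ?invr_gt0 ?subr_le0// subr0 mul1r s0.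
    rewrite (@step_ge1 _ ((d j - t) / h)); first by apply/andP; split; lra.
    by rewrite ler_pdivlMr// /d tj; lra.
  have [dt|dt] := leP (d j) t.
    by rewrite (@step_le0 _ ((d j - t) / h)) ?pmulr_lle0 ?invr_gt0 ?subr_le0//; apply/andP; split; lra.
  rewrite (@step_ge1 _ ((x ord0 j - t) / e)); first by apply/andP; split; lra.
  by rewrite ler_pdivlMr//; move: dt; rewrite /d tj; lra.
(* The length [5 * h] of this interval is the origin of the constant [5]; the half-side [4 * h] of
   the ambient box leaves room for it. *)
have Ps j t : t < c j - 3 * h \/ c j + 2 * h < t -> P j t = 0.
  have xj := xcj j; rewrite /P => -[tj|tj].
    rewrite !step_ge1 ?subrr ?mulr0// ler_pdivlMr//; first by lra.
    by rewrite /d; case: (tau1 j) => ->; lra.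
  rewrite !step_le0 ?subrr ?mulr0// pmulr_lle0 ?invr_gt0//; first by lra.
  by rewrite /d; case: (tau1 j) => ->; lra.
have bs j t : t < lo j \/ hi j < t -> b j t = 0.
  rewrite /lo /hi => tj; apply: rho_eq0 => //; have xj := xcj j.
  by case: tj => tj; [right|left]; lra.
have as_ j t : t < lo j \/ hi j < t -> a j t = 0.
  rewrite /lo /hi => tj; apply: rho_eq0 => //.
  by rewrite /d; case: (tau1 j) => ->; case: tj => tj; [right|left|right|left]; lra.
pose phi (i : 'I_n) := upd (hyb a b i) i (P i).
have sh m j : smooth1 (hyb a b m j) by rewrite /hyb; case: ifP.
have hs m : supp_in (hyb a b m) lo hi.
  by move=> j t tj; rewrite /hyb; case: ifP => _; [exact: as_|exact: bs].
have sphi i j : smooth1 (phi i j) by exact: smooth1_upd.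
have phis i : supp_in (phi i) lo hi.
  apply: supp_in_upd => // t ti; apply: Ps; move: ti; rewrite /lo /hi => ti.
  by case: ti => ti; [left|right]; lra.
have h_ge0 m j t : 0 <= hyb a b m j t.
  by rewrite /hyb; case: ifP => _; exact: rho_ge0.
have phi0 i y : 0 <= tensor (phi i) y.
  apply: prodr_ge0 => j _; rewrite /phi /upd; case: eqP => _ //.
  by have /andP[] := P01 i (y ord0 j).
have partialE i : partial i (tensor (phi i)) = tensor (upd (hyb a b i) i (fun t => tau i * (b i t - a i t))).
  by rewrite partial_tensor// /phi upd_upd upd_eq P'E.
have teleE y : tensor b y - tensor a y = \sum_(i < n) tau i * partial i (tensor (phi i)) y.
  rewrite tensor_hyb_telescope; apply: eq_bigr => i _.
  by rewrite partialE tensorZ_upd mulrA tautau mul1r.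
have ib : rintegrable mu (fun y => u y * tensor b y) by exact: (rintegrable_mul_tensor ui sb bs).
have ia : rintegrable mu (fun y => u y * tensor a y) by exact: (rintegrable_mul_tensor ui sa as_).
have ip i : rintegrable mu (fun y => u y * partial i (tensor (phi i)) y).
  rewrite partialE; apply: (rintegrable_mul_tensor ui (lo := lo) (hi := hi)).
    by rewrite -P'E; apply: smooth1_upd => //; exact: smooth1_derive1.
  by apply: supp_in_upd => // t ti; rewrite bs// as_// subrr mulr0.
have mollE : moll e u x = \int[mu]_y (u y * tensor b y) by [].
(* All factors but the [i]-th are kernels of unit mass, whatever their width, so only the integral
   of [P i] remains and nothing depends on [e]. *)
have iphi i : exists2 r, 0 <= r <= 5 * h & rintegrable mu (tensor (phi i)) /\ \int[mu]_y tensor (phi i) y = r.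
  have [r r5 Pr] := @integral_unit_supp (P i) (c i - 3 * h) (c i + 2 * h) ltac:(lra)
    (continuous_measurable_fun (smooth1_continuous (sP i))) (P01 i) (Ps i).
  have I : (\int[mu]_y (tensor (phi i) y)%:E = r%:E)%E.
    have := @integral_tensor _ n (phi i) (fun j => if j == i then r else 1).
    rewrite -big_mkcond big_pred1_eq; apply.
    - by move=> j; apply: continuous_measurable_fun; exact: smooth1_continuous.
    - move=> j t; rewrite /phi /upd; case: eqP => _ //.
      by have /andP[] := P01 i t.
    - move=> j; rewrite /phi /upd; case: eqP => _ //.
      by rewrite /hyb; case: ifP => _; exact: integral_rho_refl.
  exists r; first by move: r5; rewrite (_ : c i + _ - _ = 5 * h)//; ring.
  split; last by rewrite /Rintegral I.
  apply/integrableP; split.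
    by apply/measurable_EFinP; exact: measurable_smooth_tensor.
  by under eq_integral => y _ do rewrite /= ger0_norm//; rewrite I ltry.
have iG i : rintegrable mu (fun y => G i y * tensor (phi i) y) by exact: (rintegrable_mul_tensor (Gi i) (sphi i) (phis i)).
have D1 : s * (\int[mu]_y (u y * tensor b y) - \int[mu]_y (u y * tensor a y)) =
    - \sum_(i < n) sigma i * \int[mu]_y (G i y * tensor (phi i) y).
  rewrite -(RintegralB measurableT ib ia).
  rewrite (_ : \int[mu]_y _ = \int[mu]_y (\sum_(i < n) tau i * (u y * partial i (tensor (phi i)) y))).
    rewrite Rint_sum; last by move=> i; exact: rintegrableZ.
    rewrite mulr_sumr -sumrN; apply: eq_bigr => i _.
    by rewrite (RintegralZl _ measurableT (ip i)) (uG _ (sphi i) (phis i)) !mulrN mulrA stau.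
  apply: eq_Rintegral => y _; rewrite -mulrBr teleE mulr_sumr.
  by apply: eq_bigr => i _; rewrite mulrCA.
have D2 : - \sum_(i < n) sigma i * \int[mu]_y (G i y * tensor (phi i) y) <= 5 * h * \sum_(i < n) `|L i|.
  rewrite -sumrN mulr_sumr; apply: ler_sum => i _.
  have [r /andP[r0 r5] [ir Ir]] := iphi i.
  rewrite -RintegralZl// lerNl.
  apply: (@le_trans _ _ (L i * r)).
    rewrite lerNl (le_trans (ler_norm _))// normrN normrM mulrC (ger0_norm r0).
    by rewrite ler_wpM2r.
  rewrite -Ir -RintegralZl//; apply: le_Rintegral => //.
  - exact: rintegrableZ.
  - exact: rintegrableZ.
  move=> y _; rewrite mulrA.
  have [yK|nyK] := pselect (cbox lo hi y); first by rewrite ler_wpM2r// LG.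
  by rewrite (tensor_eq0 (phis i) nyK) !mulr0.
(* The displaced average has width [h], so each factor of its kernel is at most [Cb / h], again
   independently of [e]. *)
have D3 : s * \int[mu]_y (u y * tensor a y) <= (h^-1 * Cb) ^+ n * \int[mu]_y `|u y|.
  apply: (@le_trans _ _ `|\int[mu]_y (u y * tensor a y)|).
    by case: s1 => ->; [rewrite mul1r ler_norm|rewrite mulN1r -normrN ler_norm].
  rewrite -RintegralZl//; last exact: rintegrable_norm.
  apply: Rint_norm_le => //; first by apply: rintegrableZ; exact: rintegrable_norm.
  move=> y; rewrite normrM mulrC ler_wpM2r// normr_prod -[n in leRHS]card_ord -prodr_const.
  apply: ler_prod => j _; rewrite normr_ge0/= ger0_norm ?rho_ge0//.
  by rewrite ler_wpM2l// invr_ge0 ltW.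
move: D1 D3; rewrite mollE.
set B := \int[mu]_y (u y * tensor b y); set A := \int[mu]_y (u y * tensor a y) => D1 D3.
by rewrite -[B](subrK A) mulrDr D1 addrC lerD.
Qed.

End sup_bound.

(** * Pairing the flux with the mollified gradient *)

Section pairing.
Context {R : realType} {n : nat}.
Local Notation mu := (@lebesgue_rV R n).
Implicit Types (u f : 'rV[R]_n -> R) (G F : 'I_n -> 'rV[R]_n -> R) (H : 'I_n -> R -> R)
  (lo hi : 'I_n -> R).

Definition weak_div_on lo hi F f := forall H, (forall j, smooth1 (H j)) ->
  supp_in H lo hi ->
  - (\int[mu]_x (\sum_(i < n) F i x * partial i (tensor H) x)) =
  \int[mu]_x (f x * tensor H x).

(** Instead of a plateau, the cutoff profile has the positive lower bound of [bell_ge] on half of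
    its support; this costs a factor depending only on [n] in the final estimate. *)
Definition bell (s : R) : R := flat 1 (1 * s + 1) * flat 1 (-1 * s + 1).

Lemma smooth1_bell : smooth1 bell.
Proof. by apply: smooth1M; apply: smooth1_affine; exact: smooth1_flat. Qed.

Lemma bell_ge0 s : 0 <= bell s.
Proof. by rewrite mulr_ge0 ?flat1_ge0. Qed.

Lemma bell_le1 s : bell s <= 1.
Proof. by rewrite -[leRHS]mulr1 ler_pM ?flat1_ge0 ?flat1_le1. Qed.

Lemma bell_eq0 s : s < -1 \/ 1 < s -> bell s = 0.
Proof.
rewrite /bell => -[s1|s1]; first by rewrite flat_le0 ?mul0r//; lra.
by rewrite [X in _ * X]flat_le0 ?mulr0//; lra.
Qed.

Lemma bell_ge s : `|s| <= 2^-1 -> flat 1 2^-1 ^+ 2 <= bell s.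
Proof.
rewrite ler_norml => /andP[s1 s2].
by rewrite expr2 ler_pM ?flat1_ge0// flat1_le//; lra.
Qed.

Lemma flat_half_gt0 : 0 < flat 1 2^-1 :> R.
Proof. by apply: flat1_gt0; rewrite invr_gt0. Qed.

Definition cutoff (c : 'I_n -> R) (h : R) : 'I_n -> R -> R :=
  fun j s => bell ((s - c j) / h).

Lemma smooth1_cutoff c h j : smooth1 (cutoff c h j).
Proof. by apply: smooth1_shift_scale; exact: smooth1_bell. Qed.

Lemma cutoff_eq0 c h j s : 0 < h -> s < c j - h \/ c j + h < s -> cutoff c h j s = 0.
Proof.
move=> h0 H; apply: bell_eq0.
by case: H => H; [left; rewrite ltr_pdivrMr//|right; rewrite ltr_pdivlMr//]; lra.
Qed.

Lemma cutoff_neq0 c h x j : 0 < h -> tensor (cutoff c h) x != 0 -> `|x ord0 j - c j| <= h.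
Proof.
move=> h0; rewrite leNgt; apply: contra_neqN => H.
rewrite (tensorD1 _ j) cutoff_eq0 ?mul0r//.
by move: H; rewrite ltr_normr => /orP[H|H]; [right|left]; lra.
Qed.

Lemma rho_refl_derive e x t : (fun s => rho e (x - s))^`()%classic t =
  - (rho e)^`()%classic (x - t) :> R.
Proof.
have sr : smooth1 (rho e).
  by have := @smooth1_rho_shift R e 0; under eq_fun do rewrite subr0.
have := derive1_refl_scale x 1 sr.
rewrite (_ : (fun s => rho e ((x - s) / 1)) = fun s => rho e (x - s)); last first.
  by apply/funext => s; rewrite divr1.
by move=> ->; rewrite !invr1 mul1r mulr1.
Qed.

Lemma rho_shift_derive e y t : (fun s => rho e (s - y))^`()%classic t =
  (rho e)^`()%classic (t - y) :> R.
Proof.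
have sr : smooth1 (rho e).
  by have := @smooth1_rho_shift R e 0; under eq_fun do rewrite subr0.
have := derive1_shift_scale y 1 sr.
rewrite (_ : (fun s => rho e ((s - y) / 1)) = fun s => rho e (s - y)); last first.
  by apply/funext => s; rewrite divr1.
by move=> ->; rewrite !invr1 mul1r mulr1.
Qed.

Lemma smooth1_rho e : smooth1 (rho e : R -> R).
Proof. by have := @smooth1_rho_shift R e 0; under eq_fun do rewrite subr0. Qed.

(** The derivative of [mol e] in the [i]-th coordinate of [x]. As the kernel depends on [x - y]
    only, it is also minus the derivative in [y], and this is how the weak gradient of [u] meets the
    equation for the flux. *)
Definition dmol (e : R) (i : 'I_n) (x y : 'rV[R]_n) : R :=
  \prod_(j < n) (upd (fun=> rho e) i ((rho e)^`()%classic)) j (x ord0 j - y ord0 j).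

Lemma dmol_bounded e i : 0 < e -> exists C : R, forall x y, `|dmol e i x y| <= C.
Proof.
move=> e0.
have rs (t : R) : t < 0 \/ e < t -> rho e t = 0.
  by move=> t0; apply: rho_eq0 => //; case: t0 => /ltW ?; [left|right].
have /choice[C HC] : forall j : 'I_n, exists C : R, forall t,
    `|upd (fun=> rho e) i ((rho e)^`()%classic) j t| <= C.
  move=> j; rewrite /upd; case: eqP => _.
    have [C _ HC] := smooth1_bounded (smooth1_derive1 (smooth1_rho e)) (derive1_supp rs).
    by exists C.
  by have [C _ HC] := smooth1_bounded (smooth1_rho e) rs; exists C.
exists (\prod_j C j) => x y; rewrite normr_prod; apply: ler_prod => j _.
by rewrite normr_ge0 HC.
Qed.

Lemma measurable_dmol e i :
  measurable_fun setT (fun z : 'rV[R]_n * 'rV[R]_n => dmol e i z.1 z.2).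
Proof.
apply: measurable_prod => j _.
have mr : measurable_fun setT (upd (fun=> rho e) i ((rho e)^`()%classic) j).
  apply: continuous_measurable_fun; apply: smooth1_continuous.
  by apply: smooth1_upd => [k|]; [exact: smooth1_rho|apply: smooth1_derive1; exact: smooth1_rho].
apply: (measurableT_comp mr); apply: measurable_funB.
  by apply: (measurableT_comp (measurable_coord j)).
by apply: (measurableT_comp (measurable_coord j)).
Qed.

Lemma dmolD1 (e : R) i x y : dmol e i x y = (rho e)^`()%classic (x ord0 i - y ord0 i) *
  \prod_(j < n | j != i) rho e (x ord0 j - y ord0 j).
Proof.
rewrite /dmol (bigD1 i)//= upd_eq; congr (_ * _).
by apply: eq_bigr => j /negPf ji; rewrite /upd ji.
Qed.

Lemma molD1 (e : R) i (x y : 'rV[R]_n) : mol e x y = rho e (x ord0 i - y ord0 i) *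
  \prod_(j < n | j != i) rho e (x ord0 j - y ord0 j).
Proof. by rewrite /mol (bigD1 i). Qed.

Lemma measurable_dmol_swap e i :
  measurable_fun setT (fun z : 'rV[R]_n * 'rV[R]_n => dmol e i z.2 z.1).
Proof.
apply: measurable_prod => j _.
have mr : measurable_fun setT (upd (fun=> rho e) i ((rho e)^`()%classic) j).
  apply: continuous_measurable_fun; apply: smooth1_continuous.
  by apply: smooth1_upd => [k|]; [exact: smooth1_rho|apply: smooth1_derive1; exact: smooth1_rho].
apply: (measurableT_comp mr); apply: measurable_funB.
  by apply: (measurableT_comp (measurable_coord j)).
by apply: (measurableT_comp (measurable_coord j)).
Qed.

Lemma measurable_dmol2 e i x : measurable_fun setT (dmol e i x).
Proof. exact: (measurableT_comp (measurable_dmol e i) (measurable_pair1 x)). Qed.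

Lemma measurable_dmol1 e i y : measurable_fun setT (dmol e i ^~ y).
Proof. exact: (measurableT_comp (measurable_dmol e i) (measurable_pair2 y)). Qed.

Lemma mol_tensor e (x : 'rV[R]_n) : mol e x = tensor (fun j t => rho e (x ord0 j - t)).
Proof. by []. Qed.

Lemma partial_mol2 e i (x : 'rV[R]_n) :
  partial i (mol e x) = (fun y => - dmol e i x y).
Proof.
rewrite mol_tensor partial_tensor; last exact: smooth1_rho_refl.
by apply/funext => y; rewrite tensor_upd rho_refl_derive mulNr dmolD1.
Qed.

Lemma supp_in_mol2 e (x : 'rV[R]_n) lo hi : 0 < e ->
  (forall j, lo j <= x ord0 j - e) -> (forall j, x ord0 j <= hi j) ->
  supp_in (fun j t => rho e (x ord0 j - t)) lo hi.
Proof.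
move=> e0 xlo xhi j t tj; apply: rho_eq0 => //.
by case: tj => tj; [right; have := xlo j|left; have := xhi j]; lra.
Qed.

Lemma tensorM H1 H2 x : tensor (fun j t => H1 j t * H2 j t) x = tensor H1 x * tensor H2 x :> R.
Proof. by rewrite /tensor big_split. Qed.

Lemma partial_cutoff_mol c h e i (x y : 'rV[R]_n) :
  partial i (tensor (fun j s => cutoff c h j s * rho e (s - y ord0 j))) x =
  partial i (tensor (cutoff c h)) x * mol e x y + tensor (cutoff c h) x * dmol e i x y.
Proof.
have s1 j := smooth1_cutoff c h j.
have s2 j := @smooth1_rho_shift R e (y ord0 j).
rewrite !partial_tensor//; last exact: smooth1M.
have DE : (fun s => cutoff c h i s * rho e (s - y ord0 i))^`()%classic =
    (fun s => cutoff c h i s * (rho e)^`()%classic (s - y ord0 i) +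
      rho e (s - y ord0 i) * (cutoff c h i)^`()%classic s).
  apply: derive1_is_derive => s.
  have d1 := smooth1_is_derive s (s1 i); have d2 := smooth1_is_derive s (s2 i).
  by rewrite -rho_shift_derive; exact: is_deriveM d1 d2.
rewrite !tensor_upd /= DE.
by rewrite big_split/= (tensorD1 _ i) (molD1 _ i) dmolD1; ring.
Qed.

Lemma moll_pairing u f G F (c : 'I_n -> R) (h e : R) : 0 < e -> e <= h ->
  rintegrable mu u -> rintegrable mu f ->
  (forall i, rintegrable mu (G i)) -> (forall i, rintegrable mu (F i)) ->
  weak_grad_on (fun j => c j - 4 * h) (fun j => c j + 4 * h) u G ->
  weak_div_on (fun j => c j - 4 * h) (fun j => c j + 4 * h) F f ->
  \sum_(i < n) \int[mu]_x (F i x * tensor (cutoff c h) x * moll e (G i) x) =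
  - (\int[mu]_x (f x * tensor (cutoff c h) x * moll e u x)) -
  \sum_(i < n) \int[mu]_x (F i x * partial i (tensor (cutoff c h)) x * moll e u x).
Proof.
move=> e0 eh ui fi Gi Fi uG Ff.
have h0 : 0 < h by exact: lt_le_trans eh.
set lo := (fun j => c j - 4 * h) in uG Ff *.
set hi := (fun j => c j + 4 * h) in uG Ff *.
pose eta := tensor (cutoff c h).
have cs : supp_in (cutoff c h) lo hi.
  by move=> j t tj; apply: cutoff_eq0 => //; move: tj; rewrite /lo /hi; case=> tj; [left|right]; lra.
have sc := smooth1_cutoff c h.
have pE i : partial i eta = tensor (upd (cutoff c h) i ((cutoff c h i)^`()%classic)) by exact: partial_tensor.
have sp i j : smooth1 (upd (cutoff c h) i ((cutoff c h i)^`()%classic) j).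
  by apply: smooth1_upd => //; exact: smooth1_derive1.
have ps i : supp_in (upd (cutoff c h) i ((cutoff c h i)^`()%classic)) lo hi.
  by apply: supp_in_upd => //; apply: derive1_supp; exact: cs.
have ife : rintegrable mu (fun x => f x * eta x) by exact: rintegrable_mul_tensor cs.
have iFe i : rintegrable mu (fun x => F i x * eta x) by exact: rintegrable_mul_tensor cs.
have iFp i : rintegrable mu (fun x => F i x * partial i eta x).
  by rewrite pE; exact: rintegrable_mul_tensor (ps i).
have [Cm HCm] := @mol_bounded R n e e0.
(* Where [eta x != 0] the kernel [mol e x] is itself a test function in the box, so the definition
   of the weak gradient replaces [moll e (G i) x] by the integral of [u y * dmol e i x y]. *)
have T2 i : \int[mu]_x (F i x * eta x * moll e (G i) x) =
    \int[mu]_y (u y * \int[mu]_x (F i x * eta x * dmol e i x y)).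
  have [C HC] := dmol_bounded i e0.
  have [_ <-] := Rfubini (iFe i) ui (measurable_dmol e i) (fun z => HC z.1 z.2).
  apply: eq_Rintegral => x _; have [x0|x0] := eqVneq (eta x) 0; first by rewrite x0 mulr0 !mul0r.
  congr (_ * _).
  have xj j := cutoff_neq0 j h0 x0.
  have mols : supp_in (fun j t => rho e (x ord0 j - t)) lo hi.
    by apply: supp_in_mol2 => // j; have := xj j; rewrite ler_distl /lo /hi => /andP[]; lra.
  have := uG _ (fun j => @smooth1_rho_refl R e (x ord0 j)) mols i.
  rewrite -mol_tensor partial_mol2 => H.
  have iud : rintegrable mu (fun y => u y * dmol e i x y).
    exact: (integrableM_bounded ui (measurable_dmol2 _ _ _) (HC x)).
  apply: oppr_inj; rewrite -H -mulN1r -RintegralZl//.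
  by apply: eq_Rintegral => y _; rewrite mulrN mulN1r.
have T1 i : \int[mu]_x (F i x * partial i eta x * moll e u x) =
    \int[mu]_y (u y * \int[mu]_x (F i x * partial i eta x * mol e x y)).
  by have [_] := moll_fubini e0 (iFp i) ui.
have T3 : \int[mu]_x (f x * eta x * moll e u x) =
    \int[mu]_y (u y * \int[mu]_x (f x * eta x * mol e x y)).
  by have [_] := moll_fubini e0 ife ui.
have I1 i : rintegrable mu (fun y => u y * \int[mu]_x (F i x * partial i eta x * mol e x y)).
  exact: (proj1 (Rfubini ui (iFp i) (measurable_mol_swap e) (fun z => HCm z.2 z.1))).
have I2 i : rintegrable mu (fun y => u y * \int[mu]_x (F i x * eta x * dmol e i x y)).
  have [C HC] := dmol_bounded i e0.
  exact: (proj1 (Rfubini ui (iFe i) (measurable_dmol_swap e i) (fun z => HC z.2 z.1))).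
(* The equation tested, for one [y], with [eta] times the kernel in [x]: a product of one-variable
   functions. Multiplying by [u y] and integrating gives the claim. *)
have key y : \sum_(i < n) (\int[mu]_x (F i x * partial i eta x * mol e x y) +
      \int[mu]_x (F i x * eta x * dmol e i x y)) =
    - \int[mu]_x (f x * eta x * mol e x y).
  have sH j : smooth1 (fun s => cutoff c h j s * rho e (s - y ord0 j)).
    exact: smooth1M (sc j) (smooth1_rho_shift e (y ord0 j)).
  have Hs : supp_in (fun j s => cutoff c h j s * rho e (s - y ord0 j)) lo hi.
    by move=> j t tj; rewrite cs ?mul0r.
  have := Ff _ sH Hs.
  under [in RHS]eq_Rintegral do rewrite tensorM mulrA.
  rewrite -/eta => <-; rewrite opprK.
  have J1 i : rintegrable mu (fun x => F i x * partial i eta x * mol e x y).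
    exact: (integrableM_bounded (iFp i) (measurable_mol1 _ _) (HCm ^~ y)).
  have J2 i : rintegrable mu (fun x => F i x * eta x * dmol e i x y).
    have [C HC] := dmol_bounded i e0.
    exact: (integrableM_bounded (iFe i) (measurable_dmol1 _ _ _) (HC ^~ y)).
  under eq_bigr => i _ do rewrite -(RintegralD measurableT (J1 i) (J2 i)).
  rewrite -Rint_sum; last by move=> i; exact: rintegrableD.
  apply: eq_Rintegral => x _; apply: eq_bigr => i _.
  by rewrite partial_cutoff_mol mulrDr !mulrA.
have combine (SG SU SF TT TA TB : R) :
    SG = TB -> SF = TT -> SU = TA -> TB = - TT - TA -> SG = - SF - SU.
  by move=> -> -> ->.
apply: combine; [exact: (eq_bigr _ (fun i _ => T2 i))|exact: T3|
  exact: (eq_bigr _ (fun i _ => T1 i))|].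
have iT : rintegrable mu (fun y => u y * \int[mu]_x (f x * eta x * mol e x y)).
  exact: (proj1 (Rfubini ui ife (measurable_mol_swap e) (fun z => HCm z.2 z.1))).
apply/eqP; rewrite eq_sym subr_eq; apply/eqP.
rewrite -mulN1r -(RintegralZl (-1) measurableT iT) addrC -big_split/=.
transitivity (\sum_(i < n) \int[mu]_y (u y * \int[mu]_x (F i x * partial i eta x * mol e x y) +
    u y * \int[mu]_x (F i x * eta x * dmol e i x y))).
  rewrite -Rint_sum; last by move=> i; exact: (rintegrableD (I1 i) (I2 i)).
  apply: eq_Rintegral => y _; rewrite mulN1r -mulrN -key mulr_sumr.
  by apply: eq_bigr => i _; rewrite mulrDr.
by apply: eq_bigr => i _; rewrite (RintegralD measurableT (I1 i) (I2 i)).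
Qed.

End pairing.

(** * The flux *)
Section flux.
Context {R : realType} {n : nat}.
Local Notation mu := (@lebesgue_rV R n).
Implicit Types (xi : 'rV[R]_n) (p : R).

Lemma enorm_ge0 xi : 0 <= enorm xi.
Proof. exact: sqrtr_ge0. Qed.

Lemma enorm_sqr xi : enorm xi ^+ 2 = \sum_(i < n) xi ord0 i ^+ 2.
Proof. by rewrite /enorm sqr_sqrtr// sumr_ge0// => i _; exact: sqr_ge0. Qed.

Lemma coord_le_enorm xi i : `|xi ord0 i| <= enorm xi.
Proof.
rewrite -sqrtr_sqr; apply: ler_wsqrtr.
by rewrite (bigD1 i)//= lerDl sumr_ge0// => j _; exact: sqr_ge0.
Qed.

Lemma enorm_le_sum xi : enorm xi <= \sum_(i < n) `|xi ord0 i|.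
Proof.
have S0 : 0 <= \sum_(i < n) `|xi ord0 i| by exact: sumr_ge0.
rewrite -(ler_pXn2r (n := 2))// ?nnegrE ?enorm_ge0// enorm_sqr expr2 mulr_suml.
apply: ler_sum => i _; rewrite -real_normK ?num_real// expr2 ler_wpM2l//.
by rewrite (bigD1 i)//= lerDl sumr_ge0.
Qed.

Lemma powR_succ (x a : R) : 0 < x -> x `^ a * x = x `^ (a + 1).
Proof. by move=> x0; rewrite powRD ?powRr1 ?(ltW x0)// (gt_eqF x0)/= implybT. Qed.

Lemma p_fluxE p xi i : p_flux p xi ord0 i = enorm xi `^ (p - 2) * xi ord0 i.
Proof. by rewrite /p_flux mxE. Qed.

Lemma enorm_eq0 xi i : enorm xi = 0 -> xi ord0 i = 0.
Proof.
by move=> w0; apply/eqP; rewrite -normr_le0; have := coord_le_enorm xi i; rewrite w0.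
Qed.

Lemma p_flux_le p xi i : 1 < p -> `|p_flux p xi ord0 i| <= enorm xi `^ (p - 1).
Proof.
move=> p1; rewrite p_fluxE normrM ger0_norm ?powR_ge0//.
have := enorm_ge0 xi; rewrite le_eqVlt => /orP[/eqP w0|w0].
  by rewrite (enorm_eq0 _ (esym w0)) normr0 mulr0 powR_ge0.
rewrite (_ : p - 1 = p - 2 + 1); last by ring.
by rewrite -powR_succ// ler_wpM2l ?powR_ge0// coord_le_enorm.
Qed.

Lemma p_flux_dot p xi : 1 < p ->
  \sum_(i < n) p_flux p xi ord0 i * xi ord0 i = enorm xi `^ p.
Proof.
move=> p1; under eq_bigr do rewrite p_fluxE -mulrA -expr2.
rewrite -mulr_sumr -enorm_sqr.
have := enorm_ge0 xi; rewrite le_eqVlt => /orP[/eqP w0|w0].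
  by rewrite -w0 expr0n/= mulr0 powR0// gt_eqF//; lra.
by rewrite expr2 mulrA !powR_succ//; congr (_ `^ _); ring.
Qed.

(** If [t <= w], one power of [w] absorbs [t]. If [t > w], then [w >= 1] allows the exponent
    [p - 2], possibly negative, to be raised to [q - 1 >= 0], where [q = max(1, p - 1)], after which
    [w] may be replaced by [t]. *)
Lemma powR_split p (k w t : R) : 1 < p -> 1 <= k -> k < w -> 0 <= t ->
  w `^ (p - 2) * t <=
  w `^ (p - 1) + (if k < t then t `^ (Num.max 1 (p - 1)) else 0).
Proof.
move=> p1 k1 kw t0; set q := Num.max 1 (p - 1).
have w0 : 0 < w by lra.
have [tw|wt] := leP t w.
  rewrite -[leLHS]addr0 lerD//; last by case: ifP => // _; exact: powR_ge0.
  rewrite (_ : p - 1 = p - 2 + 1); last by ring.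
  by rewrite -powR_succ// ler_wpM2l// powR_ge0.
rewrite (lt_trans kw wt) -[leLHS]add0r lerD ?powR_ge0//.
have q1 : 1 <= q by rewrite le_max lexx.
have qp : p - 1 <= q by rewrite le_max lexx orbT.
have t1 : 0 < t by lra.
rewrite (_ : q = q - 1 + 1); last by ring.
rewrite -powR_succ// ler_wpM2r//.
apply: (@le_trans _ _ (w `^ (q - 1))); first by apply: ler_powR; lra.
by apply: ge0_ler_powR; rewrite ?nnegrE; lra.
Qed.

Lemma p_flux_negative_part p xi i (sigma L : R) : 1 < p -> (sigma = 1 \/ sigma = -1) ->
  L <= sigma * xi ord0 i -> 
  - (sigma * p_flux p xi ord0 i) <= `|L| * enorm xi `^ (p - 2).
Proof.
move=> p1 s1 Ls; rewrite p_fluxE mulrCA -mulrN mulrC ler_wpM2r ?powR_ge0//.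
by have := ler_norm (- L); rewrite normrN; lra.
Qed.

Lemma measurable_enorm_comp (D : 'rV[R]_n -> 'rV[R]_n) :
  (forall i, measurable_fun setT (fun x => D x ord0 i)) ->
  measurable_fun setT (fun x => enorm (D x)).
Proof.
move=> mD.
have mS : measurable_fun setT (fun x => \sum_(i < n) D x ord0 i ^+ 2).
  apply: measurable_sum => i; under eq_fun do rewrite expr2.
  by apply: measurable_funM; exact: mD.
exact: (measurableT_comp (continuous_measurable_fun (@sqrt_continuous R)) mS).
Qed.

Lemma measurable_enorm_powR_comp (a : R) (D : 'rV[R]_n -> 'rV[R]_n) :
  (forall i, measurable_fun setT (fun x => D x ord0 i)) ->
  measurable_fun setT (fun x => enorm (D x) `^ a).
Proof.
by move=> mD; apply: (measurableT_comp (measurable_powR a)); exact: measurable_enorm_comp.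
Qed.

Lemma measurable_flux_comp (p : R) (D : 'rV[R]_n -> 'rV[R]_n) i :
  (forall i, measurable_fun setT (fun x => D x ord0 i)) ->
  measurable_fun setT (fun x => p_flux p (D x) ord0 i).
Proof.
move=> mD; under eq_fun do rewrite p_fluxE.
by apply: measurable_funM => //; exact: measurable_enorm_powR_comp.
Qed.

End flux.

(** * The energy estimate on a box *)
Section local.
Context {R : realType} {n : nat}.
Local Notation mu := (@lebesgue_rV R n).
Variables (p h Cb C1 : R) (u f : 'rV[R]_n -> R) (D : 'rV[R]_n -> 'rV[R]_n).
Variables (sigma L c : 'I_n -> R).

Let lo (j : 'I_n) := c j - 4 * h.
Let hi (j : 'I_n) := c j + 4 * h.
Let w x := enorm (D x).
Let q := Num.max 1 (p - 1).
Let G (i : 'I_n) x := D x ord0 i.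
Let F (i : 'I_n) x := p_flux p (D x) ord0 i.
Let eta := tensor (cutoff c h).
Let W := \int[mu]_x (w x `^ (p - 1)).
Let SL := \sum_(i < n) `|L i|.
Let M := (h^-1 * Cb) ^+ n * \int[mu]_y `|u y| + 5 * h * SL.

Hypothesis p1 : 1 < p.
Hypothesis h0 : 0 < h.
Hypothesis ui : rintegrable mu u.
Hypothesis fi : rintegrable mu f.
Hypothesis Gi : forall i, rintegrable mu (G i).
Hypothesis wi : rintegrable mu (fun x => w x `^ (p - 1)).
Hypothesis Gqi : forall i, rintegrable mu (fun x => `|G i x| `^ q).
Hypothesis uG : weak_grad_on lo hi u G.
Hypothesis Ff : weak_div_on lo hi F f.
Hypothesis sigma1 : forall i, sigma i = 1 \/ sigma i = -1.
Hypothesis LG : forall i y, cbox lo hi y -> L i <= sigma i * G i y.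
Hypothesis HCb : forall t : R, bump t <= Cb.
Hypothesis HC1 : forall t : R, `|bell^`()%classic t| <= C1.

Let Cb0 : 0 <= Cb. Proof. exact: le_trans (bump_ge0 0) (HCb 0). Qed.
Let C10 : 0 <= C1. Proof. by apply: le_trans (HC1 0). Qed.
Let SL0 : 0 <= SL. Proof. exact: sumr_ge0. Qed.
Let W0 : 0 <= W. Proof. by apply: Rintegral_ge0 => x _; exact: powR_ge0. Qed.

Let M0 : 0 <= M.
Proof.
rewrite addr_ge0// mulr_ge0//.
- by rewrite exprn_ge0// mulr_ge0// invr_ge0 ltW.
- exact: Rintegral_ge0.
- by rewrite mulr_ge0// ltW.
Qed.

Let mG i : measurable_fun setT (fun x => D x ord0 i).
Proof. exact: rintegrable_measurable (Gi i). Qed.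

Lemma rintegrable_flux i : rintegrable mu (F i).
Proof.
by apply: rintegrable_le wi _ _ => [|x]; [exact: measurable_flux_comp|exact: p_flux_le].
Qed.

Lemma eta_ge0 x : 0 <= eta x.
Proof. by apply: prodr_ge0 => j _; exact: bell_ge0. Qed.

Lemma eta_le1 x : eta x <= 1.
Proof.
by apply: prodr_ile1 => j _; rewrite bell_ge0 bell_le1.
Qed.

Lemma measurable_eta : measurable_fun setT eta.
Proof. by apply: measurable_smooth_tensor => j; exact: smooth1_cutoff. Qed.

Lemma eta_neq0 x j : eta x != 0 -> c j - h <= x ord0 j <= c j + h.
Proof. by move=> x0; have := cutoff_neq0 j h0 x0; rewrite ler_distl. Qed.

Lemma rintegrable_eta : rintegrable mu eta.
Proof.
apply: rintegrable_le (rintegrable_ocbox lo hi) measurable_eta _ => x.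
rewrite ger0_norm ?eta_ge0// indicE; case: (boolP (x \in _)) => [_|]; first exact: eta_le1.
apply: contraNT; rewrite -ltNge => /lt0r_neq0 x0; rewrite inE => j.
by have /andP[] := eta_neq0 j x0; rewrite /lo /hi => ? ?; apply/andP; split; move: h0; lra.
Qed.

Lemma moll_u_le (e : R) (x : 'rV[R]_n) : 0 < e -> e <= h ->
  (forall j, c j - h <= x ord0 j <= c j + h) -> `|moll e u x| <= M.
Proof.
move=> e0 eh xc.
have xj j : `|x ord0 j - c j| <= h by rewrite ler_distl.
have := moll_sup_bound e0 eh ui Gi uG sigma1 (or_introl erefl) LG HCb xj.
have := moll_sup_bound e0 eh ui Gi uG sigma1 (or_intror erefl) LG HCb xj.
rewrite mul1r mulN1r => H1 H2; rewrite ler_norml H2 andbT.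
by rewrite lerNl.
Qed.

Lemma partial_eta_le i x : `|partial i eta x| <= C1 / h.
Proof.
rewrite partial_tensor; last exact: smooth1_cutoff.
rewrite tensor_upd normrM -[leRHS]mulr1 ler_pM//.
  rewrite derive1_shift_scale; last exact: smooth1_bell.
  by rewrite normrM ger0_norm ?invr_ge0 ?(ltW h0)// mulrC ler_wpM2r// invr_ge0 ltW.
rewrite normr_prod; apply: prodr_ile1 => j _.
by rewrite normr_ge0 ger0_norm; [exact: bell_le1|exact: bell_ge0].
Qed.

Lemma partial_eta_neq0 i x j : partial i eta x != 0 -> c j - h <= x ord0 j <= c j + h.
Proof.
rewrite partial_tensor; last exact: smooth1_cutoff.
move=> x0; apply: contraNT x0; rewrite negb_and -!ltNge => /orP xj; apply/eqP.
rewrite (@tensor_eq0 _ _ _ (fun j => c j - h) (fun j => c j + h))//.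
  apply: supp_in_upd; first by move=> k t; exact: cutoff_eq0.
  by apply: derive1_supp => t; exact: cutoff_eq0.
by move=> /(_ j) /andP[h1 h2]; case: xj; rewrite ltNge ?h1 ?h2.
Qed.

(** The right side of [moll_pairing] contains [moll e u] only where [eta] or a derivative of it is
    nonzero, hence at points where the sup bound [M] holds; no trace of [e] is left. *)
Lemma pairing_le e : 0 < e -> e <= h ->
  \sum_(i < n) \int[mu]_x (F i x * eta x * moll e (G i) x) <=
  M * (\int[mu]_x `|f x| + n%:R * (C1 / h) * W).
Proof.
move=> e0 eh; rewrite (moll_pairing e0 eh ui fi Gi rintegrable_flux uG Ff).
rewrite mulrDr lerD//.
  apply: le_trans (ler_norm _) _; rewrite normrN.
  rewrite -RintegralZl//; last exact: rintegrable_norm.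
  have ife : rintegrable mu (fun x => f x * eta x).
    apply: (integrableM_bounded fi measurable_eta (C := 1)) => x.
    by rewrite ger0_norm ?eta_ge0 ?eta_le1.
  apply: Rint_norm_le; first exact: rintegrable_mul_moll.
    by apply: rintegrableZ; exact: rintegrable_norm.
  move=> x; have [x0|x0] := eqVneq (eta x) 0.
    by rewrite -/eta x0 mulr0 mul0r normr0 mulr_ge0.
  rewrite !normrM mulrC ler_pM ?mulr_ge0//.
    by apply: moll_u_le => // j; exact: eta_neq0.
  by rewrite ler_piMr// ger0_norm ?eta_ge0 ?eta_le1.
rewrite -sumrN (_ : M * _ = \sum_(i < n) M * (C1 / h * W)); last first.
  by rewrite sumr_const card_ord -mulr_natl; ring.
apply: ler_sum => i _; apply: le_trans (ler_norm _) _; rewrite normrN mulrA.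
rewrite -RintegralZl//.
have iFp : rintegrable mu (fun x => F i x * partial i eta x).
  apply: (integrableM_bounded (rintegrable_flux i) _ (C := C1 / h)) (partial_eta_le i).
  rewrite partial_tensor; last exact: smooth1_cutoff.
  apply: measurable_smooth_tensor; apply: smooth1_upd => [j|]; first exact: smooth1_cutoff.
  by apply: smooth1_derive1; exact: smooth1_cutoff.
apply: Rint_norm_le; first exact: rintegrable_mul_moll.
  exact: rintegrableZ.
move=> x; have [x0|x0] := eqVneq (partial i eta x) 0.
  by rewrite -/eta x0 mulr0 mul0r normr0 !mulr_ge0 ?powR_ge0 ?invr_ge0// ltW.
rewrite !normrM [leRHS](_ : _ = w x `^ (p - 1) * (C1 / h) * M); last by ring.
apply: ler_pM; rewrite ?mulr_ge0//; last first.
  by apply: moll_u_le => // j; exact: partial_eta_neq0 x0.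
by apply: ler_pM => //; [exact: p_flux_le|exact: partial_eta_le].
Qed.

Let K := ocbox lo hi.
(* [g] is the nonnegative excess of [sigma_i d_i u] over its lower bound, and
   [gq] dominates [w ^ (p - 2) * g] where [g] is large; [a] truncates the flux
   to [w <= k], which makes it a bounded multiplier of the mollified excess. *)
Let g i y : R := \1_K y * (sigma i * G i y - L i).
Let gq (k : R) i y : R := if k < g i y then g i y `^ q else 0.
Let T (k : R) x : R := (w x <= k)%R%:R.
Let a (k : R) i x : R := eta x * (T k x * (sigma i * F i x)).

Lemma ocbox_sub_cbox y : K y -> cbox lo hi y.
Proof. by move=> Ky j; have /andP[/ltW -> ->] := Ky j. Qed.

Lemma excess_ge0 i y : 0 <= g i y.
Proof.
rewrite /g indicE; case: (boolP (y \in K)) => [/set_mem Ky|_]; last by rewrite mul0r.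
by rewrite mul1r subr_ge0 LG//; exact: ocbox_sub_cbox.
Qed.

Lemma excess_tail_ge0 k i y : 0 <= gq k i y.
Proof. by rewrite /gq; case: ifP => // _; exact: powR_ge0. Qed.

Lemma rintegrable_excess i : rintegrable mu (g i).
Proof.
rewrite (_ : g i = fun y => sigma i * (G i y * \1_K y) - L i * \1_K y); last first.
  by apply/funext => y; rewrite /g; ring.
apply: rintegrableB; apply: rintegrableZ; last exact: rintegrable_ocbox.
apply: (integrableM_bounded (Gi i) _ (C := 1)).
  by apply: measurable_indic; exact: measurable_ocbox.
by move=> y; rewrite indicE; case: (_ \in _); rewrite ?normr0 ?normr1.
Qed.

(** A majorant free of [k], for dominated convergence in [cvg_remainder]. The factor [2 ^ q] comes
    from bounding a difference by twice the larger absolute value. *)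
Lemma excess_tail_le k i y : 0 <= k ->
  `|gq k i y| <= 2 `^ q * (`|G i y| `^ q + `|L i| `^ q * \1_K y).
Proof.
move=> k0; rewrite ger0_norm ?excess_tail_ge0// /gq.
have q0 : 0 <= q by rewrite le_max ler01.
case: ifPn => [kg|_]; last first.
  by rewrite mulr_ge0 ?powR_ge0// addr_ge0 ?mulr_ge0 ?powR_ge0// indicE.
move: kg; rewrite /g indicE; case: (y \in K); last by rewrite mul0r ltNge k0.
rewrite mul1r mulr1 => kg; have g0 := le_lt_trans k0 kg.
pose m := Num.max `|G i y| `|L i|.
have m0 : 0 <= m by rewrite le_max normr_ge0.
apply: (@le_trans _ _ ((2 * m) `^ q)).
  apply: ge0_ler_powR => //; rewrite ?nnegrE ?mulr_ge0// ?(ltW g0)//.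
  have Gm : `|G i y| <= m by rewrite le_max lexx.
  have Lm : `|L i| <= m by rewrite le_max lexx orbT.
  apply: le_trans (ler_norm _) _; apply: (le_trans (ler_normB _ _)).
  have -> : `|sigma i * G i y| = `|G i y|.
    by case: (sigma1 i) => ->; rewrite ?mul1r// mulN1r normrN.
  by rewrite (_ : 2 * m = m + m) ?lerD//; ring.
rewrite powRM// ler_wpM2l ?powR_ge0// /m.
by rewrite maxEle; case: ifP => _; [rewrite lerDr|rewrite lerDl]; exact: powR_ge0.
Qed.

Lemma rintegrable_excess_tail k i : 0 <= k -> rintegrable mu (gq k i).
Proof.
move=> k0.
have mg := rintegrable_measurable (rintegrable_excess i).
have iB : rintegrable mu (fun y => 2 `^ q * (`|G i y| `^ q + `|L i| `^ q * \1_K y)).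
  apply: rintegrableZ; apply: rintegrableD => //.
  by apply: rintegrableZ; exact: rintegrable_ocbox.
apply: rintegrable_le iB _ (fun y => excess_tail_le _ _ k0).
apply: measurable_fun_ifT => //.
  by apply: measurable_fun_ltr => //; exact: measurable_cst.
by apply: (measurableT_comp (measurable_powR q)).
Qed.

(** From a point of the support of [eta] the kernel reaches only into [K], so the indicator in [g]
    is not felt and the constant [L i] is reproduced by unit mass. *)
Lemma moll_excess e i x : 0 < e -> e <= h -> eta x != 0 ->
  moll e (g i) x = sigma i * moll e (G i) x - L i.
Proof.
move=> e0 eh x0; rewrite /moll.
have iG : rintegrable mu (fun y => G i y * mol e x y) by exact: rintegrable_mul_mol.
have im := @rintegrable_mol2 R n e x e0.
transitivity (\int[mu]_y (sigma i * (G i y * mol e x y) - L i * mol e x y)).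
  apply: eq_Rintegral => y _.
  have [H|H] := pselect (forall j, y ord0 j < x ord0 j /\ x ord0 j < y ord0 j + e).
    rewrite /g indicE mem_set; first by rewrite mul1r; ring.
    move=> j; have [yx xy] := H j; have /andP[x1 x2] := eta_neq0 j x0.
    by rewrite /lo /hi; apply/andP; split; move: h0; lra.
  by rewrite (mol_eq0 e0 H) !mulr0 subrr.
rewrite RintegralB//; try exact: rintegrableZ.
rewrite (RintegralZl _ measurableT iG) (RintegralZl _ measurableT im).
by rewrite [X in _ - _ * X]/Rintegral integral_mol2// mulr1.
Qed.

Lemma sublevel01 k x : 0 <= T k x <= 1.
Proof. by rewrite /T; case: (w x <= k); rewrite ?lexx ?ler01. Qed.

Lemma measurable_sublevel k : measurable_fun setT (T k).
Proof.
rewrite (_ : T k = fun x => if w x <= k then 1 else 0); last first.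
  by apply/funext => x; rewrite /T; case: ifP.
apply: measurable_fun_ifT; try exact: measurable_cst.
by apply: measurable_fun_ler => //; exact: measurable_enorm_comp.
Qed.

Lemma trunc_flux_le k i x : `|a k i x| <= `|F i x|.
Proof.
have s1 : `|sigma i| = 1 by case: (sigma1 i) => ->; rewrite ?normrN normr1.
have /andP[t0 t1] := sublevel01 k x.
rewrite !normrM s1 mul1r (ger0_norm (eta_ge0 x)) (ger0_norm t0) mulrA ler_piMl//.
by rewrite -[leRHS]mulr1 ler_pM ?eta_ge0 ?eta_le1.
Qed.

Lemma rintegrable_trunc_flux k i : rintegrable mu (a k i).
Proof.
apply: rintegrable_le (rintegrable_norm (rintegrable_flux i)) _ (trunc_flux_le k i).
apply: measurable_funM; first exact: measurable_eta.
apply: measurable_funM; first exact: measurable_sublevel.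
by apply: measurable_funM; [exact: measurable_cst|exact: rintegrable_measurable (rintegrable_flux i)].
Qed.

Lemma trunc_flux_bounded k i x : 0 <= k -> `|a k i x| <= k `^ (p - 1).
Proof.
move=> k0; have [wk|kw] := leP (w x) k.
  apply: (le_trans (trunc_flux_le _ _ _)); apply: (le_trans (p_flux_le _ _ p1)).
  by apply: ge0_ler_powR; rewrite ?nnegrE ?enorm_ge0//; move: p1; lra.
by rewrite /a /T (lt_geF kw) mul0r mulr0 normr0 powR_ge0.
Qed.

(** Where [w x <= k] the two pairings differ by [L i] times the flux, at most [|L i| * w^(p-1)].
    Where [w x > k] the left side is zero and the untruncated pairing must be bounded from below:
    its negative part is at most [|L i| * w^(p-2)] times the mollified excess, up to the same
    error. *)
Lemma truncated_moll_le k e i x : 0 < e -> e <= h -> 1 <= k ->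
  a k i x * moll e (g i) x <=
  F i x * eta x * moll e (G i) x + `|L i| * w x `^ (p - 1) +
  `|L i| * ((1 - T k x) * w x `^ (p - 1) + eta x * moll e (gq k i) x).
Proof.
move=> e0 eh k1; have k0 : 0 <= k by apply: le_trans k1.
set X := w x `^ (p - 1); have X0 : 0 <= X by exact: powR_ge0.
set Q := moll e (gq k i) x; have Q0 : 0 <= Q by apply: moll_ge0 => // y; exact: excess_tail_ge0.
have e_0 := eta_ge0 x; have e_1 := eta_le1 x.
have /andP[t0 t1] := sublevel01 k x; have l0 := normr_ge0 (L i).
have [x0|x0] := eqVneq (eta x) 0.
  rewrite /a x0 !mul0r mulr0 mul0r !add0r addr0 addr_ge0 ?mulr_ge0//.
  by rewrite subr_ge0.
have mg := moll_excess i e0 eh x0.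
set m := moll e (g i) x in mg *; have m0 : 0 <= m by apply: moll_ge0 => // y; exact: excess_ge0.
have -> : moll e (G i) x = sigma i * (m + L i).
  by rewrite mg subrK mulrA; case: (sigma1 i) => ->; rewrite ?mulr1 ?mulrNN ?mul1r.
have FX : `|F i x| <= X by exact: p_flux_le.
have sFX : `|sigma i * F i x| <= X.
  by rewrite normrM; case: (sigma1 i) => ->; rewrite ?normrN normr1 mul1r.
set S := sigma i * F i x in sFX *.
have SE : S = sigma i * F i x by [].
have aE : a k i x = eta x * (T k x * S) by [].
clearbody S.
have -> : F i x * eta x * (sigma i * (m + L i)) = eta x * S * m + eta x * S * L i.
  by rewrite SE; ring.
have SL' : - (`|L i| * X) <= eta x * S * L i.
  rewrite lerNl; apply: le_trans (ler_norm _) _.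
  rewrite normrN !normrM mulrC ler_wpM2l// (ger0_norm e_0).
  by rewrite -[leRHS]mul1r ler_pM.
rewrite aE /T; have [wk|kw] := leP (w x) k.
  rewrite mul1r subrr mul0r add0r.
  have : 0 <= `|L i| * (eta x * Q) by rewrite !mulr_ge0.
  by move: SL'; lra.
rewrite mul0r mulr0 mul0r subr0 mul1r.
have S1 : - S <= `|L i| * w x `^ (p - 2).
  rewrite SE; apply: p_flux_negative_part => //; apply: LG => j.
  have /andP[x1 x2] := eta_neq0 j x0; rewrite /lo /hi.
  by apply/andP; split; move: h0; lra.
(* [powR_split] is applied under the integral in [y], with [w] frozen at [x]; the term [X] survives
   unchanged since the kernel has unit mass. *)
have wm : w x `^ (p - 2) * m <= X + Q.
  have im := @rintegrable_mol2 R n e x e0.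
  have ig := rintegrable_mul_mol x e0 (rintegrable_excess i).
  have igq := rintegrable_mul_mol x e0 (rintegrable_excess_tail i k0).
  have -> : X = \int[mu]_y (X * mol e x y).
    by rewrite (RintegralZl _ measurableT im) [X in _ * X]/Rintegral integral_mol2// mulr1.
  rewrite /m /Q /moll -(RintegralZl _ measurableT ig).
  rewrite -(RintegralD measurableT (rintegrableZ X im) igq).
  apply: le_Rintegral => //; first exact: rintegrableZ.
    by apply: rintegrableD => //; exact: rintegrableZ.
  move=> y _; rewrite mulrA -mulrDl ler_wpM2r ?mol_ge0//.
  exact: powR_split (excess_ge0 i y).
have B : eta x * (- S * m) <= `|L i| * X + `|L i| * (eta x * Q).
  apply: (@le_trans _ _ (eta x * (`|L i| * (X + Q)))).
    rewrite ler_wpM2l//; apply: (@le_trans _ _ (`|L i| * w x `^ (p - 2) * m)).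
      by rewrite ler_wpM2r.
    by rewrite -mulrA ler_wpM2l.
  rewrite !mulrDr lerD//; last by rewrite mulrCA.
  by rewrite ler_piMl// mulr_ge0.
by move: B SL'; rewrite mulrDr mulNr mulrN !mulrA; lra.
Qed.

(** The cost of truncating at level [k]: a tail of the flux and a tail of the excess. It does not
    involve [e], which permits the order of the two limits. *)
Let r (k : R) := \sum_(i < n) `|L i| *
  (\int[mu]_x ((1 - T k x) * w x `^ (p - 1)) + \int[mu]_y gq k i y).

Let E := M * (\int[mu]_x `|f x| + n%:R * (C1 / h) * W) + SL * W.

Lemma rintegrable_tail k : rintegrable mu (fun x => (1 - T k x) * w x `^ (p - 1)).
Proof.
apply: rintegrable_le wi _ _ => [|x].
  apply: measurable_funM; last exact: measurable_enorm_powR_comp.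
  by apply: measurable_funB; [exact: measurable_cst|exact: measurable_sublevel].
have /andP[t0 t1] := sublevel01 k x.
rewrite ger0_norm ?mulr_ge0 ?powR_ge0 ?subr_ge0// ler_piMl ?powR_ge0//.
by rewrite lerBlDr lerDl.
Qed.

Lemma truncated_moll_int_le k e : 0 < e -> e <= h -> 1 <= k ->
  \sum_(i < n) \int[mu]_x (a k i x * moll e (g i) x) <= E + r k.
Proof.
move=> e0 eh k1; have k0 : 0 <= k by apply: le_trans k1.
have iFe i : rintegrable mu (fun x => F i x * eta x).
  apply: (integrableM_bounded (rintegrable_flux i) measurable_eta (C := 1)) => x.
  by rewrite ger0_norm ?eta_ge0 ?eta_le1.
have i1 i : rintegrable mu (fun x => F i x * eta x * moll e (G i) x).
  exact: rintegrable_mul_moll.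
have i2 i : rintegrable mu (fun x => `|L i| * w x `^ (p - 1)) by exact: rintegrableZ.
have i3 i : rintegrable mu (fun x => eta x * moll e (gq k i) x).
  by apply: rintegrable_mul_moll => //; [exact: rintegrable_eta|exact: rintegrable_excess_tail].
have i4 i : rintegrable mu (fun x => (1 - T k x) * w x `^ (p - 1) + eta x * moll e (gq k i) x).
  by apply: rintegrableD => //; exact: rintegrable_tail.
apply: (@le_trans _ _ (\sum_(i < n) (\int[mu]_x (F i x * eta x * moll e (G i) x) +
    `|L i| * W + `|L i| * (\int[mu]_x ((1 - T k x) * w x `^ (p - 1)) +
      \int[mu]_x (eta x * moll e (gq k i) x))))).
  apply: ler_sum => i _.
  have iag : rintegrable mu (fun x => a k i x * moll e (g i) x).
    by apply: rintegrable_mul_moll => //; [exact: rintegrable_trunc_flux|exact: rintegrable_excess].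
  rewrite -(RintegralZl _ measurableT wi) -(RintegralD measurableT (rintegrable_tail k) (i3 i)).
  rewrite -(RintegralZl _ measurableT (i4 i)) -(RintegralD measurableT (i1 i) (i2 i)).
  rewrite -(RintegralD measurableT (rintegrableD (i1 i) (i2 i)) (rintegrableZ _ (i4 i))).
  apply: le_Rintegral => //.
    by apply: rintegrableD; [exact: rintegrableD|exact: rintegrableZ].
  by move=> x _; exact: truncated_moll_le.
rewrite big_split/= lerD//.
  rewrite big_split/= lerD//; first exact: pairing_le.
  by rewrite -mulr_suml.
apply: ler_sum => i _; rewrite ler_wpM2l// lerD2l.
apply: le_trans (ler_norm _) _.
apply: le_trans (moll_L1_bound (A := 1) e0 rintegrable_eta (rintegrable_excess_tail i k0) _) _.
  by move=> x; rewrite ger0_norm ?eta_ge0 ?eta_le1.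
rewrite mul1r; apply: le_Rintegral => //; first exact: rintegrable_norm (rintegrable_excess_tail i k0).
  exact: rintegrable_excess_tail.
by move=> y _; rewrite ger0_norm ?excess_tail_ge0.
Qed.

(** The limit [e -> 0] at fixed [k]; the bound [k ^ (p - 1)] on [a k i] makes it an admissible
    multiplier in [moll_cvg]. *)
Lemma truncated_excess_int_le k : 1 <= k ->
  \sum_(i < n) \int[mu]_x (a k i x * g i x) <= E + r k.
Proof.
move=> k1; have k0 : 0 <= k by apply: le_trans k1.
have H := @cvg_sum_seq R _ (index_enum 'I_n)
  (fun i m => \int[mu]_x (a k i x * moll m.+1%:R^-1 (g i) x))
  (fun i => \int[mu]_x (a k i x * g i x))
  (fun i => moll_cvg_integrable (rintegrable_excess i) (rintegrable_trunc_flux k i)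
    (fun x => trunc_flux_bounded i x k0)).
rewrite -(cvg_lim (@Rhausdorff R) H); apply: limr_le; first exact: cvgP H.
near=> m; apply: truncated_moll_int_le => //.
by apply: ltW; near: m; exact: near_infty_natSinv_lt (PosNum h0).
Unshelve. all: by end_near. Qed.

(** By [p_flux_dot] the energy density is the sum of [F i * G i]. Expressing [G i] through the
    excess leaves [L i] times the flux, which costs a second copy of [SL * W]. *)
Lemma truncated_energy_le k : 1 <= k ->
  rintegrable mu (fun x => eta x * (T k x * w x `^ p)) /\
  \int[mu]_x (eta x * (T k x * w x `^ p)) <= E + SL * W + r k.
Proof.
move=> k1; have k0 : 0 <= k by apply: le_trans k1.
have p0 : 0 <= p by move: p1; lra.
have iT : rintegrable mu (fun x => eta x * (T k x * w x `^ p)).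
  apply: rintegrable_le (rintegrableZ (k `^ p) rintegrable_eta) _ _ => [|x].
    apply: measurable_funM; first exact: measurable_eta.
    by apply: measurable_funM; [exact: measurable_sublevel|exact: measurable_enorm_powR_comp].
  have /andP[t0 t1] := sublevel01 k x.
  rewrite ger0_norm ?mulr_ge0 ?powR_ge0 ?eta_ge0// mulrC ler_wpM2r ?eta_ge0// /T.
  have [wk|_] := leP (w x) k; last by rewrite mul0r powR_ge0.
  by rewrite mul1r; apply: ge0_ler_powR; rewrite ?nnegrE ?enorm_ge0.
split => //.
have iag i : rintegrable mu (fun x => a k i x * g i x).
  by apply: (rintegrable_bmul (rintegrable_trunc_flux k i) (fun x => trunc_flux_bounded i x k0)); exact: rintegrable_excess.
apply: (@le_trans _ _ (\sum_(i < n) \int[mu]_x (a k i x * g i x) + SL * W)); last first.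
  by rewrite addrAC lerD2r truncated_excess_int_le.
rewrite -Rint_sum// -(RintegralZl SL measurableT wi).
have is_ := rintegrable_sum (index_enum 'I_n) iag.
rewrite -(RintegralD measurableT is_ (rintegrableZ SL wi)).
apply: le_Rintegral => //; first by apply: rintegrableD => //; exact: rintegrableZ.
move=> x _; have [x0|x0] := eqVneq (eta x) 0.
  rewrite x0 mul0r big1 ?add0r ?mulr_ge0 ?powR_ge0// => i _.
  by rewrite /a x0 !mul0r.
have Kx : K x.
  move=> j; have /andP[x1 x2] := eta_neq0 j x0; rewrite /lo /hi.
  by apply/andP; split; move: h0; lra.
have /andP[t0 t1] := sublevel01 k x; have e_0 := eta_ge0 x; have e_1 := eta_le1 x.
rewrite -(p_flux_dot (D x) p1) !mulr_sumr mulr_suml -big_split/=; apply: ler_sum => i _.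
have -> : g i x = sigma i * G i x - L i by rewrite /g indicE mem_set// mul1r.
set X := w x `^ (p - 1); have X0 : 0 <= X by exact: powR_ge0.
have sFX : `|sigma i * F i x| <= X.
  rewrite normrM; case: (sigma1 i) => ->; rewrite ?normrN normr1 mul1r; exact: p_flux_le.
have s2 : sigma i * sigma i = 1 by case: (sigma1 i) => ->; rewrite ?mulr1 ?mulrNN ?mul1r.
have -> : a k i x * (sigma i * G i x - L i) =
    (sigma i * sigma i) * (eta x * (T k x * (F i x * G i x))) - (eta x * T k x) * (L i * (sigma i * F i x)).
  by rewrite /a; ring.
rewrite s2 mul1r -addrA lerDl addrC subr_ge0.
apply: (le_trans (ler_norm _)).
rewrite normrM ger0_norm ?mulr_ge0// -[leRHS]mul1r ler_pM ?mulr_ge0//.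
  by rewrite -[leRHS]mul1r ler_pM.
by rewrite normrM ler_wpM2l.
Qed.

Lemma cvg_remainder : r m.+1%:R @[m --> \oo] --> 0.
Proof.
have mT (m : nat) : (0 : R) <= m.+1%:R by [].
have lt_near (y : R) : \forall m \near \oo, y < m.+1%:R.
  by near=> m; rewrite (@lt_trans _ _ m%:R) ?ltr_nat//; near: m; exact: nbhs_infty_gtr.
have tail0 x : (1 - T m.+1%:R x) * w x `^ (p - 1) @[m --> \oo] --> 0.
  apply: cvg_near_cst; apply: filterS (lt_near (w x)) => m wm.
  by rewrite /T (ltW wm) subrr mul0r.
have gq0 i y : gq m.+1%:R i y @[m --> \oo] --> 0.
  apply: cvg_near_cst; apply: filterS (lt_near (g i y)) => m gm.
  by rewrite /gq (lt_gtF gm).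
have tail_le m x : `|(1 - T m.+1%:R x) * w x `^ (p - 1)| <= w x `^ (p - 1).
  have /andP[t0 t1] := sublevel01 m.+1%:R x.
  rewrite ger0_norm ?mulr_ge0 ?powR_ge0 ?subr_ge0// ler_piMl ?powR_ge0//.
  by rewrite lerBlDr lerDl.
have iB i : rintegrable mu (fun y => 2 `^ q * (`|G i y| `^ q + `|L i| `^ q * \1_K y)).
  apply: rintegrableZ; apply: rintegrableD => //.
  by apply: rintegrableZ; exact: rintegrable_ocbox.
rewrite (_ : 0 = \sum_(i < n) `|L i| * (0 + 0)); last first.
  by rewrite big1// => i _; rewrite addr0 mulr0.
apply: cvg_sum_seq => i; apply: cvgMl_tmp; apply: cvgD.
  have [_] := Rdominated_cvg (fun m => rintegrable_measurable (rintegrable_tail m.+1%:R)) tail0 wi tail_le.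
  by rewrite Rintegral_cst// mul0r.
have [_] := Rdominated_cvg (fun m => rintegrable_measurable (rintegrable_excess_tail i (mT m))) (gq0 i)
  (iB i) (fun m x => excess_tail_le i x (mT m)).
by rewrite Rintegral_cst// mul0r.
Unshelve. all: by end_near. Qed.

(** The limit [k -> oo]. Monotone convergence in the extended reals yields finiteness of the energy
    as a conclusion. *)
Lemma local_energy_le :
  (\int[mu]_x (eta x * w x `^ p)%:E <=
   (M * (\int[mu]_x `|f x| + n%:R * (C1 / h) * W) + 2 * SL * W)%:E)%E.
Proof.
have -> : M * (\int[mu]_x `|f x| + n%:R * (C1 / h) * W) + 2 * SL * W = E + SL * W.
  by rewrite /E; ring.
pose v (m : nat) x : \bar R := (eta x * (T m.+1%:R x * w x `^ p))%:E.
have k1 (m : nat) : (1 : R) <= m.+1%:R by rewrite ler1n.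
have mv m : measurable_fun setT (v m).
  by apply/measurable_EFinP; exact: rintegrable_measurable (proj1 (truncated_energy_le (k1 m))).
have v0 m x : setT x -> (0%R <= v m x)%E.
  move=> _; have /andP[t0 _] := sublevel01 m.+1%:R x.
  by rewrite lee_fin !mulr_ge0 ?eta_ge0 ?powR_ge0.
have nd x : setT x -> {homo v^~ x : m l / (m <= l)%N >-> (m <= l)%E}.
  move=> _ m l ml; rewrite lee_fin ler_wpM2l ?eta_ge0// ler_wpM2r ?powR_ge0//.
  rewrite /T; have [wm|_] := leP (w x) m.+1%:R; last exact: ler0n.
  by rewrite (le_trans wm)// ler_nat.
have H := cvg_monotone_convergence measurableT mv v0 nd.
have lim_v x : limn (v^~ x) = (eta x * w x `^ p)%:E.
  apply: cvg_lim => //; apply: cvg_near_cst; near=> m.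
  have wm : w x <= m.+1%:R.
    by apply: ltW; rewrite (@lt_trans _ _ m%:R) ?ltr_nat//; near: m; exact: nbhs_infty_gtr.
  by rewrite /v /T wm mul1r.
have HE : (\int[mu]_x v m x)%E @[m --> \oo] --> (\int[mu]_x (eta x * w x `^ p)%:E)%E.
  by rewrite (_ : (\int[mu]_x _ = \int[mu]_x limn (v^~ x))%E)//; apply: eq_integral => x _; rewrite lim_v.
have Hr : (E + SL * W + r m.+1%:R)%:E @[m --> \oo] --> (E + SL * W)%:E.
  apply: cvg_EFin; first exact: nearW.
  rewrite -[X in _ --> X]addr0; apply: cvgD; first exact: cvg_cst.
  exact: cvg_remainder.
apply: (lee_cvg_to HE Hr); apply: nearW => m.
have [iT H2] := truncated_energy_le (k1 m).
by rewrite /v RintE// lee_fin.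
Unshelve. all: by end_near. Qed.

Let Q := cbox (fun j => c j - h / 2) (fun j => c j + h / 2).

Lemma half_box_sub x : Q x -> forall j, c j - h <= x ord0 j <= c j + h.
Proof. by move=> Qx j; have /andP[x1 x2] := Qx j; apply/andP; split; move: h0; lra. Qed.

(** The sup bound passes to [u] itself. Against the indicator [A] of the part of [Q] where
    [s * u > M], weak convergence gives [int A * (s * u - M) <= 0] for a nonnegative integrand. This
    supplies the local integrability of [|u|^p], which the exponent [max(1, p-1)] alone does not
    provide. *)
Lemma ae_le_local (s : R) : s = 1 \/ s = -1 ->
  {ae mu, forall x, Q x -> s * u x <= M}.
Proof.
move=> s1; pose b x : R := if M < s * u x then 1 else 0.
pose A x := \1_Q x * b x.
have mu_ := rintegrable_measurable ui.
have mQ : measurable Q by exact: measurable_cbox.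
have b01 x : 0 <= b x <= 1 by rewrite /b; case: ifP; rewrite ?lexx ?ler01.
have A0 x : 0 <= A x by rewrite mulr_ge0// ?indicE//; have /andP[] := b01 x.
have A1 x : `|A x| <= \1_(ocbox lo hi) x.
  rewrite ger0_norm// /A; have /andP[b0 b1] := b01 x.
  rewrite !indicE; case: (boolP (x \in Q)) => [/set_mem/half_box_sub Qx|_]; last by rewrite mul0r.
  rewrite mem_set ?mul1r// => j; have /andP[x1 x2] := Qx j.
  by rewrite /lo /hi; apply/andP; split; move: h0; lra.
have A1' x : `|A x| <= 1.
  by apply: (le_trans (A1 x)); rewrite indicE; case: (_ \in _).
have iA : rintegrable mu A.
  apply: rintegrable_le (rintegrable_ocbox lo hi) _ A1.
  apply: measurable_funM; first exact: measurable_indic.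
  apply: measurable_fun_ifT => //.
  by apply: measurable_fun_ltr => //; exact: measurable_funM.
have iAu : rintegrable mu (fun x => A x * u x) by exact: (rintegrable_bmul iA A1').
pose z x := s * (A x * u x) - M * A x.
have iz : rintegrable mu z by apply: rintegrableB; exact: rintegrableZ.
have z0 x : 0 <= z x.
  rewrite /z mulrCA [M * _]mulrC -mulrBr /A /b; case: ifPn => [Mu|_]; last by rewrite mulr0 mul0r.
  by rewrite mulr1 mulr_ge0 ?subr_ge0 ?(ltW Mu)// indicE.
have le0 : \int[mu]_x z x <= 0.
  rewrite (RintegralB measurableT (rintegrableZ s iAu) (rintegrableZ M iA)).
  rewrite (RintegralZl _ measurableT iAu) (RintegralZl _ measurableT iA) subr_le0.
  have H : s * \int[mu]_x (A x * moll m.+1%:R^-1 u x) @[m --> \oo] -->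
      s * \int[mu]_x (A x * u x).
    by apply: cvgMl_tmp; exact: (moll_cvg_integrable ui iA A1').
  rewrite -(cvg_lim (@Rhausdorff R) H); apply: limr_le; first exact: cvgP H.
  near=> m.
  have mh : m.+1%:R^-1 <= h by apply: ltW; near: m; exact: near_infty_natSinv_lt (PosNum h0).
  have m0 : (0 : R) < m.+1%:R^-1 by rewrite invr_gt0.
  have im := rintegrable_mul_moll m0 iA ui.
  rewrite -(RintegralZl _ measurableT im) -(RintegralZl _ measurableT iA).
  apply: le_Rintegral => //; try exact: rintegrableZ.
  move=> x _; rewrite mulrCA [leRHS]mulrC; have [x0|x0] := eqVneq (A x) 0.
    by rewrite x0 !mul0r.
  have Qx : Q x.
    by apply: contra_neqP x0 => nQ; rewrite /A indicE memNset ?mul0r.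
  rewrite ler_wpM2l//; have := moll_u_le m0 mh (half_box_sub Qx); rewrite ler_norml => /andP[].
  by case: s1 => ->; lra.
have : (\int[mu]_x `|(z x)%:E| = 0)%E.
  under eq_integral => x _ do rewrite /= ger0_norm//.
  by rewrite RintE//; congr EFin; apply/eqP; rewrite eq_le le0 Rintegral_ge0.
move/(ae_eq_integral_abs _ measurableT) => zae.
apply: filterS (zae (measurable_int _ iz)) => x /(_ I) [zx] Qx.
rewrite leNgt; apply/negP => Mu; move: zx; rewrite /z /A /b Mu indicE mem_set//.
by rewrite !mul1r mulr1; move: Mu; lra.
Unshelve. all: by end_near. Qed.

Lemma eta_ge_half_box x : Q x -> (flat 1 2^-1 ^+ 2) ^+ n <= eta x.
Proof.
move=> Qx; rewrite -[n in leLHS]card_ord -prodr_const; apply: ler_prod => j _.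
rewrite exprn_ge0 ?flat1_ge0//; apply: bell_ge; have /andP[x1 x2] := Qx j.
rewrite normrM (gtr0_norm (x := h^-1)) ?invr_gt0// ler_pdivrMr//.
by rewrite ler_norml; apply/andP; split; lra.
Qed.

Lemma box_energy_le :
  (\int[mu]_(x in Q) (w x `^ p)%:E <=
   ((flat 1 2^-1 ^+ 2) ^- n *
    (M * (\int[mu]_x `|f x| + n%:R * (C1 / h) * W) + 2 * SL * W))%:E)%E.
Proof.
have c0 : 0 < (flat 1 2^-1 ^+ 2) ^+ n :> R by rewrite !exprn_gt0 ?flat_half_gt0.
have mw := measurable_enorm_powR_comp p mG.
have mQ : measurable Q by exact: measurable_cbox.
apply: (@le_trans _ _ (\int[mu]_x (((flat 1 2^-1 ^+ 2) ^- n)%:E * (eta x * w x `^ p)%:E))%E).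
  rewrite integral_mkcond; apply: ge0_le_integral => //.
  - by move=> x _; rewrite patchE; case: ifP => // _; rewrite lee_fin powR_ge0.
  - by apply/measurable_restrict => //; rewrite setTI; apply/measurable_EFinP; exact: measurable_funTS.
  - apply/measurable_EFinP; apply: measurable_funM => //.
    by apply: measurable_funM => //; exact: measurable_eta.
  move=> x _; rewrite patchE -EFinM; case: ifPn => [/set_mem Qx|_]; last first.
    by rewrite lee_fin !mulr_ge0 ?powR_ge0 ?eta_ge0// invr_ge0 ltW.
  by rewrite lee_fin mulrA ler_peMl ?powR_ge0// mulrC ler_pdivlMr// mul1r eta_ge_half_box.
rewrite ge0_integralZl//; last 3 first.
- apply/measurable_EFinP; apply: measurable_funM => //; exact: measurable_eta.
- by move=> x _; rewrite lee_fin mulr_ge0 ?eta_ge0 ?powR_ge0.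
- by rewrite lee_fin invr_ge0 ltW.
rewrite EFinM lee_wpmul2l//; first by rewrite lee_fin invr_ge0 ltW.
exact: local_energy_le.
Qed.

End local.

(** * Covering *)
Section geometry.
Context {R : realType} {n : nat}.
Implicit Types (A Omega : set 'rV[R]_n) (x y z : 'rV[R]_n).

Lemma enormZ (t : R) x : enorm (t *: x) = `|t| * enorm x.
Proof.
rewrite /enorm -(sqrtr_sqr t) -sqrtrM ?sqr_ge0//; congr Num.sqrt.
by rewrite mulr_sumr; apply: eq_bigr => i _; rewrite mxE exprMn.
Qed.

Lemma enormN x : enorm (- x) = enorm x.
Proof. by rewrite -scaleN1r enormZ normrN normr1 mul1r. Qed.

Lemma norm_le_enorm x : `|x| <= enorm x.
Proof.
rewrite /Num.norm/= mx_normrE; apply: bigmax_le; first exact: enorm_ge0.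
by move=> -[i j] _ /=; rewrite (ord1 i) coord_le_enorm.
Qed.

Lemma enorm_le_norm x : enorm x <= n%:R * `|x|.
Proof.
apply: (le_trans (enorm_le_sum x)).
rewrite (_ : n%:R * `|x| = \sum_(i < n) `|x|); last by rewrite sumr_const card_ord mulr_natl.
apply: ler_sum => i _; rewrite [leRHS]/Num.norm/= mx_normrE.
exact: (le_bigmax _ (fun ij => `|x ij.1 ij.2|) (ord0, i)).
Qed.

(** The parameters outside [Omega] form a compact set with a least element; it is positive, and all
    earlier points of the segment are in [Omega]. *)
Lemma segment_boundary Omega x y : open Omega -> Omega x -> ~ Omega y ->
  exists2 t, 0 <= t <= 1 & boundary Omega (x + t *: (y - x)).
Proof.
move=> oO Ox Oy; pose gam (t : R) := x + t *: (y - x).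
have cg : continuous gam.
  by move=> t; apply: cvgD; [exact: cvg_cst|apply: cvgZr_tmp; exact: cvg_id].
pose S := `[0, 1]%classic `&` gam @^-1` (~` Omega).
have cS : compact S.
  apply: (subclosed_compact _ (segment_compact (a := 0) (b := 1))); last exact: subIsetl.
  apply: closedI; first exact: interval_closed.
  by apply: closed_comp => [t _|]; [exact: cg|exact: open_closedC].
have S1 : S 1 by split; [rewrite /= in_itv/= ler01 lexx|rewrite /gam/= scale1r addrC subrK].
have cid : {within S, continuous (id : R -> R)}.
  by apply: continuous_subspaceT => s; exact: cvg_id.
have [t /set_mem[/= t01 Ot] tmin] := compact_EVT_min (ex_intro _ 1 S1) cS cid.
exists t; first by move: t01; rewrite in_itv.
split; last by move=> /interior_subset.
move=> B nB.
have : \forall s \near t, B (gam s) by exact: (cg t).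
move=> /nbhs_ballP[e /= e0 He].
have t0 : 0 < t.
  rewrite lt_neqAle; move: t01; rewrite in_itv/= => /andP[-> _]; rewrite andbT.
  by apply: contra_notN Ot => /eqP <-; rewrite /gam scale0r addr0.
(* The maximum with [0] keeps [s] in the parameter interval when [e] is large. *)
pose s := Num.max 0 (t - e / 2).
have st : s < t by rewrite /s gt_max t0/= ltrBlDr ltrDl divr_gt0.
exists (gam s); split; last first.
  apply: He; rewrite /ball/= gtr0_norm ?subr_gt0// ltrBlDr -ltrBlDl.
  by rewrite lt_max; apply/orP; right; rewrite ltrD2l ltrN2 ltr_pdivrMr// ltr_pMr// ltr1n.
apply: contrapT => Os; have : t <= s.
  apply: tmin; rewrite inE; split=> //=; rewrite in_itv/= le_max lexx/=.
  by apply: ltW; apply: lt_le_trans st _; move: t01; rewrite in_itv => /andP[].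
by rewrite leNgt st.
Qed.

(** A uniform radius obtained from compactness rather than from [set_dist], so that an empty [A] is
    covered as well. *)
Lemma compactly_contained_margin A Omega : open Omega -> compactly_contained A Omega ->
  exists2 d : R, 0 < d & forall x y, A x -> `|x - y| < d -> Omega y.
Proof.
move=> oO [cA AO].
have /compact_near_coveringP H := cA.
have : \forall e \near (0 : R)^'+, closure A `<=` [set x | ball x e `<=` Omega].
  apply: H => x /AO Ox.
  have /nbhs_ballP[e /= e0 He] : nbhs x Omega by exact: open_nbhs_nbhs.
  exists (ball x (e / 2), [set d | d < e / 2]) => /=.
    split; first by apply: nbhsx_ballx; rewrite divr_gt0.
    by apply: nbhs_right_lt; rewrite divr_gt0.
  move=> [z d] /= [xz de] y zy; apply: He.
  rewrite (splitr e); apply: ball_triangle xz _.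
  exact: le_ball (ltW de) _ zy.
move=> Hd; have [d [Hd' d0]] : exists d : R, closure A `<=` [set x | ball x d `<=` Omega] /\ 0 < d.
  near (0 : R)^'+ => d; exists d; split; last by near: d; exact: nbhs_right_gt.
  by near: d.
exists d => // x y Ax xy; apply: (Hd' x); first exact: subset_closure.
by rewrite -ball_normE.
Unshelve. all: by end_near. Qed.

Lemma set_dist_margin A Omega x y : open Omega -> A `<=` Omega -> A x ->
  enorm (y - x) < set_dist A (boundary Omega) -> Omega y.
Proof.
move=> oO AO Ax xy; apply: contrapT => Oy.
have [t /andP[t0 t1] bt] := segment_boundary oO (AO _ Ax) Oy.
move: xy; apply/negP; rewrite -leNgt.
apply: (@le_trans _ _ (enorm (x - (x + t *: (y - x))))).
  apply: ge_inf; last by exists x, (x + t *: (y - x)).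
  by exists 0 => _ [a [b [_ _ ->]]]; exact: enorm_ge0.
by rewrite opprD addrA subrr add0r enormN enormZ ger0_norm// ler_piMl ?enorm_ge0.
Qed.

(** An infimum over the empty set would be [0], so a boundary point must be exhibited: a segment
    from [A] to a point beyond the ball of radius [r] leaves [Omega]. Such a point exists because
    [0 < n]. *)
Lemma set_dist_gt0 A Omega r : (0 < n)%N -> open Omega -> Omega `<=` eball 0 r ->
  compactly_contained A Omega -> A !=set0 -> 0 < set_dist A (boundary Omega).
Proof.
move=> n0 oO Or AO [x Ax].
have [d d0 Hd] := compactly_contained_margin oO AO.
have AsO : A `<=` Omega by apply: subset_trans AO.2; exact: subset_closure.
apply: (lt_le_trans d0); apply: lb_le_inf.
  pose y : 'rV[R]_n := const_mx (`|r| + 1).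
  have Oy : ~ Omega y.
    move=> /Or; rewrite /eball/= subr0; apply/negP; rewrite -leNgt.
    have := coord_le_enorm y (Ordinal n0); rewrite mxE ger0_norm ?addr_ge0//.
    by have := ler_norm r; lra.
  have [t _ bt] := segment_boundary oO (AsO _ Ax) Oy.
  by exists (enorm (x - (x + t *: (y - x)))), x, (x + t *: (y - x)).
move=> _ [a [b [Aa bb ->]]]; apply: (le_trans _ (norm_le_enorm _)).
rewrite leNgt; apply/negP => /(Hd _ _ Aa) Ob.
by apply: bb.2; rewrite /interior; exact: open_nbhs_nbhs.
Qed.

(** The centres start at [- r] with spacing [h], and each coordinate is rounded to the nearest one,
    whence the [1 / 2]. The count depends on [r] and [h] only, as the final constant must. *)
Definition grid_size (r h : R) : nat := (Num.truncn (2 * r / h + 1 / 2)).+1.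

Definition grid_center (r h : R) N (k : {ffun 'I_n -> 'I_N}) (j : 'I_n) : R :=
  - r + (k j)%:R * h.

Lemma grid_cover (r h : R) x : 0 < h -> (forall j, `|x ord0 j| <= r) ->
  exists k : {ffun 'I_n -> 'I_(grid_size r h)},
    cbox (fun j => grid_center r h k j - h / 2) (fun j => grid_center r h k j + h / 2) x.
Proof.
move=> h0 xr.
have v0 j : 0 <= (x ord0 j + r) / h + 1 / 2.
  by have := xr j; rewrite ler_norml => /andP[? _]; rewrite addr_ge0// divr_ge0 ?(ltW h0)//; lra.
have kN j : (Num.truncn ((x ord0 j + r) / h + 1 / 2) < grid_size r h)%N.
  rewrite ltnS le_truncn// lerD2r ler_pM2r ?invr_gt0//.
  by have := xr j; rewrite ler_norml => /andP[_ ?]; lra.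
exists [ffun j => Ordinal (kN j)] => j; rewrite /grid_center ffunE/=.
have /andP[t1 t2] := truncn_itv (v0 j).
set k := (Num.truncn _)%:R in t1 *.
have t3 : (x ord0 j + r) / h + 1 / 2 < k + 1 by move: t2; rewrite -[(Num.truncn _).+1%:R]natr1.
have e1 : k * h <= x ord0 j + r + h / 2.
  have : k * h <= ((x ord0 j + r) / h + 1 / 2) * h by rewrite ler_pM2r.
  by rewrite mulrDl mulfVK ?gt_eqF//; lra.
have e2 : x ord0 j + r + h / 2 <= (k + 1) * h.
  have : ((x ord0 j + r) / h + 1 / 2) * h <= (k + 1) * h by rewrite ler_pM2r// ltW.
  by rewrite mulrDl mulfVK ?gt_eqF//; lra.
by apply/andP; split; move: e1 e2; lra.
Qed.

End geometry.

(** * Membership in L^q, null sets and finite covers *)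

Section glue.
Context d (T : measurableType d) (R : realType) (mu : {measure set T -> \bar R}).
Implicit Types (A B : set T) (v : T -> R).

Lemma Lfun_powRP (q : R) v : 1 <= q ->
  v \in Lfun mu q%:E <->
  measurable_fun setT v /\ rintegrable mu (fun x => `|v x| `^ q).
Proof.
move=> q1; split=> [vq|[mv iv]].
  split; last exact: Lfun_integrable.
  by move: vq; rewrite inE => /andP[/[!inE]/=].
rewrite inE; apply/andP; split; rewrite inE//= /finite_norm unlock /Lnorm.
rewrite poweR_lty//; have /integrableP[_] := iv.
apply: le_lt_trans; apply: ge0_le_integral => //.
- by move=> x _; exact: poweR_ge0.
- apply/measurable_EFinP; apply: (measurableT_comp (measurable_powR q)).
  exact: measurableT_comp.
- by apply: measurableT_comp => //; exact: measurable_int iv.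
by move=> x _ /=; rewrite lee_fin ler_norm.
Qed.

Lemma rintegrable_powR_le1 (q : R) v A : 1 <= q -> measurable A -> (mu A < +oo)%E ->
  measurable_fun setT v -> (forall x, ~ A x -> v x = 0) ->
  rintegrable mu (fun x => `|v x| `^ q) -> rintegrable mu v.
Proof.
move=> q1 mA Aoo mv v0 vq.
apply: rintegrable_le (rintegrableD (rintegrable_indic mA Aoo) vq) mv _ => x.
rewrite indicE; have [xA|xA] := pselect (A x); last first.
  by rewrite v0// normr0 addr_ge0// powR_ge0.
rewrite mem_set//; have [vx|vx] := leP `|v x| 1.
  by rewrite -[leLHS]addr0 lerD// powR_ge0.
rewrite -[leLHS]add0r lerD//; rewrite -[leLHS]powRr1//.
by apply: ler_powR => //; exact: ltW.
Qed.

Lemma Rint_ae_eq v1 v2 : measurable_fun setT v1 -> measurable_fun setT v2 ->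
  {ae mu, forall x, v1 x = v2 x} -> \int[mu]_x v1 x = \int[mu]_x v2 x.
Proof.
move=> m1 m2 v12; rewrite /Rintegral; congr fine; apply: ae_eq_integral => //.
- exact/measurable_EFinP.
- exact/measurable_EFinP.
- by apply: filterS v12 => x -> _.
Qed.

Lemma integral_cover (I : finType) (P : pred I) (Q : I -> set T) (A : set T)
    (v : T -> \bar R) (B : I -> \bar R) :
  measurable A -> (forall k, measurable (Q k)) -> measurable_fun setT v ->
  (forall x, (0 <= v x)%E) -> (forall x, A x -> exists2 k, P k & Q k x) ->
  (forall k, P k -> (\int[mu]_(x in Q k) v x <= B k)%E) ->
  (\int[mu]_(x in A) v x <= \sum_(k | P k) B k)%E.
Proof.
move=> mA mQ mv v0 AQ vB.
have mvA C : measurable C -> measurable_fun setT (v \_ C).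
  by move=> mC; apply/measurable_restrict => //; rewrite setTI; exact: measurable_funTS.
have vA0 C x : (0 <= (v \_ C) x)%E by rewrite patchE; case: ifP.
rewrite integral_mkcond.
apply: (@le_trans _ _ (\int[mu]_x \sum_(k <- index_enum I | P k) (v \_ (Q k)) x)%E).
  apply: ge0_le_integral => //; [exact: mvA| |].
    by under eq_fun do rewrite -big_filter; apply: emeasurable_sum => k; exact: mvA.
  move=> x _; rewrite patchE; case: ifPn => [/set_mem/AQ[k Pk Qx]|_].
    rewrite (bigD1 k)//= [X in (_ <= X + _)%E]patchE mem_set//.
    by rewrite leeDl// sume_ge0.
  by apply: sume_ge0.
under eq_integral do rewrite -big_filter.
rewrite ge0_integral_sum//; last by move=> k; exact: mvA.
by rewrite big_filter; apply: lee_sum => k Pk; rewrite -integral_mkcond; exact: vB.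
Qed.

End glue.

(** * Restriction of weak derivatives to subdomains *)

Section test_restrict.
Context {R : realType} {n : nat}.
Local Notation mu := (@lebesgue_rV R n).
Implicit Types (A Omega : set 'rV[R]_n) (phi : 'rV[R]_n -> R).

Lemma test_functionW A Omega phi : A `<=` Omega -> test_function A phi -> test_function Omega phi.
Proof. by move=> AO [sphi [cphi phiA]]; split => //; split => //; exact: subset_trans AO. Qed.

Lemma test_function_eq0 A phi x : test_function A phi -> ~ A x -> phi x = 0.
Proof.
move=> [_ [_ phiA]] Ax; apply/eqP/negPn/negP => phix; apply: Ax; apply: phiA.
exact: subset_closure.
Qed.

Lemma test_function_partial_eq0 A phi i x : test_function A phi -> ~ A x -> partial i phi x = 0.
Proof.
move=> [_ [_ phiA]] Ax.
have : is_derive x (delta_mx ord0 i) phi 0.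
  apply: (@near_eq_is_derive _ _ _ (cst 0)).
  have : nbhs x (~` closure [set x | phi x != 0]).
    apply: open_nbhs_nbhs; split; last by move=> /phiA.
    by apply: closed_openC; exact: closed_closure.
  apply: filterS => y ny /=; apply/esym/eqP/negPn/negP => phiy; apply: ny.
  exact: subset_closure.
by case.
Qed.

Lemma Rintegral_subset (A Omega : set 'rV[R]_n) (v : 'rV[R]_n -> R) : A `<=` Omega ->
  (forall x, ~ A x -> v x = 0) ->
  \int[mu]_(x in A) v x = \int[mu]_(x in Omega) v x.
Proof.
move=> AO v0; rewrite Rintegral_mkcond [RHS]Rintegral_mkcond.
apply: eq_Rintegral => x _; rewrite !patchE.
case: ifPn => [/set_mem/AO xO|/negP xA]; first by rewrite mem_set.
by case: ifP => // _; rewrite v0// => Ax; apply: xA; exact: mem_set.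
Qed.

Lemma weak_gradientW A Omega u (Du : 'rV[R]_n -> 'rV[R]_n) : A `<=` Omega ->
  weak_gradient Omega u Du -> weak_gradient A u Du.
Proof.
move=> AO uDu phi tphi i.
rewrite (Rintegral_subset AO); last first.
  by move=> x Ax; rewrite (test_function_partial_eq0 _ tphi Ax) mulr0.
rewrite (uDu _ (test_functionW AO tphi)); congr (- _).
apply/esym; apply: Rintegral_subset => // x Ax.
by rewrite (test_function_eq0 tphi Ax) mulr0.
Qed.

(** Comparison with the largest coordinate works for every positive exponent, without convexity;
    dimension zero has no such coordinate and is separate. *)
Lemma enorm_powR_le (q : R) (xi : 'rV[R]_n) : 0 < q ->
  enorm xi `^ q <= n%:R `^ q * \sum_(i < n) `|xi ord0 i| `^ q.
Proof.
move=> q0; case: n xi => [|m] xi.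
  rewrite /enorm big_ord0 sqrtr0 powR0 ?gt_eqF// mulr_ge0 ?powR_ge0//.
  by rewrite sumr_ge0// => i _; exact: powR_ge0.
case: (arg_maxP (fun i => `|xi ord0 i|) (erefl (xpredT (ord0 : 'I_m.+1)))) => i _ Hi.
apply: (@le_trans _ _ ((m.+1%:R * `|xi ord0 i|) `^ q)).
  apply: ge0_ler_powR; rewrite ?nnegrE ?enorm_ge0 ?mulr_ge0 ?(ltW q0)//.
  apply: (le_trans (enorm_le_sum xi)).
  rewrite [leRHS](_ : _ = \sum_(j < m.+1) `|xi ord0 i|); last by rewrite sumr_const card_ord mulr_natl.
  by apply: ler_sum => j _; exact: Hi.
rewrite powRM// ler_wpM2l ?powR_ge0// (bigD1 i)//= lerDl.
by rewrite sumr_ge0// => j _; exact: powR_ge0.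
Qed.

End test_restrict.

(** * The estimate on subdomains *)
Section global.
Context {R : realType} {n : nat}.
Local Notation mu := (@lebesgue_rV R n).
Variables (p r Cb C1 : R) (Omega N : set 'rV[R]_n) (f u : 'rV[R]_n -> R).
Variables (Du : 'rV[R]_n -> 'rV[R]_n) (sigma : 'I_n -> R) (L : 'rV[R]_n).

Let q := Num.max 1 (p - 1).

Hypothesis p1 : 1 < p.
Hypothesis oO : open Omega.
Hypothesis Or : Omega `<=` eball 0 r.
Hypothesis fO : Lp_on Omega 1 f.
Hypothesis uDu : sobolev Omega q u Du.
Hypothesis Duf : weak_p_laplace Omega p Du f.
Hypothesis sigma1 : forall i, sigma i = 1 \/ sigma i = -1.
Hypothesis mN : measurable N.
Hypothesis N0 : mu N = 0%E.
Hypothesis LDu : forall x, Omega x -> ~ N x -> forall i, L ord0 i <= sigma i * Du x ord0 i.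
Hypothesis HCb : forall t : R, bump t <= Cb.
Hypothesis HC1 : forall t : R, `|bell^`()%classic t| <= C1.

Let q1 : 1 <= q. Proof. by rewrite le_max lexx. Qed.
Let mO : measurable Omega. Proof. exact: open_measurable_rV. Qed.

Let coord_lt x j : Omega x -> `|x ord0 j| < r.
Proof. by move=> /Or; rewrite /eball/= subr0; apply: le_lt_trans; exact: coord_le_enorm. Qed.

Let Oty : (mu Omega < +oo)%E.
Proof.
apply: le_lt_trans (lebesgue_ocbox_lty (fun=> - r) (fun=> r)).
apply: le_measure; rewrite ?inE//; first exact: measurable_ocbox.
by move=> x Ox j; have := coord_lt j Ox; rewrite ltr_norml => /andP[-> /ltW].
Qed.

Let ut := u \_ Omega.
Let ft := f \_ Omega.
Let D1 x : 'rV[R]_n := if x \in Omega then Du x else 0.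

(* [Du] corrected on the null set [N], so that the one-sided bounds on the
   derivatives hold everywhere in [Omega]. *)
Let D x : 'rV[R]_n := if x \in Omega then
  (if x \in N then \row_i (sigma i * L ord0 i) else Du x) else 0.

Let D1E i x : D1 x ord0 i = ((fun x => Du x ord0 i) \_ Omega) x.
Proof. by rewrite /D1 patchE; case: ifP => // _; rewrite mxE. Qed.

Let DE i x : D x ord0 i = \1_N x * (\1_Omega x * (sigma i * L ord0 i)) +
  (1 - \1_N x) * D1 x ord0 i.
Proof.
rewrite /D /D1 !indicE; case: (x \in Omega); case: (x \in N);
  by rewrite ?mxE ?mul1r ?mul0r ?subrr ?subr0 ?mul0r ?mul1r ?addr0 ?add0r ?mulr0.
Qed.

Let mD1 i : measurable_fun setT (fun x => D1 x ord0 i).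
Proof.
under eq_fun do rewrite D1E.
by have [_ /(_ i) H _] := uDu; have [] := (Lfun_powRP _ _ q1).1 H.
Qed.

Let mD i : measurable_fun setT (fun x => D x ord0 i).
Proof.
under eq_fun do rewrite DE.
apply: measurable_funD; apply: measurable_funM => //.
  by apply: measurable_funM => //; exact: measurable_indic.
by apply: measurable_funB => //; exact: measurable_indic.
Qed.

Let Dae : {ae mu, forall x, D x = D1 x}.
Proof.
exists N; split => // x /= H; apply: contrapT => nN; apply: H.
by rewrite /D /D1; case: ifP => // _; rewrite memNset.
Qed.

Let D_out x : ~ Omega x -> D x = 0.
Proof. by move=> Ox; rewrite /D memNset. Qed.

Let Dq i : rintegrable mu (fun x => `|D x ord0 i| `^ q).
Proof.
have [_ /(_ i) H _] := uDu; have [_ H1] := (Lfun_powRP _ _ q1).1 H.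
apply: (rintegrable_le (rintegrableD H1
  (rintegrableZ (`|L ord0 i| `^ q) (rintegrable_indic mO Oty)))).
  by apply: (measurableT_comp (measurable_powR q)); exact: measurableT_comp.
move=> x; rewrite ger0_norm ?powR_ge0// -D1E.
have q0 : q != 0 by rewrite gt_eqF// (lt_le_trans ltr01).
rewrite /D /D1 indicE; case: (x \in Omega); last first.
  by rewrite mxE normr0 powR0// addr0.
case: (x \in N); last by rewrite lerDl mulr_ge0 ?powR_ge0.
rewrite mxE normrM (_ : `|sigma i| = 1); last by case: (sigma1 i) => ->; rewrite ?normrN normr1.
by rewrite mul1r mulr1 lerDr powR_ge0.
Qed.

Let Di i : rintegrable mu (fun x => D x ord0 i).
Proof.
by apply: (rintegrable_powR_le1 q1 mO Oty (mD i)) (Dq i) => x Ox; rewrite D_out// mxE.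
Qed.

(** On [Omega], of finite measure, [w^(p-1) <= 1 + w^q] because [0 < p - 1 <= q]. *)
Let Dwi : rintegrable mu (fun x => enorm (D x) `^ (p - 1)).
Proof.
have pp : 0 < p - 1 by rewrite subr_gt0.
have iS : rintegrable mu (fun x => \1_Omega x + n%:R `^ q * \sum_(i < n) `|D x ord0 i| `^ q).
  apply: rintegrableD; first exact: rintegrable_indic.
  by apply: rintegrableZ; exact: rintegrable_sum.
apply: rintegrable_le iS _ _ => [|x]; first exact: measurable_enorm_powR_comp.
rewrite ger0_norm ?powR_ge0// indicE.
have [Ox|Ox] := pselect (Omega x); last first.
  rewrite D_out// -[0](scale0r 0) enormZ normr0 mul0r powR0 ?gt_eqF//.
  by rewrite addr_ge0 ?mulr_ge0 ?powR_ge0// sumr_ge0// => i _; exact: powR_ge0.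
rewrite mem_set//; have q0 : 0 < q by exact: lt_le_trans q1.
apply: (@le_trans _ _ (1 + enorm (D x) `^ q)); last by rewrite lerD2l enorm_powR_le.
have [w1|w1] := leP (enorm (D x)) 1.
  rewrite -[leLHS]addr0 lerD ?powR_ge0//.
  apply: (@le_trans _ _ (1 `^ (p - 1))); last by rewrite powR1.
  by apply: ge0_ler_powR; rewrite ?nnegrE ?enorm_ge0// ltW.
rewrite -[leLHS]add0r lerD//; apply: ler_powR; first exact: ltW.
by rewrite le_max lexx orbT.
Qed.

Let iut : rintegrable mu ut.
Proof.
have [H _ _] := uDu; have [mu_ Hq] := (Lfun_powRP _ _ q1).1 H.
by apply: (rintegrable_powR_le1 q1 mO Oty mu_) Hq => x Ox; rewrite /ut patchE memNset.
Qed.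

Let ift : rintegrable mu ft.
Proof. exact: (Lfun1_integrable _ _).1 fO. Qed.

Let wgrad lo hi : cbox lo hi `<=` Omega -> weak_grad_on lo hi ut (fun i x => D x ord0 i).
Proof.
move=> KO H sH Hs i; have tH := test_function_tensor sH Hs KO.
have [_ _ /(_ _ tH i)] := uDu.
rewrite Rintegral_mkcond [X in _ = - X]Rintegral_mkcond.
have mH := measurable_smooth_tensor sH.
rewrite (_ : _ \_ Omega = fun y => ut y * partial i (tensor H) y); last first.
  by apply/funext => x; rewrite /ut !patchE; case: ifP => // _; rewrite mul0r.
move=> ->; congr (- _).
rewrite (_ : _ \_ Omega = fun y => D1 y ord0 i * tensor H y); last first.
  by apply/funext => x; rewrite D1E !patchE; case: ifP => // _; rewrite mul0r.
apply: Rint_ae_eq; [exact: measurable_funM|exact: measurable_funM|].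
by apply: filterS Dae => x ->.
Qed.

Let wdiv lo hi : cbox lo hi `<=` Omega ->
  weak_div_on lo hi (fun i x => p_flux p (D x) ord0 i) ft.
Proof.
move=> KO H sH Hs; have tH := test_function_tensor sH Hs KO.
have := Duf tH; rewrite Rintegral_mkcond [X in _ = X]Rintegral_mkcond.
rewrite (_ : (fun x => f x * tensor H x) \_ Omega = fun y => ft y * tensor H y); last first.
  by apply/funext => x; rewrite /ft !patchE; case: ifP => // _; rewrite mul0r.
move=> <-; congr (- _).
rewrite (_ : _ \_ Omega = fun x => \sum_(i < n) p_flux p (D1 x) ord0 i * partial i (tensor H) x); last first.
  apply/funext => x; rewrite /D1 patchE; case: ifP => // _; rewrite big1// => i _.
  by rewrite p_fluxE mxE mulr0 mul0r.
have mp i : measurable_fun setT (partial i (tensor H)).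
  rewrite partial_tensor//; apply: measurable_smooth_tensor.
  by apply: smooth1_upd => //; exact: smooth1_derive1.
apply: Rint_ae_eq.
- by apply: measurable_sum => i; apply: measurable_funM => //; exact: measurable_flux_comp.
- by apply: measurable_sum => i; apply: measurable_funM => //; exact: measurable_flux_comp.
- by apply: filterS Dae => x ->.
Qed.

Let LD i y : Omega y -> L ord0 i <= sigma i * D y ord0 i.
Proof.
move=> Oy; rewrite /D mem_set//; have [Ny|Ny] := pselect (N y); last by rewrite memNset// LDu.
rewrite mem_set// mxE mulrA.
by case: (sigma1 i) => ->; rewrite ?mulr1 ?mulrNN ?mul1r.
Qed.

Let W := \int[mu]_x (enorm (D x) `^ (p - 1)).
Let SL := \sum_(i < n) `|L ord0 i|.
Let M (h : R) := (h^-1 * Cb) ^+ n * \int[mu]_y `|ut y| + 5 * h * SL.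
Let E (h : R) := (flat 1 2^-1 ^+ 2) ^- n *
  (M h * (\int[mu]_x `|ft x| + n%:R * (C1 / h) * W) + 2 * SL * W).

Let I (h : R) := {ffun 'I_n -> 'I_(grid_size r h)}.
Let Q (h : R) (k : I h) := cbox (fun j => grid_center r h k j - h / 2)
  (fun j => grid_center r h k j + h / 2).

(** [9 / 2 * h] is [h / 2 + 4 * h]: a cell meeting [A] has its centre within [h / 2] of a point of
    [A] in each coordinate, and the estimate on the cell takes place in the box of half-side
    [4 * h]. *)
Definition margin (A : set 'rV[R]_n) (h : R) := forall (x y : 'rV[R]_n), A x ->
  (forall j, `|y ord0 j - x ord0 j| <= 9 / 2 * h) -> Omega y.

Let cell_sub A h (k : I h) x : 0 < h -> margin A h -> A x -> Q k x ->
  cbox (fun j => grid_center r h k j - 4 * h) (fun j => grid_center r h k j + 4 * h)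
  `<=` Omega.
Proof.
move=> h0 mA Ax Qx y Ky; apply: (mA x) => // j.
have /andP[a1 a2] := Qx j; have /andP[b1 b2] := Ky j.
by rewrite ler_norml; apply/andP; split; lra.
Qed.

(** Only cells that meet [A] are kept, since the enlargement of any other cell may leave [Omega]. *)
Let cell_cover A h x : 0 < h -> A `<=` Omega -> A x ->
  exists2 k : I h, `[< exists y, A y /\ Q k y >] & Q k x.
Proof.
move=> h0 AO Ax; have [k Qk] := @grid_cover R n r h x h0 (fun j => ltW (coord_lt j (AO _ Ax))).
by exists k => //; apply/asboolP; exists x.
Qed.

Lemma box_bound_ge0 h : 0 < h -> 0 <= E h.
Proof.
move=> h0.
have Cb0 : 0 <= Cb by exact: le_trans (bump_ge0 0) (HCb 0).
have C10 : 0 <= C1 by apply: le_trans (HC1 0).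
have W0 : 0 <= W by apply: Rintegral_ge0 => x _; exact: powR_ge0.
have SL0 : 0 <= SL by exact: sumr_ge0.
have u0 : 0 <= \int[mu]_y `|ut y| by exact: Rintegral_ge0.
have f0 : 0 <= \int[mu]_y `|ft y| by exact: Rintegral_ge0.
rewrite mulr_ge0 ?invr_ge0 ?exprn_ge0 ?flat1_ge0//.
rewrite addr_ge0 ?mulr_ge0// ?addr_ge0 ?mulr_ge0 ?exprn_ge0 ?mulr_ge0 ?invr_ge0 ?(ltW h0)//.
Qed.

Lemma cover_energy A h : 0 < h -> measurable A -> A `<=` Omega -> margin A h ->
  (\int[mu]_(x in A) (enorm (D x) `^ p)%:E <= (#|I h|%:R * E h)%:E)%E.
Proof.
move=> h0 mA AO marg.
apply: (le_trans (integral_cover (P := fun k => `[< exists y, A y /\ Q k y >])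
  (Q := Q (h := h)) (B := fun=> (E h)%:E) mA _ _ _ _ _)).
- by move=> k; exact: measurable_cbox.
- by apply/measurable_EFinP; exact: measurable_enorm_powR_comp.
- by move=> x; rewrite lee_fin powR_ge0.
- by move=> x; exact: cell_cover.
- move=> k /asboolP[y [Ay Qy]].
  have KO := cell_sub h0 marg Ay Qy.
  exact: (box_energy_le p1 h0 iut ift Di Dwi Dq (wgrad KO) (wdiv KO) sigma1
    (fun i z Kz => LD i (KO z Kz)) HCb HC1).
(* The number of kept cells is bounded by that of the whole grid, which depends on neither [A] nor
   [Omega]. *)
rewrite sumEFin lee_fin big_mkcond/= mulr_natl -sumr_const; apply: ler_sum => k _.
by case: ifP => // _; exact: box_bound_ge0.
Qed.

Lemma cover_u A h : 0 < h -> measurable A -> A `<=` Omega -> margin A h ->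
  (\int[mu]_(x in A) (`|ut x| `^ p)%:E < +oo)%E.
Proof.
move=> h0 mA AO marg.
have p0 : 0 <= p by apply: ltW; apply: lt_trans p1.
have mut : measurable_fun setT ut by exact: rintegrable_measurable iut.
have mup : measurable_fun setT (fun x => (`|ut x| `^ p)%:E).
  apply/measurable_EFinP; apply: (measurableT_comp (measurable_powR p)).
  exact: measurableT_comp.
have mQ k : measurable (Q (h := h) k) by exact: measurable_cbox.
have Qty k : (mu (Q (h := h) k) < +oo)%E.
  apply: le_lt_trans (lebesgue_ocbox_lty (fun j => grid_center r h k j - h) (fun j => grid_center r h k j + h)).
  apply: le_measure; rewrite ?inE//; first exact: measurable_ocbox.
  by move=> x Qx j; have /andP[a1 a2] := Qx j; apply/andP; split; lra.
apply: (le_lt_trans (integral_cover (P := fun k => `[< exists y, A y /\ Q k y >])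
  (Q := Q (h := h)) (B := fun k => ((`|M h| `^ p)%:E * mu (Q k))%E) mA _ _ _ _ _)) => //.
- by move=> x; exact: cell_cover.
- move=> k /asboolP[y [Ay Qy]].
  have KO := cell_sub h0 marg Ay Qy.
  have H s s1 := ae_le_local h0 iut Di (wgrad KO) sigma1
    (fun i z Kz => LD i (KO z Kz)) HCb (s := s) s1.
  have ae : {ae mu, forall x, Q k x -> `|ut x| <= `|M h|}.
    apply: filterS2 (H 1 (or_introl erefl)) (H (-1) (or_intror erefl)) => x H1 H2 Qx.
    have := H1 Qx; have := H2 Qx; rewrite mul1r mulN1r => H3 H4.
    by apply: le_trans (ler_norm _); rewrite ler_norml H4 andbT lerNl.
  rewrite -integral_cst//.
  apply: ae_ge0_le_integral => //.
  - exact: (measurable_funTS mup).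
  - by move=> x _; rewrite lee_fin powR_ge0.
  - apply: filterS ae => x Hx Qx; rewrite lee_fin.
    by apply: ge0_ler_powR; rewrite ?nnegrE ?normr_ge0// Hx.
- by apply: lte_sum_pinfty => k _; apply: lte_mul_pinfty => //; rewrite ?lee_fin ?powR_ge0.
Qed.

Let l := enorm L.

(** Separates the data from the constant: [SL] is at most [n] times [l], so each factor of [E h] is
    a multiple of one of the two factors in the theorem. *)
Lemma box_bound_le h : 0 < h -> E h <=
  (flat 1 2^-1 ^+ 2) ^- n *
  (((h^-1 * Cb) ^+ n + 5 * h * n%:R) * (1 + n%:R * (C1 / h)) + 2 * n%:R) *
  ((\int[mu]_x `|ft x| + W) * (\int[mu]_x `|ut x| + l)).
Proof.
move=> h0; rewrite -mulrA; apply: ler_wpM2l.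
  by rewrite invr_ge0 !exprn_ge0// flat1_ge0.
have Cb0 : 0 <= Cb by exact: le_trans (bump_ge0 0) (HCb 0).
have C10 : 0 <= C1 by apply: le_trans (HC1 0).
have W0 : 0 <= W by apply: Rintegral_ge0 => x _; exact: powR_ge0.
have SL0 : 0 <= SL by exact: sumr_ge0.
have u0 : 0 <= \int[mu]_y `|ut y| by exact: Rintegral_ge0.
have f0 : 0 <= \int[mu]_y `|ft y| by exact: Rintegral_ge0.
have l0 : 0 <= l by exact: enorm_ge0.
have SLl : SL <= n%:R * l.
  rewrite (_ : n%:R * l = \sum_(i < n) l); last by rewrite sumr_const card_ord mulr_natl.
  by apply: ler_sum => i _; exact: coord_le_enorm.
rewrite /M; move: (\int[mu]_y `|ut y|) (\int[mu]_y `|ft y|) u0 f0 => U V U0 V0.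
set a := (h^-1 * Cb) ^+ n; have a0 : 0 <= a by rewrite exprn_ge0// mulr_ge0// invr_ge0 ltW.
set b := n%:R * (C1 / h); have b0 : 0 <= b by rewrite !mulr_ge0// invr_ge0 ltW.
set m := n%:R in SLl *; have m0 : 0 <= m by exact: ler0n.
rewrite [leRHS]mulrDl; apply: lerD.
  rewrite [leRHS](_ : _ = ((a + 5 * h * m) * (U + l)) * ((1 + b) * (V + W))); last by ring.
  apply: ler_pM.
  - by rewrite addr_ge0 ?mulr_ge0// ltW.
  - exact: addr_ge0 V0 (mulr_ge0 b0 W0).
  - rewrite [leRHS]mulrDl; apply: lerD; first by rewrite ler_wpM2l// lerDl.
    rewrite -!mulrA ler_wpM2l// ler_wpM2l ?(ltW h0)//.
    by apply: (le_trans SLl); rewrite ler_wpM2l// lerDr.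
  - rewrite [leRHS]mulrDl mul1r lerD//; first by rewrite lerDl.
    by rewrite ler_wpM2l// lerDr.
rewrite [leRHS](_ : _ = 2 * (m * (U + l)) * (V + W)); last by ring.
apply: ler_pM; rewrite ?mulr_ge0//; last by rewrite lerDr.
by rewrite ler_wpM2l//; apply: (le_trans SLl); rewrite ler_wpM2l// lerDr.
Qed.

Lemma integral_norm_Omega (v : 'rV[R]_n -> R) : rintegrable mu (v \_ Omega) ->
  (\int[mu]_(x in Omega) `|v x|%:E = (\int[mu]_x `|(v \_ Omega) x|)%:E)%E.
Proof.
move=> iv; rewrite -(RintE (rintegrable_norm iv)) [LHS]integral_mkcond.
apply: eq_integral => x _.
by rewrite !patchE; case: ifP => // _; rewrite normr0.
Qed.

Lemma integral_energy_ae (a : R) (A : set 'rV[R]_n) : 0 < a -> measurable A -> A `<=` Omega ->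
  (\int[mu]_(x in A) (enorm (Du x) `^ a)%:E = \int[mu]_(x in A) (enorm (D x) `^ a)%:E)%E.
Proof.
move=> a0 mA AO.
transitivity (\int[mu]_(x in A) (enorm (D1 x) `^ a)%:E)%E.
  by apply: eq_integral => x /set_mem/AO Ox; rewrite /D1 mem_set.
apply: ge0_ae_eq_integral => //.
- by apply/measurable_EFinP; apply: measurable_funTS; exact: measurable_enorm_powR_comp.
- by apply/measurable_EFinP; apply: measurable_funTS; exact: measurable_enorm_powR_comp.
- by move=> x _; rewrite lee_fin powR_ge0.
- by move=> x _; rewrite lee_fin powR_ge0.
- by apply: filterS Dae => x -> _.
Qed.

Lemma integral_flux_Omega :
  (\int[mu]_(x in Omega) (enorm (Du x) `^ (p - 1))%:E = W%:E)%E.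
Proof.
have pp : 0 < p - 1 by rewrite subr_gt0.
rewrite (integral_energy_ae pp mO)// -(RintE Dwi) [LHS]integral_mkcond.
apply: eq_integral => x _; rewrite patchE; case: ifPn => // /negP xO.
rewrite D_out; last by move=> Ox; apply: xO; exact: mem_set.
by rewrite -[0](scale0r 0) enormZ normr0 mul0r powR0// gt_eqF.
Qed.

Lemma energy_le A h : 0 < h -> measurable A -> A `<=` Omega -> margin A h ->
  (\int[mu]_(x in A) (enorm (Du x) `^ p)%:E <=
   (#|I h|%:R * ((flat 1 2^-1 ^+ 2) ^- n *
  (((h^-1 * Cb) ^+ n + 5 * h * n%:R) * (1 + n%:R * (C1 / h)) + 2 * n%:R)))%:E *
  (\int[mu]_(x in Omega) `|f x|%:E + \int[mu]_(x in Omega) (enorm (Du x) `^ (p - 1))%:E) *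
  (\int[mu]_(x in Omega) `|u x|%:E + l%:E))%E.
Proof.
move=> h0 mA AO marg.
rewrite (integral_norm_Omega ift) (integral_norm_Omega iut) integral_flux_Omega.
rewrite (integral_energy_ae (lt_trans ltr01 p1) mA AO).
apply: (le_trans (cover_energy h0 mA AO marg)).
rewrite -!EFinD -!EFinM lee_fin -!mulrA ler_wpM2l//.
by have := box_bound_le h0; rewrite -!mulrA.
Qed.

Lemma Lp_on_restrict (A : set 'rV[R]_n) (v : 'rV[R]_n -> R) : measurable A -> A `<=` Omega ->
  measurable_fun setT (v \_ Omega) ->
  (\int[mu]_(x in A) (`|v x| `^ p)%:E < +oo)%E -> Lp_on A p v.
Proof.
move=> mA AO mv voo; apply/(Lfun_powRP _ _ (ltW p1)).
have mvA : measurable_fun setT (v \_ A).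
  rewrite (_ : v \_ A = (v \_ Omega) \_ A); last first.
    by apply/funext => x; rewrite !patchE; case: ifPn => // /set_mem/AO Ox; rewrite mem_set.
  by apply/measurable_restrict => //; rewrite setTI; exact: measurable_funTS.
split => //; apply/integrableP; split.
  apply/measurable_EFinP; apply: (measurableT_comp (measurable_powR p)).
  exact: measurableT_comp.
rewrite (_ : (\int[mu]_x _)%E = (\int[mu]_(x in A) (`|v x| `^ p)%:E)%E)//.
rewrite [RHS]integral_mkcond; apply: eq_integral => x _ /=.
rewrite ger0_norm ?powR_ge0// !patchE; case: ifP => // _.
by rewrite normr0 powR0// gt_eqF// (lt_trans ltr01).
Qed.

Lemma sobolev_restrict A h : 0 < h -> measurable A -> A `<=` Omega -> margin A h ->
  sobolev A p u Du.
Proof.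
move=> h0 mA AO marg; have p0 : 0 < p by exact: lt_trans p1.
split; last by have [_ _ uD] := uDu; exact: weak_gradientW uD.
- apply: Lp_on_restrict => //; first exact: rintegrable_measurable iut.
  apply: le_lt_trans (cover_u h0 mA AO marg).
  rewrite le_eqVlt; apply/orP; left; apply/eqP; apply: eq_integral => x /set_mem/AO Ox.
  by rewrite /ut patchE mem_set.
- move=> i; apply: Lp_on_restrict => //.
    rewrite (_ : _ \_ _ = fun x => D1 x ord0 i) //.
    by apply/funext => x; rewrite D1E.
  apply: (@le_lt_trans _ _ (\int[mu]_(x in A) (enorm (Du x) `^ p)%:E)%E); last first.
    rewrite (integral_energy_ae p0 mA AO).
    by apply: le_lt_trans (cover_energy h0 mA AO marg) _; rewrite ltry.
  rewrite (_ : (\int[mu]_(x in A) (enorm (Du x) `^ p)%:E)%E =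
     (\int[mu]_(x in A) (enorm (D1 x) `^ p)%:E)%E); last first.
    by apply: eq_integral => x /set_mem/AO Ox; rewrite /D1 mem_set.
  rewrite (_ : (\int[mu]_(x in A) (`|Du x ord0 i| `^ p)%:E)%E =
     (\int[mu]_(x in A) (`|D1 x ord0 i| `^ p)%:E)%E); last first.
    by apply: eq_integral => x /set_mem/AO Ox; rewrite /D1 mem_set.
  apply: ge0_le_integral => //.
  + apply/measurable_EFinP; apply: measurable_funTS.
    by apply: (measurableT_comp (measurable_powR p)); exact: measurableT_comp.
  + by apply/measurable_EFinP; apply: measurable_funTS; exact: measurable_enorm_powR_comp.
  move=> x _; rewrite lee_fin; apply: ge0_ler_powR; rewrite ?nnegrE ?normr_ge0 ?enorm_ge0 ?(ltW p0)//.
  exact: coord_le_enorm.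
Qed.

End global.

(** * From the margin to the distance, and the final constant *)

Lemma enorm_lt_margin (R : realType) (n : nat) (x y : 'rV[R]_n) (d : R) :
  (0 < n)%N -> 0 < d ->
  (forall j, `|y ord0 j - x ord0 j| <= 9 / 2 * (d / (10 * n%:R))) -> enorm (y - x) < d.
Proof.
move=> n0 d0 H; have n0' : (0 : R) < n%:R by rewrite ltr0n.
apply: (le_lt_trans (enorm_le_sum _)).
apply: (@le_lt_trans _ _ (\sum_(i < n) (9 / 2 * (d / (10 * n%:R))))).
  by apply: ler_sum => i _; rewrite !mxE.
rewrite sumr_const card_ord -[_ *+ n]mulr_natl.
(* The factor [10] in the step size makes the sum of all coordinates less than half of [d]. *)
rewrite (_ : n%:R * _ = 9 / 20 * d); last by field; rewrite gt_eqF.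
by lra.
Qed.

Lemma bounded_set_eball (R : realType) (n : nat) (A : set 'rV[R]_n) :
  bounded_set A -> exists2 r : R, 0 < r & A `<=` eball 0 r.
Proof.
move=> [M [Mr HM]]; have M1 : M < `|M| + 1 by rewrite (le_lt_trans (ler_norm M))// ltrDl.
exists (n%:R * (`|M| + 1) + 1) => [|x Ax].
  by rewrite ltr_wpDl// mulr_ge0// addr_ge0.
rewrite /eball/= subr0; apply: (le_lt_trans (enorm_le_norm x)).
by apply: (@le_lt_trans _ _ (n%:R * (`|M| + 1))); rewrite ?ltrDl// ler_wpM2l//; exact: HM.
Qed.

Lemma bump_bounded (R : realType) : exists C : R, forall t, bump t <= C.
Proof.
have H (t : R) : t < 0 \/ 1 < t -> bump t = 0.
  by move=> [/ltW/bump_le0|/ltW/bump_ge1].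
have [C _ HC] := smooth1_bounded (@smooth1_bump R) H.
by exists C => t; exact: le_trans (ler_norm _) (HC t).
Qed.

Lemma bell_derive_bounded (R : realType) : exists C : R, forall t, `|(bell^`()%classic t : R)| <= C.
Proof.
have [C _ HC] := smooth1_bounded (smooth1_derive1 (@smooth1_bell R)) (derive1_supp (@bell_eq0 R)).
by exists C.
Qed.

Theorem theorem1p1 (R : realType) (n : nat) (n_gt0 : (0 < n)%N) :
  exists C : R -> R -> R, (forall r d, 0 < C r d) /\
  forall (p : R) (Omega : set 'rV[R]_n) (f u : 'rV[R]_n -> R)
    (Du : 'rV[R]_n -> 'rV[R]_n) (sigma : 'I_n -> R) (L : 'rV[R]_n),
  1 < p ->
  open Omega -> bounded_set Omega ->
  Lp_on Omega 1 f ->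
  sobolev Omega (Num.max 1 (p - 1)) u Du ->
  weak_p_laplace Omega p Du f ->
  (forall i, sigma i = 1 \/ sigma i = -1) ->
  (forall i, {ae @lebesgue_rV R n,
     forall x, Omega x -> L ord0 i <= sigma i * Du x ord0 i}) ->
  sobolev_loc Omega p u Du /\
  forall (r : R) (Omega' : set 'rV[R]_n),
  0 < r -> Omega `<=` eball 0 r ->
  open Omega' -> compactly_contained Omega' Omega ->
  (\int[@lebesgue_rV R n]_(x in Omega') (enorm (Du x) `^ p)%:E
   <= (C r (set_dist Omega' (boundary Omega)))%:E
      * (\int[@lebesgue_rV R n]_(x in Omega) `|f x|%:E
         + \int[@lebesgue_rV R n]_(x in Omega) (enorm (Du x) `^ (p - 1))%:E)
      * (\int[@lebesgue_rV R n]_(x in Omega) `|u x|%:E + (enorm L)%:E))%E.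
Proof.
have [Cb HCb] := bump_bounded R; have [C1 HC1] := bell_derive_bounded R.
pose step_ (d : R) := d / (10 * n%:R).
pose K (r h : R) := #|{ffun 'I_n -> 'I_(grid_size r h)}|%:R * ((flat 1 2^-1 ^+ 2) ^- n *
  (((h^-1 * Cb) ^+ n + 5 * h * n%:R) * (1 + n%:R * (C1 / h)) + 2 * n%:R)).
(* Positivity is required for all real [r] and [d], including values for which [K] has no meaning;
   hence the absolute value and the [1]. *)
exists (fun r d => 1 + `|K r (step_ d)|); split=> [r d|]; first by rewrite ltr_wpDr.
move=> p Omega f u Du sigma L p1 oO bO fO uDu Duf sigma1 LDu.
have step_gt0 d : 0 < d -> 0 < step_ d.
  by move=> d0; rewrite divr_gt0// mulr_gt0// ltr0n.
have [N [mN N0 NL]] : {ae @lebesgue_rV R n, forall x, forall i, Omega x -> L ord0 i <= sigma i * Du x ord0 i}.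
  by apply: filter_forall => i; exact: LDu.
have LN x : Omega x -> ~ N x -> forall i, L ord0 i <= sigma i * Du x ord0 i.
  by move=> Ox Nx i; apply: contra_notP Nx => H; apply: NL => /= /(_ i Ox).
split.
  move=> A oA AO; have [d d0 Hd] := compactly_contained_margin oO AO.
  have [r r0 Or] := bounded_set_eball bO.
  have H := sobolev_restrict p1 oO Or fO uDu Duf sigma1 mN N0 LN HCb HC1 (step_gt0 _ d0).
  apply: H.
  - exact: open_measurable_rV.
  - by apply: subset_trans AO.2; exact: subset_closure.
  - move=> x y Ax xy; apply: (Hd x) => //.
    rewrite -normrN opprB; apply: (le_lt_trans (norm_le_enorm _)).
    exact: enorm_lt_margin.
move=> r Omega' r0 Or oO' cO'.
have F0 : (0 <= \int[@lebesgue_rV R n]_(x in Omega) `|f x|%:E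
         + \int[@lebesgue_rV R n]_(x in Omega) (enorm (Du x) `^ (p - 1))%:E)%E.
  by rewrite adde_ge0// integral_ge0// => x _; rewrite lee_fin ?powR_ge0.
have U0 : (0 <= \int[@lebesgue_rV R n]_(x in Omega) `|u x|%:E + (enorm L)%:E)%E.
  by rewrite adde_ge0// ?lee_fin ?enorm_ge0// integral_ge0.
(* For an empty [Omega'] the value of [set_dist] is the default [0], which yields no positive grid
   step; the left side is then zero. *)
have [A0|/set0P A0] := eqVneq Omega' set0.
  rewrite A0 integral_set0 mule_ge0// mule_ge0// lee_fin addr_ge0//.
have d0 := set_dist_gt0 n_gt0 oO Or cO' A0.
have O'O : Omega' `<=` Omega by apply: subset_trans cO'.2; exact: subset_closure.
have marg : margin Omega Omega' (step_ (set_dist Omega' (boundary Omega))).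
  move=> x y Ax xy; apply: (set_dist_margin oO O'O Ax).
  exact: enorm_lt_margin.
have H := energy_le p1 oO Or fO uDu Duf sigma1 mN N0 LN HCb HC1 (step_gt0 _ d0)
  (open_measurable_rV oO') O'O marg.
apply: (le_trans H); rewrite lee_wpmul2r// lee_wpmul2r// lee_fin.
by apply: (le_trans (ler_norm _)); rewrite lerDr.
Qed.
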